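(* Let $n,k\ge1$, $T>0$, let $F=(F^{ij}):\mathbb{R}^k\to\mathbb{R}^{k\times n}$ ($1\le i\le k$, $1\le j\le n$) be a $C^2$ map, and assume that the system of conservation laws $$\partial_t U^i+\sum_{j=1}^n\partial_{x_j}\bigl(F^{ij}(U)\bigr)=0,\qquad i=1,\dots,k,$$ has a strictly convex entropy, i.e. there is a $C^2$ map $(\eta,q):\mathbb{R}^k\to\mathbb{R}\times\mathbb{R}^n$ and a constant $c_0>0$ such that $D^2\eta\ge c_0\,\mathrm{Id}$ and $\sum_{i=1}^k\partial_i\eta\,\partial_lF^{ij}=\partial_l q^j$ on $\mathbb{R}^k$ for all $1\le l\le k$, $1\le j\le n$. Assume that $U:[0,T]\times\mathbb{R}^n\to\mathbb{R}^k$ is a bounded Lipschitz solution of this system and that $\nu$ is a bounded admissible measure-valued solution of it (with respect to the entropy pair $(\eta,q)$) with initial data $U_0=U(0,\cdot)$. Then $\nu_{t,x}=\delta_{U(t,x)}$ for a.e. $(t,x)\in[0,T]\times\mathbb{R}^n$.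
   Context: A bounded admissible measure-valued solution of the system with initial data $U_0\in L^\infty(\mathbb{R}^n;\mathbb{R}^k)$ is a (Lebesgue-)measurable family $\nu=(\nu_{t,x})$ of probability measures on $\mathbb{R}^k$, parametrized by $(t,x)\in[0,T]\times\mathbb{R}^n$, whose supports are all contained in a fixed bounded subset of $\mathbb{R}^k$, such that, writing $\langle\nu_{t,x},g(\xi)\rangle=\int_{\mathbb{R}^k}g(\xi)\,\nu_{t,x}(d\xi)$: (1) $t\mapsto\langle\nu_{t,\cdot},\xi\rangle$ is a weakly$^*$ continuous map with values in $L^\infty(\mathbb{R}^n;\mathbb{R}^k)$; (2) $\partial_t\langle\nu,\xi\rangle+\operatorname{div}_x\langle\nu,F(\xi)\rangle=0$ with $\langle\nu_{0,x},\xi\rangle=U_0(x)$ in the sense of distributions, i.e. for every $i$ and every $\psi\in C_c^\infty((-T,T)\times\mathbb{R}^n)$, $$\int_0^T\!\!\int_{\mathbb{R}^n}\Bigl[\partial_t\psi\,\langle\nu_{t,x},\xi^i\rangle+\sum_j\partial_{x_j}\psi\,\langle\nu_{t,x},F^{ij}(\xi)\rangle\Bigr]dx\,dt+\int_{\mathbb{R}^n}\psi(0,x)\,U_0^i(x)\,dx=0;$$ (3) $\partial_t\langle\nu,\eta(\xi)\rangle+\operatorname{div}_x\langle\nu,q(\xi)\rangle\le0$ with $\langle\nu_{0,x},\eta(\xi)\rangle=\eta(U_0(x))$ in the sense of distributions, i.e. for every nonnegative $\psi\in C_c^\infty((-T,T)\times\mathbb{R}^n)$, $$\int_0^T\!\!\int_{\mathbb{R}^n}\Bigl[\partial_t\psi\,\langle\nu_{t,x},\eta(\xi)\rangle+\sum_j\partial_{x_j}\psi\,\langle\nu_{t,x},q^j(\xi)\rangle\Bigr]dx\,dt+\int_{\mathbb{R}^n}\psi(0,x)\,\eta(U_0(x))\,dx\ge0.$$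 A bounded Lipschitz solution $U$ is a bounded, Lipschitz continuous function on $[0,T]\times\mathbb{R}^n$ satisfying the system a.e. *)

(* Defs.v *)
From HB Require Import structures.
From mathcomp Require Import all_boot all_order all_algebra.
From mathcomp Require Import all_classical all_reals all_analysis.
From mathcomp Require Import measurable_realfun.
Set Implicit Arguments. Unset Strict Implicit. Unset Printing Implicit Defensive.
Import Order.TTheory GRing.Theory Num.Theory.
Import numFieldNormedType.Exports.
Local Open Scope classical_set_scope.
Local Open Scope ring_scope.

(* Matrices, hence the spaces 'rV_n that model R^n, carry the Borel sigma-algebra
   of their norm topology. *)
Fact borel_mx_display : measure_display. Proof. exact: default_measure_display. Qed.

Section borel_matrix.
Variables (R : realType) (m n : nat).
Let M := 'M[R]_(m, n).
Let s0 : <<s @open M >> set0. Proof. exact: sigma_algebra0. Qed.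
Let sC A : <<s @open M >> A -> <<s @open M >> (~` A).
Proof. exact: sigma_algebraC. Qed.
Let sU (F : (set M)^nat) :
  (forall i, <<s @open M >> (F i)) -> <<s @open M >> (\bigcup_i F i).
Proof. exact: sigma_algebra_bigcup. Qed.
HB.instance Definition _ :=
  @isMeasurable.Build borel_mx_display 'M[R]_(m, n) <<s @open M >> s0 sC sU.
End borel_matrix.

Section lebesgue_rV.
Variable R : realType.

Definition rV_cons n (z : measurableTypeR R * 'rV[R]_n) : 'rV[R]_n.+1 :=
  row_mx (z.1%:M : 'rV[R]_1) z.2.

Definition rV_uncons n (x : 'rV[R]_n.+1) : measurableTypeR R * 'rV[R]_n :=
  (x 0 0, rsubmx (x : 'rV[R]_(1 + n))).

Lemma rV_consK n : cancel (@rV_cons n) (@rV_uncons n).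
Proof.
case=> t x; rewrite /rV_uncons /rV_cons /= row_mxKr; congr pair.
rewrite mxE; case: split_ordP => j j0; last by move/(congr1 val): j0.
by rewrite mxE ord1 eqxx mulr1n.
Qed.

Lemma open_measurable_rV n (A : set 'rV[R]_n) : open A -> measurable A.
Proof. by move=> oA; apply: sub_sigma_algebra. Qed.

Lemma rV_approx n (x : 'rV[R]_n) (e : R) : 0 < e ->
  exists c : 'rV[rat]_n, ball x e (map_mx ratr c).
Proof.
move=> e0.
have h i : exists q : rat, ball (x 0 i) e (ratr q : R).
  have xe : x 0 i - e < x 0 i + e by rewrite ltrD2l gt0_cp.
  have [q] := rat_in_itvoo xe; rewrite in_itv/= => /andP[q1 q2].
  by exists q; rewrite /ball/= ltr_distlC q1 q2.
have [c cP] := choice h.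
exists (\row_i c i); split => // i j; rewrite !mxE ord1; exact: cP.
Qed.

Lemma open_measurable_prod n (A : set (R * 'rV[R]_n)) : open A ->
  measurable (A : set (measurableTypeR R * 'rV[R]_n)).
Proof.
move=> oA.
pose F (i : rat * 'rV[rat]_n * nat) : set (R * 'rV[R]_n) :=
  let B := ball ((ratr i.1.1 : R), map_mx ratr i.1.2 : 'rV[R]_n)
                (i.2.+1%:R^-1) in
  if `[< B `<=` A >] then B else set0.
have -> : A = \bigcup_i F i.
  apply/seteqP; split => [[t x] Az|z [i _]]; last first.
    by rewrite /F; case: asboolP => // BA /BA.
  have /nbhs_ballP [e /= e0 eA] := open_nbhs_nbhs (conj oA Az).
  have e20 : 0 < e / 2 by rewrite divr_gt0.
  have [k _ /(_ k (leqnn k)) ke] := near_infty_natSinv_lt (PosNum e20).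
  rewrite /= in ke.
  have k0 : 0 < (k.+1%:R^-1 : R) by rewrite invr_gt0.
  have [c cP] := rV_approx x k0.
  have [d dP] := rV_approx (t%:M : 'rV_1) k0.
  have {}dP : ball t k.+1%:R^-1 (ratr (d 0 0) : R).
    by case: dP => _ /(_ 0 0); rewrite !mxE eqxx mulr1n.
  have zc : ball (t, x) k.+1%:R^-1 ((ratr (d 0 0) : R), map_mx ratr c : 'rV[R]_n).
    by split.
  exists (d 0 0, c, k) => //; rewrite /F.
  case: asboolP => [_|]; first exact: ball_sym.
  case=> y cy; apply: eA; apply: (@le_ball _ _ _ (k.+1%:R^-1 + k.+1%:R^-1)).
    by rewrite (splitr e) lerD// ltW.
  exact: ball_triangle zc cy.
apply: countable_bigcupT_measurable => [|i]; first exact: countableP.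
rewrite /F; case: asboolP => // _.
rewrite [X in measurable X](_ : _ = ball (ratr i.1.1 : R) i.2.+1%:R^-1 `*`
  ball (map_mx ratr i.1.2 : 'rV[R]_n) i.2.+1%:R^-1)//.
apply: measurableX; first by apply: open_measurable; exact: ball_open.
by apply: open_measurable_rV; exact: ball_open.
Qed.

Lemma rV_cons_continuous n :
  continuous (@rV_cons n : R * 'rV[R]_n -> 'rV[R]_n.+1).
Proof.
move=> z; apply/cvg_ballP => e e0.
near=> y.
have /= [y1 y2] : ball z e y by near: y; exact: (@nbhsx_ballx R (R * 'rV[R]_n)%type z e e0).
split => // i j; rewrite ord1 /rV_cons !mxE.
case: split_ordP => k _; first by rewrite !mxE ord1 eqxx !mulr1n.
by case: y2 => _; exact.
Unshelve. all: by end_near. Qed.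

Lemma measurable_rV_cons n : measurable_fun setT (@rV_cons n).
Proof.
apply: (@measurability _ _ _ _ setT (@rV_cons n) (@open 'rV[R]_n.+1) erefl).
move=> _ [A oA <-]; rewrite setTI; apply: open_measurable_prod.
by move/continuousP : (@rV_cons_continuous n); exact.
Qed.

Lemma measurable_rV_uncons n : measurable_fun setT (@rV_uncons n).
Proof.
apply: measurable_fun_pair.
- apply: (measurability _ (RGenOpens.measurableE R)).
  move=> _ [_ [a [b ->]] <-]; rewrite setTI; apply: open_measurable_rV.
  have /continuousP := @coord_continuous R 1 n.+1 0 0; apply.
  exact: interval_open.
- apply: (@measurability _ _ _ _ setT
    (fun x : 'rV[R]_n.+1 => rsubmx (x : 'rV[R]_(1 + n))) (@open 'rV[R]_n) erefl).
  move=> _ [A oA <-]; rewrite setTI; apply: open_measurable_rV.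
  have /continuousP : continuous
      (fun x : 'rV[R]_n.+1 => rsubmx (x : 'rV[R]_(1 + n)) : 'rV[R]_n); last exact.
  move=> x A' /= /nbhs_ballP[e /= e0 eA].
  apply/nbhs_ballP; exists e => //= y [_ yx]; apply: eA.
  by split => // i j; rewrite !mxE; exact: yx.
Qed.

HB.instance Definition _ n := isMeasurableFun.Build _ _ _ _
  (@rV_cons n) (@measurable_rV_cons n).

Section lebesgue_rV_succ.
Variables (n : nat) (m : {sigma_finite_measure set 'rV[R]_n -> \bar R}).
Definition lebesgue_rV_succ : set 'rV[R]_n.+1 -> \bar R :=
  pushforward (lebesgue_measure \x m)%E (@rV_cons n).

Let succ0 : lebesgue_rV_succ set0 = 0%E.
Proof. by rewrite /lebesgue_rV_succ /pushforward preimage_set0 measure0. Qed.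

Let succ_ge0 A : (0 <= lebesgue_rV_succ A)%E.
Proof. exact: measure_ge0. Qed.

Let succ_sigma_additive : semi_sigma_additive lebesgue_rV_succ.
Proof.
rewrite /lebesgue_rV_succ.
apply: measure_semi_sigma_additive.
exact: measurable_rV_cons.
Qed.

HB.instance Definition _ := isMeasure.Build _ _ _ lebesgue_rV_succ
  succ0 succ_ge0 succ_sigma_additive.

Lemma lebesgue_rV_succ_sigma_finite : sigma_finite setT lebesgue_rV_succ.
Proof.
have [F FT mF] : sigma_finite setT (lebesgue_measure \x m)%E.
  have /sigma_finiteP[F [TF ndF Foo]] := sigma_finiteT (@lebesgue_measure R).
  have /sigma_finiteP[G [TG ndG Goo]] := sigma_finiteT m.
  exists (fun k => F k `*` G k).
    rewrite -setXTT TF TG predeqE => -[x y]; split.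
      move=> [/= [i _ Fix] [j _ Gjy]]; exists (maxn i j) => //; split.
      - by move: x Fix; exact/subsetPset/ndF/leq_maxl.
      - by move: y Gjy; exact/subsetPset/ndG/leq_maxr.
    by move=> [i _ []/= ? ?]; split; exists i.
  move=> k; have [? ?] := Foo k; have [? ?] := Goo k.
  split; first exact: measurableX.
  by rewrite product_measure1E// lte_mul_pinfty// ge0_fin_numE.
exists (fun k => @rV_uncons n @^-1` F k).
  by rewrite -preimage_bigcup -FT preimage_setT.
move=> k; have [mFk Fk] := mF k; split.
  by rewrite -[X in measurable X]setTI; exact: measurable_rV_uncons.
rewrite /lebesgue_rV_succ /pushforward -comp_preimage.
rewrite (_ : _ \o _ = id) ?preimage_id//.
by apply/funext => z /=; rewrite rV_consK.
Qed.
HB.instance Definition _ :=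
  Measure_isSigmaFinite.Build _ _ _ lebesgue_rV_succ lebesgue_rV_succ_sigma_finite.
End lebesgue_rV_succ.

(* n-dimensional Lebesgue measure on Borel sets, as the iterated product of the
   one-dimensional one; lebesgue_rV_box gives its values on boxes. *)
Fixpoint lebesgue_rV n : {sigma_finite_measure set 'rV[R]_n -> \bar R} :=
  if n is n'.+1 then lebesgue_rV_succ (lebesgue_rV n') else \d_(0 : 'rV[R]_0).

Lemma measurable_rV_coord n (i : 'I_n) :
  measurable_fun setT (fun x : 'rV[R]_n => x 0 i : measurableTypeR R).
Proof.
apply: (measurability _ (RGenOpens.measurableE R)).
move=> _ [_ [a [b ->]] <-]; rewrite setTI; apply: open_measurable_rV.
have /continuousP := @coord_continuous R 1 n 0 i; apply.
exact: interval_open.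
Qed.

Lemma lebesgue_rV_box n (A : 'I_n -> set (measurableTypeR R)) :
  (forall i, measurable (A i)) ->
  lebesgue_rV n [set x | forall i, A i (x 0 i)] =
  (\prod_(i < n) lebesgue_measure (A i))%E.
Proof.
elim: n => [|n ih] in A *; move=> mA.
  rewrite big_ord0 /= /dirac indicE mem_set//; by case.
have -> : lebesgue_rV n.+1 [set x | forall i, A i (x 0 i)] =
    (lebesgue_measure \x lebesgue_rV n)%E
      (A ord0 `*` [set x : 'rV[R]_n | forall i : 'I_n, A (lift ord0 i) (x 0 i)]).
  rewrite /= /lebesgue_rV_succ /pushforward; congr (_ _).
  apply/seteqP; split => -[t x]; rewrite /rV_cons /=.
    move=> Atx; split => [|i].
      have := Atx ord0; rewrite mxE; case: split_ordP => j j0.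
        by rewrite mxE ord1 eqxx mulr1n.
      by move/(congr1 val): j0.
    have := Atx (lift ord0 i); rewrite mxE; case: split_ordP => j j0.
      by move/(congr1 val): j0; rewrite ord1.
    by congr (A _ (x _ _)); apply/val_inj; move/(congr1 val): j0 => /= -[].
  move=> [At Ax] i; rewrite mxE; case: split_ordP => j ij.
    by rewrite mxE ord1 eqxx mulr1n ij; congr (A _ _): At; apply/val_inj; rewrite ord1.
  rewrite (_ : i = lift ord0 j); first exact: Ax.
  by apply/val_inj; rewrite ij.
rewrite product_measure1E//; last first.
  rewrite (_ : mkset _ = \bigcap_(i : 'I_n)
      ((fun x : 'rV[R]_n => x 0 i) @^-1` A (lift ord0 i))); last first.
    by apply/seteqP; split => [x Ax i _|x Ax i]; exact: Ax.
  apply: fin_bigcap_measurable => // i _.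
  by rewrite -[X in measurable X]setTI; exact: measurable_rV_coord.
rewrite big_ord_recl; congr (_ * _)%E.
exact: (ih (fun i => A (lift ord0 i))).
Qed.
End lebesgue_rV.

(* Lebesgue measurability is understood with respect to the completions: as for
   completed_lebesgue_measure, the completed measures live on the Caratheodory
   sigma-algebra, carried by an alias of the underlying type. *)
Section completed_lebesgue.
Variables (R : realType) (n : nat).

Definition space_lebesgue :=
  @completed_measure_extension _ _ _ (lebesgue_rV R n).
HB.instance Definition _ := Measure.on space_lebesgue.

Definition spacetime_lebesgue :=
  @completed_measure_extension _ _ _ (lebesgue_measure \x lebesgue_rV R n)%E.
HB.instance Definition _ := Measure.on spacetime_lebesgue.

Definition space_type : measurableType _ :=
  caratheodory_type (mu_ext (lebesgue_rV R n)).
Definition spacetime_type : measurableType _ :=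
  caratheodory_type (mu_ext (lebesgue_measure \x lebesgue_rV R n)%E).

End completed_lebesgue.
Arguments space_lebesgue : clear implicits.
Arguments spacetime_lebesgue : clear implicits.

Section calculus.
Variables (R : realType) (V W : normedModType R).

(* f is of class C^m; meant for finite-dimensional V, where the derivative is
   determined by, and as regular as, the directional derivatives. *)
Fixpoint of_class (m : nat) (f : V -> W) : Prop :=
  if m is m'.+1 then
    (forall x, differentiable f x) /\ (forall v, of_class m' (fun x => 'D_v f x))
  else continuous f.

End calculus.

Section conservation_laws.
Variables (R : realType) (n k : nat).
Implicit Types (T c : R) (F : 'rV[R]_k -> 'M[R]_(k, n)).
Implicit Types (eta : 'rV[R]_k -> R) (q : 'rV[R]_k -> 'rV[R]_n).

Definition dir_t : R * 'rV[R]_n := (1, 0).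
Definition dir_x (j : 'I_n) : R * 'rV[R]_n := (0, delta_mx 0 j).

Definition strip T : set (R * 'rV[R]_n) := `[0, T] `*` [set: 'rV[R]_n].

Definition hessian eta (xi : 'rV[R]_k) : 'M[R]_k :=
  \matrix_(a, b) 'D_(delta_mx 0 a) (fun x => 'D_(delta_mx 0 b) eta x) xi.

Definition strictly_convex_entropy F eta q c : Prop :=
  [/\ of_class 2 eta, of_class 2 q, 0 < c,
      (forall xi v : 'rV[R]_k,
         c * (v *m v^T) 0 0 <= (v *m hessian eta xi *m v^T) 0 0) &
      (forall (xi : 'rV[R]_k) (l : 'I_k) (j : 'I_n),
         \sum_(i < k) 'D_(delta_mx 0 i) eta xi
                       * 'D_(delta_mx 0 l) (fun x => F x i j) xi
         = 'D_(delta_mx 0 l) (fun x => q x 0 j) xi)].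

(* The norms on 'rV_n and on products are maximum norms, equivalent to the
   Euclidean ones. Only the values of U on the strip matter: the system is
   imposed at almost every interior point, the slices t = 0 and t = T being
   negligible. *)
Definition bounded_lipschitz_solution T F (U : R * 'rV[R]_n -> 'rV[R]_k) : Prop :=
  [/\ [bounded U z | z in strip T],
      [lipschitz U z | z in strip T] &
      {ae spacetime_lebesgue R n, forall z : R * 'rV[R]_n, 0 < z.1 < T ->
        forall i : 'I_k,
          [/\ derivable (fun y => U y 0 i) z dir_t,
              forall j, derivable (fun y => F (U y) i j) z (dir_x j) &
              'D_dir_t (fun y => U y 0 i) z
              + \sum_(j < n) 'D_(dir_x j) (fun y => F (U y) i j) z = 0]}].

(* C_c^oo((-T, T) x R^n), each function being extended by 0 to R x R^n *)
Definition test_function T (psi : R * 'rV[R]_n -> R) : Prop :=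
  let S := closure [set z | psi z != 0] in
  [/\ forall m, of_class m psi, compact S &
      S `<=` `]- T, T[ `*` [set: 'rV[R]_n]].

Definition msupport (mu : probability 'rV[R]_k R) : set 'rV[R]_k :=
  [set xi | forall A, open_nbhs xi A -> (0 < mu A)%E].

(* <mu, g> *)
Definition avg (mu : probability 'rV[R]_k R) (g : 'rV[R]_k -> R) : R :=
  \int[mu]_xi g xi.

Definition barycenter (mu : probability 'rV[R]_k R) : 'rV[R]_k :=
  \row_i avg mu (fun xi => xi 0 i).

Definition in_Linfty (f : 'rV[R]_n -> 'rV[R]_k) : Prop :=
  (forall i, measurable_fun setT (fun x : space_type R n => f x 0 i)) /\
  exists M : R, {ae space_lebesgue R n, forall x, `|f x| <= M}.

Definition weakstar_continuous T (V : R -> 'rV[R]_n -> 'rV[R]_k) : Prop :=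
  (forall t, 0 <= t <= T -> in_Linfty (V t)) /\
  forall phi : 'rV[R]_n -> 'rV[R]_k,
    (forall i, (space_lebesgue R n).-integrable setT (fun x => (phi x 0 i)%:E)) ->
    {within `[0, T], continuous (fun t : R =>
       \int[space_lebesgue R n]_x (\sum_(i < k) phi x 0 i * V t x 0 i) : R)}.

Record bounded_admissible_mvs T F eta q (U0 : 'rV[R]_n -> 'rV[R]_k)
    (nu : R * 'rV[R]_n -> probability 'rV[R]_k R) : Prop := {
  mvs_Linfty_data : in_Linfty U0;
  mvs_measurable : forall B : set 'rV[R]_k, measurable B ->
    measurable_fun (strip T : set (spacetime_type R n))
      (fun z : spacetime_type R n => nu z B);
  mvs_bounded : exists2 K : set 'rV[R]_k, bounded_set K &
    forall z, strip T z -> msupport (nu z) `<=` K;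
  mvs_continuous : weakstar_continuous T (fun t x => barycenter (nu (t, x)));
  mvs_system : forall (i : 'I_k) (psi : R * 'rV[R]_n -> R),
    test_function T psi ->
    \int[spacetime_lebesgue R n]_(z in strip T)
      ('D_dir_t psi z * avg (nu z) (fun xi => xi 0 i)
       + \sum_(j < n) 'D_(dir_x j) psi z * avg (nu z) (fun xi => F xi i j))
    + \int[space_lebesgue R n]_x (psi (0, x) * U0 x 0 i) = 0;
  mvs_entropy : forall psi : R * 'rV[R]_n -> R,
    test_function T psi -> (forall z, 0 <= psi z) ->
    0 <= \int[spacetime_lebesgue R n]_(z in strip T)
      ('D_dir_t psi z * avg (nu z) eta
       + \sum_(j < n) 'D_(dir_x j) psi z * avg (nu z) (fun xi => q xi 0 j))
    + \int[space_lebesgue R n]_x (psi (0, x) * eta (U0 x))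
}.

End conservation_laws.

(* Main.v *)
Require Import Defs.
From HB Require Import structures.
From mathcomp Require Import all_boot all_order all_algebra.
From mathcomp Require Import all_classical all_reals all_analysis.
From mathcomp Require Import measurable_realfun ring lra.

(* Relative entropy. Let P = D eta (U), sigma = eta (U) - P . U and
   tau_j = q_j (U) - P . F_j (U). Testing the entropy inequality with psi and the
   i-th equation with psi P_i, and adding the divergence identities for
   psi sigma and psi tau, everything of first order in xi - U cancels: since
   d sigma = - U . dP, d tau_j = - F_j (U) . dP, and P solves the adjoint
   linearized system by the symmetry of D^2 eta . DF_j, what remains is
   d_t psi <nu, eta (xi | U)> + d_x psi . <nu, q (xi | U)> plus psi times a
   quantity that is O(<nu, |xi - U|^2>), with eta (xi | U) >= c |xi - U|^2. For
   psi = exp (- lambda / (s^2 - M t - N t^2 - |x|^2)), with M and lambda large, the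
   decay of psi in time absorbs both the flux term (finite speed of propagation)
   and the zeroth order term (Gronwall), so <nu, |xi - U|^2> = 0 almost everywhere
   on a paraboloid; these paraboloids exhaust the strip.

   P, sigma and tau are only Lipschitz, so they are mollified first, by a kernel
   that looks forward in time only and therefore only sees times at which U
   solves the system. The three relations above survive with an error that is
   bounded by the width of the kernel. *)

Set Implicit Arguments. Unset Strict Implicit. Unset Printing Implicit Defensive.
Import Order.TTheory GRing.Theory Num.Theory.
Import numFieldNormedType.Exports.
Local Open Scope classical_set_scope.
Local Open Scope ring_scope.

(** * Differential calculus for iterated differentiability *)

(** The assumption on [U] supplies, almost everywhere, only the derivatives that occur in the
    system: that of [U] in time and that of each F_ij (U) along x_j. Space derivatives of [U], hence
    of P, sigma and tau, are not assumed to exist. The relations between these fields are therefore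
    stated for difference quotients, as convergence to 0 of a linear combination with continuous
    coefficients. Lipschitz bounds dominate the quotients, so such a statement passes through the
    averaging, and only the mollified fields are ever differentiated. Mollifying P, sigma and tau,
    rather than [U] inside them, leaves the freezing of the coefficients as the only source of error
    in the relations.

    At time 0 the forward kernel can be used up to the boundary, so the term of the initial data is
    compared with the mollified fields directly. Near the final time the kernel would look past T;
    hence the argument runs before an arbitrary T' < T, and the slice t = T is discarded as a null
    set. For a fixed cutoff all errors are e times a constant that depends on the cutoff only, so e
    tends to 0 with the cutoff fixed. *)

Section of_class_theory.
Variables (R : realType) (V : normedModType R).
Implicit Types (f g : V -> R) (v x : V) (m : nat).

Lemma of_class_continuous (W : normedModType R) m (f : V -> W) :
  of_class m f -> continuous f.
Proof. by case: m => [//|m [df _] x]; exact/differentiable_continuous/df. Qed.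

Lemma of_classS_le (W : normedModType R) m (f : V -> W) :
  of_class m.+1 f -> of_class m f.
Proof.
elim: m f => [|m ih] f; first exact: (@of_class_continuous _ 1).
by case=> df cf; split => // v; exact/ih/cf.
Qed.

Lemma of_class_cst m (a : R) : of_class m (fun _ : V => a).
Proof.
elim: m a => [|m ih] a /=; first exact: cst_continuous.
split => [x|v]; first exact: differentiable_cst.
have -> : (fun x : V => 'D_v (fun _ : V => a) x) = (fun=> 0).
  by apply/funext => x; exact: derive_cst.
exact: ih.
Qed.

Lemma of_class_add m f g :
  of_class m f -> of_class m g -> of_class m (fun x => f x + g x).
Proof.
elim: m f g => [|m ih] f g /=.
  by move=> cf cg x; apply: continuousD; [exact: cf|exact: cg].
move=> [df cf] [dg cg]; split=> [x|v]; first exact: (differentiableD (df x) (dg x)).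
have -> : (fun x => 'D_v (fun x => f x + g x) x) = fun x => 'D_v f x + 'D_v g x.
  by apply/funext => x; apply: deriveD; exact: diff_derivable.
exact: ih.
Qed.

Lemma of_class_mul m f g :
  of_class m f -> of_class m g -> of_class m (fun x => f x * g x).
Proof.
elim: m f g => [|m ih] f g.
  by move=> cf cg x; apply: continuousM; [exact: cf|exact: cg].
move=> sf sg; have [df cf] := sf; have [dg cg] := sg.
split=> [x|v]; first exact: (differentiableM (df x) (dg x)).
have -> : (fun x => 'D_v (fun x => f x * g x) x) =
    fun x => f x * 'D_v g x + g x * 'D_v f x.
  by apply/funext => x; apply: deriveM; exact: diff_derivable.
by apply: of_class_add; apply: ih; by [|exact: of_classS_le|exact: cf|exact: cg].
Qed.

Lemma of_class_opp m f : of_class m f -> of_class m (fun x => - f x).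
Proof.
move=> sf; rewrite (_ : (fun x => _) = fun x => -1 * f x); last first.
  by apply/funext => x; rewrite mulN1r.
by apply: of_class_mul => //; exact: of_class_cst.
Qed.

Lemma of_class_sum m (I : Type) (r : seq I) (f : I -> V -> R) :
  (forall i, of_class m (f i)) -> of_class m (fun x => \sum_(i <- r) f i x).
Proof.
move=> sf; elim: r => [|i r ih].
  by under eq_fun do rewrite big_nil; exact: of_class_cst.
by under eq_fun do rewrite big_cons; exact: of_class_add.
Qed.

Lemma of_class_linear m f : (forall a x y, f (a *: x + y) = a * f x + f y) ->
  continuous f -> of_class m f.
Proof.
move=> lf cf.
have lf' : linear f by move=> a x y; rewrite lf.
pose L : {linear V -> R} := HB.pack f (GRing.isLinear.Build _ _ _ _ f lf').
case: m => [//|m]; split=> [x|v].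
  exact: (@linear_differentiable _ _ _ L).
have -> : (fun x => 'D_v f x) = fun=> f v; last exact: of_class_cst.
apply/funext => x; rewrite deriveE; last exact: (@linear_differentiable _ _ _ L).
by have -> := @diff_lin _ _ _ L x cf.
Qed.

Lemma derive_comp_line (W : normedModType R) (f : V -> W) x v (s : R) :
  derivable f (x + s *: v) v ->
  is_derive s 1 (fun s => f (x + s *: v)) ('D_v f (x + s *: v)).
Proof.
move=> fv.
have e : (fun h : R => h^-1 *: (((fun s => f (x + s *: v)) \o shift s) (h *: 1)
            - f (x + s *: v))) =
         (fun h => h^-1 *: ((f \o shift (x + s *: v)) (h *: v) - f (x + s *: v))).
  apply/funext => h /=; congr (_ *: (f _ - _)).
  by rewrite [h *: 1]mulr1 scalerDl addrCA.
by split; [rewrite /derivable e|rewrite /derive e].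
Qed.

Lemma line_MVT f x v : (forall y, derivable f y v) ->
  exists2 s : R, 0 < s < 1 & f (x + v) - f x = 'D_v f (x + s *: v).
Proof.
move=> df.
have D (s : R) : is_derive s 1 (fun s : R => f (x + s *: v)) ('D_v f (x + s *: v)).
  exact: derive_comp_line.
have [|s] := MVT (@ltr01 R) (fun s _ => D s).
  by apply: continuous_subspaceT => s; apply: differentiable_continuous;
     apply/derivable1_diffP; case: (D s).
rewrite in_itv /= => s01; rewrite subr0 mulr1 scale1r scale0r addr0 => ->.
by exists s.
Qed.

End of_class_theory.

Section coordinate_basis.
Variables (R : realType) (V : normedModType R) (I : finType).
Variables (e : I -> V) (c : V -> I -> R).

(** Coordinates are bounded by the norm with constant 1, as holds for maximum norms. The estimates
    below then serve both the state space and spacetime. *)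
Definition coordinate_basis : Prop :=
  (forall v, v = \sum_i c v i *: e i) /\ (forall v i, `|c v i| <= `|v|).

Hypothesis be : coordinate_basis.

Lemma derive_basis (f : V -> R) (x v : V) : differentiable f x ->
  'D_v f x = \sum_i c v i * 'D_(e i) f x.
Proof.
move=> df; rewrite deriveE// {1}(be.1 v) linear_sum; apply: eq_bigr => i _.
by rewrite linearZ deriveE.
Qed.

(** Mean value theorem on the segment from [x] to [y], which stays in [A], followed by expansion of
    the directional derivative in coordinates. *)
Lemma lipschitz_of_bounded_derive (A : set V) (f : V -> R) (C : R) :
  (forall x y s, A x -> A y -> 0 < s < 1 -> A (x + s *: (y - x))) ->
  (forall x, differentiable f x) ->
  (forall x i, A x -> `|'D_(e i) f x| <= C) ->
  forall x y, A x -> A y -> `|f y - f x| <= #|I|%:R * C * `|y - x|.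
Proof.
move=> cA df bf x y Ax Ay.
have [|s s01] := @line_MVT _ _ f x (y - x).
  by move=> z; exact: diff_derivable.
rewrite subrKC => ->; rewrite derive_basis//.
apply: le_trans (ler_norm_sum _ _ _) _.
rewrite -mulrA mulr_natl -sumr_const.
apply: ler_sum => i _; rewrite normrM mulrC ler_pM//; last exact: be.2.
by apply: bf; exact: cA.
Qed.

(** The mean value theorem turns the remainder into a difference of derivatives in direction [y - x]
    at two points at distance at most that of [x] and [y]; the Lipschitz bound supplies the second
    factor. *)
Lemma taylor_bound (A : set V) (f : V -> R) (C : R) : 0 <= C ->
  (forall x y s, A x -> A y -> 0 < s < 1 -> A (x + s *: (y - x))) ->
  (forall x, differentiable f x) ->
  (forall x y i, A x -> A y -> `|'D_(e i) f y - 'D_(e i) f x| <= C * `|y - x|) ->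
  forall x y, A x -> A y ->
  `|f y - f x - 'D_(y - x) f x| <= #|I|%:R * C * `|y - x| ^+ 2.
Proof.
move=> C0 cA df bf x y Ax Ay.
have [|s s01] := @line_MVT _ _ f x (y - x).
  by move=> z; exact: diff_derivable.
rewrite subrKC => ->; rewrite !derive_basis// -sumrB.
apply: le_trans (ler_norm_sum _ _ _) _.
rewrite -mulrA mulr_natl -sumr_const.
apply: ler_sum => i _; rewrite -mulrBr normrM expr2 mulrC mulrA ler_pM//.
  apply: (le_trans (bf _ _ _ Ax (cA _ _ _ Ax Ay s01))).
  rewrite ler_wpM2l// addrC addKr normrZ ler_piMl//.
  by case/andP: s01 => s0 s1; rewrite ger0_norm ltW.
exact: be.2.
Qed.

End coordinate_basis.

Section bases.
Variable R : realType.

Lemma rV_basis k : coordinate_basis (fun i : 'I_k => delta_mx 0 i : 'rV[R]_k)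
  (fun v i => v 0 i).
Proof.
split=> [v|v i]; first exact: row_sum_delta.
rewrite [`|v|]mx_normrE; exact: (le_bigmax _ (fun ij => `|v ij.1 ij.2|) (0, i)).
Qed.

End bases.

(** * Symmetry of second derivatives *)

Section second_derivatives.
Variables (R : realType) (V : normedModType R).
Implicit Types (f g : V -> R) (u v x : V).

(** The mean value theorem applied twice: to the increment [f (y + v) - f y] along [u], then to
    ['D_u f] along [v]. *)
Lemma second_difference f x u v : of_class 2 f ->
  exists p : R * R, [/\ 0 < p.1 < 1, 0 < p.2 < 1 &
    f (x + u + v) - f (x + u) - (f (x + v) - f x) =
    'D_v (fun y => 'D_u f y) (x + p.1 *: u + p.2 *: v)].
Proof.
move=> [df cf].
have dshift y : derivable (fun y => f (y + v)) y u /\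
    'D_u (fun y => f (y + v)) y = 'D_u f (y + v).
  have e : (fun h : R => h^-1 *: (((fun y => f (y + v)) \o shift y) (h *: u) - f (y + v)))
         = (fun h : R => h^-1 *: ((f \o shift (y + v)) (h *: u) - f (y + v))).
    by apply/funext => h /=; rewrite addrA.
  have fu : derivable f (y + v) u by exact: diff_derivable.
  by split; [rewrite /derivable e|rewrite /derive e].
have [|s s01 /= E] := @line_MVT _ _ (fun y => f (y + v) - f y) x u.
  by move=> y; apply: derivableB; [exact: (dshift y).1|exact: diff_derivable].
have [|r r01 E'] := @line_MVT _ _ (fun y => 'D_u f y) (x + s *: u) v.
  by move=> y; apply: diff_derivable; case: (cf u).
exists (s, r); split => //=; rewrite -E'.
have -> : f (x + u + v) - f (x + u) - (f (x + v) - f x) =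
  'D_u (fun y => f (y + v) - f y) (x + s *: u) by rewrite -E.
rewrite deriveB ?(dshift _).2 //; [exact: (dshift _).1|exact: diff_derivable].
Qed.

(** The second difference over the parallelogram spanned by [s *: u] and [s *: v] is symmetric, and
    it equals s^2 times either mixed derivative at some point of the parallelogram. Continuity of
    both at [x] concludes for small [s]. *)
Lemma derive_comm f x u v : of_class 2 f ->
  'D_u (fun y => 'D_v f y) x = 'D_v (fun y => 'D_u f y) x.
Proof.
move=> sf.
have cont a b : {for x, continuous (fun y => 'D_a (fun y => 'D_b f y) y)}.
  by case: sf => _ /(_ b) [_ /(_ a)]; exact.
have K0 : 0 < `|u| + `|v| + 1 by rewrite ltr_wpDl// addr_ge0.
apply/eqP; rewrite -subr_eq0 -normr_eq0 eq_le normr_ge0 andbT.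
apply/ler_addgt0Pr => e e0; rewrite add0r; have e20 : 0 < e / 2 by rewrite divr_gt0.
have /cvgrPdist_le/(_ _ e20)/nbhs_normP[d1 /= d10 h1] := cont u v.
have /cvgrPdist_le/(_ _ e20)/nbhs_normP[d2 /= d20 h2] := cont v u.
(* This size keeps both intermediate points inside the two neighbourhoods; the [+ 1] covers the case
   where [u] and [v] vanish. *)
have [s s0 sd] : exists2 s : R, 0 < s & s * (`|u| + `|v|) < Num.min d1 d2.
  exists (Num.min d1 d2 / (`|u| + `|v| + 1)); first by rewrite divr_gt0// lt_min d10.
  by rewrite mulrAC ltr_pdivrMr// ltr_pM2l ?lt_min ?d10// ltr_pwDr.
have near (p : R * R) a b : 0 < p.1 < 1 -> 0 < p.2 < 1 -> `|a| + `|b| = `|u| + `|v| ->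
    `|x - (x + p.1 *: (s *: a) + p.2 *: (s *: b))| < Num.min d1 d2.
  move=> p1 p2 ab; rewrite opprD opprD !addrA subrr sub0r -opprD normrN.
  have lt q c : 0 < q < 1 -> `|q *: (s *: c)| <= s * `|c|.
    move=> /andP[q0 q1]; rewrite !normrZ (gtr0_norm q0) (gtr0_norm s0).
    by rewrite ler_piMl ?mulr_ge0 ?(ltW q1) ?(ltW s0).
  apply: le_lt_trans sd; rewrite -ab mulrDr.
  by apply: le_trans (ler_normD _ _) _; rewrite lerD// lt.
have [p [p1 p2 E1]] := second_difference x (s *: u) (s *: v) sf.
have [q [q1 q2 E2]] := second_difference x (s *: v) (s *: u) sf.
have scale a b y : 'D_(s *: a) (fun y => 'D_(s *: b) f y) y =
    s * (s * 'D_a (fun y => 'D_b f y) y).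
  have -> : (fun y => 'D_(s *: b) f y) = (fun y => s * 'D_b f y).
    by apply/funext => z; case: sf => df _; rewrite !deriveE// linearZ.
  case: sf => _ /(_ b)[db _].
  by rewrite deriveE ?linearZ /= -?deriveE ?deriveMl //;
    try exact: diff_derivable; exact: (differentiableZ s (db y)).
have sym : f (x + s *: u + s *: v) - f (x + s *: u) - (f (x + s *: v) - f x) =
           f (x + s *: v + s *: u) - f (x + s *: v) - (f (x + s *: u) - f x).
  by rewrite [x + _ + s *: u]addrAC; ring.
have {}E1 := etrans (etrans (esym E2) (esym sym)) E1.
have {}E1 := etrans (esym (scale u v _)) (etrans E1 (scale v u _)).
have E : 'D_u (fun y => 'D_v f y) (x + q.1 *: (s *: v) + q.2 *: (s *: u)) =
    'D_v (fun y => 'D_u f y) (x + p.1 *: (s *: u) + p.2 *: (s *: v)).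
  exact: (mulfI (lt0r_neq0 s0) (mulfI (lt0r_neq0 s0) E1)).
have [] := (h1 (x + q.1 *: (s *: v) + q.2 *: (s *: u)),
            h2 (x + p.1 *: (s *: u) + p.2 *: (s *: v))).
have /(_ q1 q2 (addrC _ _)) := near q v u; rewrite lt_min => /andP[q' _] /(_ q').
have /(_ p1 p2 erefl) := near p u v; rewrite lt_min => /andP[_ p'].
rewrite E => k1 /(_ p') k2.
rewrite distrC in k2; rewrite [e]splitr.
exact: le_trans (ler_distD _ _ _) (lerD k1 k2).
Qed.

End second_derivatives.

Section row_vector_functions.
Variables (R : realType) (k : nat).
Implicit Types (f g : 'rV[R]_k -> R).

Lemma of_class_coord m p r (F : 'rV[R]_k -> 'M[R]_(p, r)) i j :
  of_class m F -> of_class m (fun x => F x i j).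
Proof.
elim: m F => [|m ih] F /=.
  by move=> cF x; apply: (@continuous_comp _ _ _ F (fun M : 'M[R]_(p, r) => M i j));
     [exact: cF|exact: coord_continuous].
move=> [dF cF]; split=> [x|v].
  apply: (@differentiable_comp _ _ _ _ F (fun M : 'M[R]_(p, r) => M i j)) => //.
  exact: differentiable_coord.
have -> : (fun x => 'D_v (fun x => F x i j) x) = (fun x => ('D_v F x) i j).
  apply/funext => x; rewrite derive_mx ?mxE//; exact: diff_derivable.
exact: ih.
Qed.

Definition rV_ball (r : R) : set 'rV[R]_k := [set x | `|x| <= r].

Lemma rV_ball_segment r (x y : 'rV[R]_k) (s : R) :
  rV_ball r x -> rV_ball r y -> 0 < s < 1 -> rV_ball r (x + s *: (y - x)).
Proof.
rewrite /rV_ball /= => xr yr /andP[s0 s1].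
have -> : x + s *: (y - x) = (1 - s) *: x + s *: y.
  by rewrite scalerBl scale1r scalerBr addrCA addrC.
apply: (le_trans (ler_normD _ _)); rewrite !normrZ (gtr0_norm s0).
have s1' : 0 < 1 - s by rewrite subr_gt0.
rewrite (gtr0_norm s1').
have -> : r = (1 - s) * r + s * r by rewrite -mulrDl subrK mul1r.
by rewrite lerD// ler_wpM2l// ltW.
Qed.

Lemma rV_ball_bound r f : continuous f ->
  exists2 C : R, 0 <= C & forall x, rV_ball r x -> `|f x| <= C.
Proof.
move=> cf.
have cB : compact (rV_ball r).
  apply: bounded_closed_compact.
    by exists r; split; [exact: num_real|move=> M rM x /= /le_trans; apply; exact: ltW].
  exact: (@closed_comp _ _ (fun x : 'rV[R]_k => `|x|) _ (in1W (@norm_continuous _ _))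
    (@closed_le R r)).
have : compact (f @` rV_ball r).
  by apply: continuous_compact => //; exact: continuous_subspaceT.
move=> /compact_bounded [M [Mr hM]].
exists (Num.max 0 (M + 1)); first by rewrite le_max lexx.
move=> x rx; rewrite le_max; apply/orP; right.
by apply: hM; [rewrite ltrDl|exists x].
Qed.

Lemma rV_ball_boundI (I : finType) r (f : I -> 'rV[R]_k -> R) :
  (forall i, continuous (f i)) ->
  exists2 C : R, 0 <= C & forall i x, rV_ball r x -> `|f i x| <= C.
Proof.
move=> cf; have /choice[C Ch] : forall i, exists C : R, 0 <= C /\
    forall x, rV_ball r x -> `|f i x| <= C.
  by move=> i; have [C C0 h] := rV_ball_bound r (cf i); exists C.
exists (\sum_i C i); first by apply: sumr_ge0 => i _; case: (Ch i).
move=> i x rx; apply: le_trans ((Ch i).2 x rx) _.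
by rewrite (bigD1 i)//= lerDl sumr_ge0// => j _; case: (Ch j).
Qed.

Lemma rV_ball_lipschitz r f : of_class 1 f ->
  exists2 C : R, 0 <= C & forall x y, rV_ball r x -> rV_ball r y ->
    `|f y - f x| <= C * `|y - x|.
Proof.
move=> [df cf]; have [C C0 hC] :=
  rV_ball_boundI r (fun i : 'I_k => cf (delta_mx 0 i)).
exists (#|'I_k|%:R * C); first by rewrite mulr_ge0.
apply: (lipschitz_of_bounded_derive (@rV_basis R k)) => //.
  exact: rV_ball_segment.
by move=> x i rx; exact: hC.
Qed.

Lemma rV_ball_taylor r f : of_class 2 f ->
  exists2 C : R, 0 <= C & forall x y, rV_ball r x -> rV_ball r y ->
    `|f y - f x - 'D_(y - x) f x| <= C * `|y - x| ^+ 2.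
Proof.
move=> [df cf]; have /choice[C Ch] : forall i : 'I_k, exists C : R, 0 <= C /\
    forall x y, rV_ball r x -> rV_ball r y ->
    `|'D_(delta_mx 0 i) f y - 'D_(delta_mx 0 i) f x| <= C * `|y - x|.
  by move=> i; have [C C0 h] := rV_ball_lipschitz r (cf (delta_mx 0 i)); exists C.
have C0 : 0 <= \sum_i C i by apply: sumr_ge0 => i _; case: (Ch i).
exists (#|'I_k|%:R * \sum_i C i); first by rewrite mulr_ge0.
apply: (taylor_bound (@rV_basis R k)) => //; first exact: rV_ball_segment.
move=> x y i rx ry; apply: le_trans ((Ch i).2 _ _ rx ry) _.
rewrite ler_wpM2r// (bigD1 i)//= lerDl sumr_ge0// => j _; by case: (Ch j).
Qed.

(** The Hessian bound is integrated twice along the line [x + s *: v], each time through the mean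
    value theorem: [slope] is the first integration. *)
Lemma strongly_convex_lower_bound f (c : R) : of_class 2 f ->
  (forall x v : 'rV[R]_k, c * (v *m v^T) 0 0 <= (v *m hessian f x *m v^T) 0 0) ->
  forall x v : 'rV[R]_k, c / 2 * \sum_i v 0 i ^+ 2 <= f (x + v) - f x - 'D_v f x.
Proof.
move=> [df cf] hess x v.
have hessE y : (v *m hessian f y *m v^T) 0 0 = 'D_v (fun y => 'D_v f y) y.
  have -> : (fun y => 'D_v f y) =
      (\sum_(i < k) (fun y => v 0 i * 'D_(delta_mx 0 i) f y)).
    apply/funext => z; rewrite (derive_basis (@rV_basis R k))//.
    by rewrite fct_sumE.
  have dd i z : differentiable (fun y => v 0 i * 'D_(delta_mx 0 i) f y) z.
    by apply: (differentiableZ (v 0 i)); case: (cf (delta_mx 0 i)).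
  rewrite derive_sum; last by move=> i; exact: diff_derivable.
  rewrite mxE; apply: eq_bigr => i _; rewrite !mxE mulrC.
  rewrite deriveMl; last by apply: diff_derivable; case: (cf (delta_mx 0 i)).
  congr (_ * _); rewrite (derive_basis (@rV_basis R k)); last by case: (cf (delta_mx 0 i)).
  by apply: eq_bigr => j _; rewrite mxE.
have sqE : (v *m v^T) 0 0 = \sum_i v 0 i ^+ 2.
  by rewrite mxE; apply: eq_bigr => i _; rewrite mxE expr2.
set Q := \sum_i _ in sqE *.
have D s : is_derive s (1 : R) (fun s : R => f (x + s *: v)) ('D_v f (x + s *: v)).
  by apply: derive_comp_line; exact: diff_derivable.
have D2 s : is_derive s (1 : R) (fun s : R => 'D_v f (x + s *: v))
    ('D_v (fun y => 'D_v f y) (x + s *: v)).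
  by apply: derive_comp_line; apply: diff_derivable; case: (cf v).
have slope s : 0 < s -> c * Q * s <= 'D_v f (x + s *: v) - 'D_v f x.
  move=> s0; have [|r _] := MVT s0 (fun s _ => D2 s).
    by apply: continuous_subspaceT => z; apply: differentiable_continuous;
     apply/derivable1_diffP; case: (D2 z).
  rewrite scale0r addr0 subr0 => ->.
  by apply: ler_wpM2r; [exact: ltW|rewrite -hessE -sqE; exact: hess].
(* With the parabola subtracted, [slope] says that the derivative of [g] is at least its value at
   0. *)
pose g s := f (x + s *: v) - c * Q / 2 * s ^+ 2.
have dg (s : R) : is_derive s (1 : R) g ('D_v f (x + s *: v) - c * Q * s).
  have dsq : is_derive s (1 : R) (fun s : R => c * Q / 2 * s ^+ 2) (c * Q * s).
    have dX : derivable (fun s : R => s ^+ 2) s 1 by exact: exprn_derivable.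
    have EX := @deriveMl _ _ (fun s : R => s ^+ 2) (c * Q / 2) s 1 dX.
    apply: DeriveDef; first exact: (derivableM (derivable_cst (c * Q / 2) _ _) dX).
    by rewrite [LHS]EX exp_derive expr1 -[_ *: 1]/(_ * 1) -[_ *: s]/(_ * s); field.
  exact: (is_deriveB (D s) dsq).
have [|r] := MVT (@ltr01 R) (fun s _ => dg s).
  by apply: continuous_subspaceT => z; apply: differentiable_continuous;
     apply/derivable1_diffP; case: (dg z).
rewrite in_itv /= => /andP[r0 _]; rewrite /g subr0 mulr1 scale1r scale0r addr0.
by have := slope r r0; rewrite expr1n expr0n /= => k1 k2; nra.
Qed.

End row_vector_functions.

(** * Change of variables and Lebesgue measure on spacetime *)

Section measure_preserving.
Context d1 d2 (X : measurableType d1) (Y : measurableType d2) (R : realType).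
Variables (m1 : {measure set X -> \bar R}) (m2 : {measure set Y -> \bar R}).

Definition measure_preserving (phi : X -> Y) : Prop :=
  measurable_fun setT phi /\
  (forall B, measurable B -> m1 (phi @^-1` B) = m2 B).

(** Bundles the pushforward as a measure, the form in which the uniqueness theorems for product and
    Lebesgue measure apply to it. *)
Lemma pushforward_measure (phi : X -> Y) : measurable_fun setT phi ->
  exists m : {measure set Y -> \bar R}, forall B, m B = m1 (phi @^-1` B).
Proof.
move=> mphi.
pose m : {measure set Y -> \bar R} := pushforward m1 phi.
by exists (m mphi).
Qed.

Variable phi : X -> Y.
Hypothesis pphi : measure_preserving phi.
Let mphi := pphi.1.

Lemma preserving_preimage (D : set Y) : measurable D -> measurable (phi @^-1` D).
Proof. by move=> mD; rewrite -[X in measurable X]setTI; exact: mphi. Qed.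

Lemma preserving_ge0_integral (D : set Y) (f : Y -> \bar R) : measurable D ->
  measurable_fun D f -> (forall y, (0 <= f y)%E) ->
  (\int[m2]_(y in D) f y)%E = (\int[m1]_(x in phi @^-1` D) f (phi x))%E.
Proof.
move=> mD mf f0; rewrite -(ge0_integral_pushforward mphi)//.
by apply: eq_measure_integral => A mA _; rewrite -pphi.2.
Qed.

Lemma preserving_integral (D : set Y) (f : Y -> \bar R) : measurable D ->
  measurable_fun D f ->
  (\int[m2]_(y in D) f y)%E = (\int[m1]_(x in phi @^-1` D) f (phi x))%E.
Proof.
move=> mD mf.
rewrite integralE [RHS](integralE _ _ (f \o phi)) (funepos_comp f phi) (funeneg_comp f phi).
congr (_ - _)%E.
  exact: (preserving_ge0_integral mD (measurable_funepos mf) (funepos_ge0 f)).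
exact: (preserving_ge0_integral mD (measurable_funeneg mf) (funeneg_ge0 f)).
Qed.

Lemma preserving_Rintegral (D : set Y) (f : Y -> R) : measurable D ->
  measurable_fun D f ->
  \int[m2]_(y in D) f y = \int[m1]_(x in phi @^-1` D) f (phi x).
Proof.
move=> mD mf; rewrite /Rintegral preserving_integral//.
exact/measurable_EFinP.
Qed.

Lemma preserving_measurable_fun d3 (Z : measurableType d3) (D : set Y) (f : Y -> Z) :
  measurable D -> measurable_fun D f -> measurable_fun (phi @^-1` D) (f \o phi).
Proof.
move=> mD mf; apply: (measurable_comp mD) => //; last exact: measurable_funTS.
by move=> _ [x Dx <-].
Qed.

Lemma preserving_integrable (D : set Y) (f : Y -> \bar R) : measurable D ->
  m2.-integrable D f -> m1.-integrable (phi @^-1` D) (f \o phi).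
Proof.
move=> mD /integrableP[mf fi]; apply/integrableP; split.
  exact: preserving_measurable_fun.
rewrite -(@preserving_ge0_integral D (fun y => `|f y|)%E)//.
exact: measurableT_comp.
Qed.

End measure_preserving.

Section product_preserving.
Context d1 d2 (X : measurableType d1) (Y : measurableType d2) (R : realType).
Variables (m1 : {sigma_finite_measure set X -> \bar R}).
Variables (m2 : {sigma_finite_measure set Y -> \bar R}).

(** The pushforward of the product agrees with the product on measurable rectangles, and these
    determine it. *)
Lemma product_preserving (f : X -> X) (g : Y -> Y) :
  measure_preserving m1 m1 f -> measure_preserving m2 m2 g ->
  measure_preserving (m1 \x m2)%E (m1 \x m2)%E (fun z => (f z.1, g z.2)).
Proof.
move=> [mf pf] [mg pg].
have mfg : measurable_fun setT (fun z : X * Y => (f z.1, g z.2)).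
  by apply: measurable_fun_pair;
     [exact: (measurableT_comp mf)|exact: (measurableT_comp mg)].
split => // B mB; have [m mE] := pushforward_measure (m1 \x m2)%E mfg.
rewrite -mE; symmetry; apply: product_measure_unique => // A C mA mC.
rewrite mE -pf// -pg// -product_measure1E//.
  by rewrite -[X in measurable X]setTI; exact: mf.
by rewrite -[X in measurable X]setTI; exact: mg.
Qed.

End product_preserving.

Section translations.
Variable R : realType.

Lemma lebesgue_measure_translation (a : R) :
  measure_preserving (@lebesgue_measure R) (@lebesgue_measure R)
    (fun x : measurableTypeR R => x + a).
Proof.
have mT : measurable_fun setT (fun x : measurableTypeR R => (x + a : measurableTypeR R)).
  by apply: measurable_funD => //; exact: measurable_cst.
split => // B mB; have [m mE] := pushforward_measure (@lebesgue_measure R) mT.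
rewrite -mE; symmetry; apply: lebesgue_measure_unique => // _ [[b c] _ <-] /=.
rewrite mE.
have -> : (fun x : measurableTypeR R => (x + a : measurableTypeR R)) @^-1` `]b, c] =
    `](b - a), (c - a)]%classic.
  by apply/seteqP; split => x /=; rewrite !in_itv/= ltrBlDr lerBrDr.
by rewrite [LHS]lebesgue_measure_itv [RHS]lebesgue_measure_itv /= !lte_fin ltrD2r;
  case: ifP => // _; rewrite -!EFinB opprB addrA subrK.
Qed.

Lemma continuous_measurable_rV m n (f : 'rV[R]_m -> 'rV[R]_n) :
  continuous f -> measurable_fun setT f.
Proof.
move=> cf; apply: (@measurability _ _ _ _ setT f (@open 'rV[R]_n) erefl).
move=> _ [A oA <-]; rewrite setTI; apply: open_measurable_rV.
by move/continuousP: cf; exact.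
Qed.

Lemma continuous_measurable_rV_R m (f : 'rV[R]_m -> R) :
  continuous f -> measurable_fun setT (f : _ -> measurableTypeR R).
Proof.
move=> cf; apply: (measurability _ (RGenOpens.measurableE R)).
move=> _ [_ [a [b ->]] <-]; rewrite setTI; apply: open_measurable_rV.
by move/continuousP: cf; apply; exact: interval_open.
Qed.

Lemma rV_consD n (z : measurableTypeR R * 'rV[R]_n) (a : 'rV[R]_n.+1) :
  rV_cons z + a = rV_cons (z.1 + a 0 0, z.2 + rsubmx (a : 'rV[R]_(1 + n))).
Proof.
apply/rowP => i; rewrite /rV_cons [LHS]mxE /=.
case: (@split_ordP 1 n i) => j ->.
  apply: etrans (congr1 (+%R^~ _) (row_mxEl _ _ _ _)) (etrans _ (esym (row_mxEl _ _ _ _))).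
  by rewrite !mxE ord1 eqxx !mulr1n; congr (_ + a _ _); apply/val_inj.
apply: etrans (congr1 (+%R^~ _) (row_mxEr _ _ _ _)) (etrans _ (esym (row_mxEr _ _ _ _))).
by rewrite !mxE.
Qed.

(** Induction on the dimension: through [rV_cons] a translation acts separately on the first
    coordinate and on the others. *)
Lemma lebesgue_rV_translation n (a : 'rV[R]_n) :
  measure_preserving (lebesgue_rV R n) (lebesgue_rV R n) (fun x => x + a).
Proof.
have mT k (b : 'rV[R]_k) : measurable_fun setT (fun x : 'rV[R]_k => x + b).
  by apply: continuous_measurable_rV => x;
    apply: (@continuousD _ _ _ id (cst b)); [exact: cvg_id|exact: cst_continuous].
split; first exact: mT.
elim: n a => [|n ih] a B mB.
  by congr (_ _); apply/seteqP; split => x /=; rewrite [x + a]thinmx0 [x]thinmx0.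
rewrite /= /lebesgue_rV_succ /pushforward.
pose a' : 'rV[R]_n := rsubmx (a : 'rV[R]_(1 + n)).
have [_ pr] := product_preserving (lebesgue_measure_translation (a 0 0))
  (conj (mT n a') (ih a')).
rewrite -[RHS]pr; first by congr (_ _); apply/funext => -[t x] /=; rewrite rV_consD.
by rewrite -[X in measurable X]setTI; exact: measurable_rV_cons.
Qed.

End translations.

(** * Completed measures, and integrals of bounded functions of bounded support *)

Section completion.
Context d (X : measurableType d) (R : realType) (m : {measure set X -> \bar R}).

(** Integrals of Borel functions against the completed measure are computed before completion, where
    Fubini and translations are at hand. *)
Lemma completion_preserving : measure_preserving
  (@completed_measure_extension _ _ _ m) m
  (fun x : caratheodory_type (mu_ext m) => x : X).
Proof.
split; last by move=> B mB; exact: measurable_mu_extE.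
move=> _ B mB; rewrite setTI.
by apply: sub_caratheodory; apply: sub_sigma_algebra.
Qed.

End completion.

Section bounded_support.
Context d (X : measurableType d) (R : realType) (m : {measure set X -> \bar R}).
Variables (D B : set X).
Hypotheses (mD : measurable D) (mB : measurable B) (Boo : (m B < +oo)%E).

Lemma bounded_support_integrable (f : X -> R) (C : R) : measurable_fun D f ->
  (forall x, D x -> `|f x| <= C) -> (forall x, D x -> ~ B x -> f x = 0) ->
  m.-integrable D (EFin \o f).
Proof.
move=> mf fC fB.
have iB : m.-integrable setT (EFin \o (fun x => C * \1_B x)).
  apply/integrableP; split.
    by apply/measurable_EFinP; apply: measurable_funM;
      [exact: measurable_cst|exact: measurable_indic].
  rewrite (_ : (fun x => _) = fun x => (`|C|)%:E * (\1_B x)%:E)%E; last first.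
    by apply/funext => x /=; rewrite normrM EFinM (@ger0_norm _ (\1_B x))// indicE ler0n.
  rewrite ge0_integralZl//; last by apply/measurable_EFinP.
  rewrite integral_indic// setIT.
  by apply: lte_mul_pinfty => //; rewrite ?ge0_fin_numE// lee_fin.
apply: (le_integrable mD) (integrableS measurableT mD (@subsetT _ _) iB).
  exact/measurable_EFinP.
move=> x Dx /=; rewrite lee_fin.
have [Bx|nBx] := pselect (B x).
  by rewrite indicE mem_set// mulr1 (le_trans (fC x Dx))// ler_norm.
by rewrite fB// normr0.
Qed.

Lemma bounded_support_Rintegral (f : X -> R) (C : R) : measurable_fun D f -> 0 <= C ->
  (forall x, D x -> `|f x| <= C) -> (forall x, D x -> ~ B x -> f x = 0) ->
  `|\int[m]_(x in D) f x| <= C * fine (m B).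
Proof.
move=> mf C0 fC fB.
have fi := bounded_support_integrable mf fC fB.
apply: (le_trans (le_normr_Rintegral mD fi)).
have iB : m.-integrable D (EFin \o (fun x => C * \1_B x)).
  apply: (@bounded_support_integrable _ C).
  - by apply: measurable_funM => //; exact: measurable_funTS.
  - by move=> x _; rewrite normrM !ger0_norm ?indicE ?ler0n// ler_piMr// lern1 leq_b1.
  - by move=> x _ nB; rewrite indicE memNset// mulr0.
have nfi : m.-integrable D (EFin \o (fun x => `|f x|)).
  exact: (integrable_norm fi).
apply: (le_trans (le_Rintegral mD nfi iB _)).
  move=> x Dx; have [Bx|nBx] := pselect (B x).
    by rewrite indicE mem_set// mulr1 fC.
  by rewrite fB// normr0 mulr_ge0// indicE ler0n.
have i1 : m.-integrable D (EFin \o \1_B).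
  apply: (@bounded_support_integrable _ 1).
  - exact: measurable_funTS.
  - by move=> x _; rewrite ger0_norm ?indicE ?ler0n// lern1 leq_b1.
  - by move=> x _ nB; rewrite indicE memNset.
rewrite RintegralZl// ler_wpM2l// /Rintegral integral_indic// fine_le//.
- rewrite ge0_fin_numE// (le_lt_trans _ Boo)// le_measure// ?inE//.
  exact: measurableI.
- by rewrite ge0_fin_numE.
- by rewrite le_measure// ?inE//; exact: measurableI.
Qed.

Lemma bounded_dominated_cvg (f_ : nat -> X -> R) (f : X -> R) (C : R) :
  (forall i, measurable_fun D (f_ i)) -> measurable_fun D f ->
  (forall i x, D x -> `|f_ i x| <= C) ->
  (forall i x, D x -> ~ B x -> f_ i x = 0) ->
  {ae m, forall x, D x -> f_ i x @[i --> \oo] --> f x} ->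
  \int[m]_(x in D) f_ i x @[i --> \oo] --> \int[m]_(x in D) f x.
Proof.
move=> mf_ mf fC fB ae.
have iB : m.-integrable D (EFin \o (fun x => C * \1_B x)).
  apply: (@bounded_support_integrable _ `|C|).
  - by apply: measurable_funM => //; exact: measurable_funTS.
  - move=> x _; rewrite normrM ler_piMr// ger0_norm ?indicE ?ler0n//.
    by rewrite lern1 leq_b1.
  - by move=> x _ nB; rewrite indicE memNset// mulr0.
have [] := @dominated_convergence _ _ _ m D mD (fun i x => (f_ i x)%:E)
  (fun x => (f x)%:E) (fun x => (C * \1_B x)%:E).
- by move=> i; exact/measurable_EFinP.
- exact/measurable_EFinP.
- by apply: filterS ae => x h Dx; apply: cvg_EFin; [exact: nearW|exact: h].
- exact: iB.
- apply: aeW => x i Dx; rewrite lee_fin.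
  have [Bx|nBx] := pselect (B x); first by rewrite indicE mem_set// mulr1 fC.
  by rewrite fB// normr0 indicE memNset// mulr0.
move=> fi _ h; apply: fine_cvg; rewrite fineK; first exact: h.
exact: integrable_fin_num.
Qed.

End bounded_support.

Section spacetime_integral.
Variables (R : realType) (n : nat).
Notation V := (R * 'rV[R]_n)%type.
Notation st := (spacetime_lebesgue R n).
Notation mu := (lebesgue_measure \x lebesgue_rV R n)%E.

Definition st_ball (r : R) : set V := [set z | `|z| <= r].

Lemma st_preserving : measure_preserving st mu (fun z : spacetime_type R n => z).
Proof. exact: completion_preserving. Qed.

Lemma st_measurable (D : set V) :
  measurable (D : set (measurableTypeR R * 'rV[R]_n)) ->
  measurable (D : set (spacetime_type R n)).
Proof. exact: (preserving_preimage st_preserving). Qed.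

Lemma st_measurable_fun d (Y : measurableType d) (f : V -> Y) :
  measurable_fun setT (f : measurableTypeR R * 'rV[R]_n -> Y) ->
  measurable_fun setT (f : spacetime_type R n -> Y).
Proof. exact: (preserving_measurable_fun st_preserving). Qed.

(** The target carries the uncompleted product: a translation then only has to be measurable into
    the Borel sets, which is enough for continuous integrands. *)
Lemma st_translation (a : V) : measure_preserving st mu (fun z => z + a).
Proof.
have [mp pp] := product_preserving (lebesgue_measure_translation a.1)
  (lebesgue_rV_translation a.2).
have [mi pi] := st_preserving.
split; first exact: (measurableT_comp mp mi).
move=> B mB; rewrite -pp// -pi//.
by rewrite -[X in measurable X]setTI; exact: mp.
Qed.

Lemma continuous_measurable_prod (f : V -> R) : continuous f ->
  measurable_fun setT (f : measurableTypeR R * 'rV[R]_n -> measurableTypeR R).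
Proof.
move=> cf; apply: (measurability _ (RGenOpens.measurableE R)).
move=> _ [_ [a [b ->]] <-]; rewrite setTI; apply: open_measurable_prod.
by move/continuousP: cf; apply; exact: interval_open.
Qed.

Lemma continuous_st_measurable (f : V -> R) : continuous f ->
  measurable_fun setT (f : spacetime_type R n -> R).
Proof. by move=> cf; apply: st_measurable_fun; exact: continuous_measurable_prod. Qed.

Lemma measurable_prod_ball r :
  measurable (st_ball r : set (measurableTypeR R * 'rV[R]_n)).
Proof.
rewrite -[X in measurable X]setCK; apply: measurableC; apply: open_measurable_prod.
rewrite openC; exact: (@closed_comp _ _ (fun z : V => `|z|) _
  (in1W (@norm_continuous _ _)) (@closed_le R r)).
Qed.

Lemma st_ball_measurable r : measurable (st_ball r : set (spacetime_type R n)).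
Proof. apply: st_measurable; exact: measurable_prod_ball. Qed.

Definition rV_box (r : R) : set 'rV[R]_n := [set x | forall i, x 0 i \in `[- r, r]].

Lemma rV_box_measurable r : measurable (rV_box r).
Proof.
have -> : rV_box r = \bigcap_(i in [set: 'I_n]) (fun x : 'rV[R]_n => x 0 i) @^-1` `[- r, r]%classic.
  by apply/seteqP; split => x h i; [move=> _; exact: h|exact: (h i I)].
apply: fin_bigcap_measurable => // i _.
by rewrite -[X in measurable X]setTI; apply: measurable_rV_coord => //; exact: measurable_itv.
Qed.

Lemma lebesgue_rV_box_lty r : (lebesgue_rV R n (rV_box r) < +oo)%E.
Proof.
have := @lebesgue_rV_box R n (fun=> [set` (`[- r, r] : interval R)]) (fun=> measurable_itv _).
rewrite -[X in lebesgue_rV R n X]/(rV_box r) => ->.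
rewrite -ge0_fin_numE; last by apply: prode_ge0.
apply: (big_ind (fun x => x \is a fin_num)) => // [x y|i _]; first exact: fin_numM.
by rewrite [lebesgue_measure _]lebesgue_measure_itv; case: ifP.
Qed.

Lemma rV_box_norm r (x : 'rV[R]_n) : `|x| <= r -> rV_box r x.
Proof.
move=> xr i; rewrite in_itv /= -ler_norml.
exact: le_trans ((@rV_basis R n).2 x i) xr.
Qed.

Lemma st_ball_lty r : (st (st_ball r) < +oo)%E.
Proof.
rewrite -[st _]/(st ((fun z : spacetime_type R n => z) @^-1` (st_ball r))).
rewrite st_preserving.2; last exact: measurable_prod_ball.
apply: (@le_lt_trans _ _ (mu (`[- r, r]%classic `*` rV_box r))).
  apply: le_measure; rewrite ?inE; first exact: measurable_prod_ball.
    by apply: measurableX; [exact: measurable_itv|exact: rV_box_measurable].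
  move=> [t x]; rewrite /st_ball /= prod_normE /= ge_max => /andP[tr xr].
  by split; [rewrite /= in_itv /= -ler_norml|exact: rV_box_norm].
have mI : (lebesgue_measure (`[(- r)%R, r]%classic : set R) < +oo)%E.
  by rewrite lebesgue_measure_itv; case: ifP => // _; rewrite ltry.
rewrite product_measure1E; [|exact: measurable_itv|exact: rV_box_measurable].
apply: lte_mul_pinfty => //; last exact: lebesgue_rV_box_lty.
by rewrite ge0_fin_numE.
Qed.

Lemma strip_measurable T : measurable (strip T : set (spacetime_type R n)).
Proof.
apply: st_measurable; apply: measurableX => //; exact: measurable_itv.
Qed.

Lemma Rintegral_strip_translation T (f : V -> R) (a : V) : a.1 = 0 -> continuous f ->
  \int[st]_(z in strip T) f (z + a) = \int[st]_(z in strip T) f z.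
Proof.
move=> a0 cf.
have mf := continuous_measurable_prod cf.
have mS : measurable (strip T : set (measurableTypeR R * 'rV[R]_n)).
  by apply: measurableX => //; exact: measurable_itv.
rewrite -(preserving_Rintegral st_preserving mS (measurable_funTS mf)).
rewrite (preserving_Rintegral (st_translation a) mS (measurable_funTS mf)).
congr Rintegral; apply/seteqP.
by split => -[t x] []; rewrite /strip /= in_itv /= a0 addr0 in_itv.
Qed.

Lemma Rintegral_translation (f : V -> R) (a : V) : continuous f ->
  \int[st]_z f (z + a) = \int[st]_z f z.
Proof.
move=> cf; have mf := continuous_measurable_prod cf.
have mT : measurable [set: measurableTypeR R * 'rV[R]_n] by [].
rewrite -(preserving_Rintegral st_preserving mT mf).
by rewrite (preserving_Rintegral (st_translation a) mT mf) preimage_setT.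
Qed.

End spacetime_integral.

(** * Difference quotients and integration by parts on the strip *)

Section difference_quotients.
Variables (R : realType) (V : normedModType R).

(** The steps form a sequence, as dominated convergence requires; [i.+1] keeps them nonzero and at
    most 1. *)
Definition dq (f : V -> R) (v : V) (i : nat) (z : V) : R :=
  i.+1%:R * (f (z + i.+1%:R^-1 *: v) - f z).

Lemma dq_cvg (f : V -> R) v z : derivable f z v ->
  dq f v i z @[i --> \oo] --> 'D_v f z.
Proof.
move=> df; have h0 : (fun i : nat => i.+1%:R^-1 : R) @ \oo --> (0 : R)^'.
  move=> A nA; have nA' : nbhs (0 : R) (fun y => y != 0 -> A y) by exact: nA.
  have : \forall i \near \oo, (fun y : R => y != 0 -> A y) (harmonic i).
    exact: (@cvg_harmonic R _ nA').
  by apply: filterS => i; apply; apply: lt0r_neq0; exact: harmonic_gt0.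
have := cvg_comp _ _ h0 df; apply: cvg_trans.
rewrite (_ : (_ \o _) = (fun i => dq f v i z))//.
by apply/funext => i /=; rewrite /dq invrK [_ *: v + z]addrC.
Qed.

Lemma dq_le (f : V -> R) v i z (L : R) : (forall x y, `|f x - f y| <= L * `|x - y|) ->
  `|dq f v i z| <= L * `|v|.
Proof.
move=> Lf; rewrite /dq normrM normr_nat -ler_pdivlMl ?ltr0n//.
apply: (le_trans (Lf _ _)); rewrite addrC addKr normrZ.
by rewrite (@ger0_norm _ i.+1%:R^-1) ?invr_ge0// mulrCA.
Qed.

Lemma dq_continuous (f : V -> R) v i : continuous f -> continuous (dq f v i).
Proof.
move=> cf; apply: (@of_class_mul _ _ 0); first exact: (@of_class_cst _ _ 0).
apply: (@of_class_add _ _ 0); last exact: (@of_class_opp _ _ 0).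
move=> z; apply: (@continuous_comp _ _ _ (fun z => z + i.+1%:R^-1 *: v) f); last exact: cf.
apply: (@continuousD _ _ _ id (cst _)); [exact: cvg_id|exact: cst_continuous].
Qed.

End difference_quotients.

Section spacetime_calculus.
Variables (R : realType) (n : nat).
Notation V := (R * 'rV[R]_n)%type.
Notation st := (spacetime_lebesgue R n).

(** [None] is the time direction: one finite type indexes all coordinate directions of spacetime. *)
Definition dir (r : option 'I_n) : V := if r is Some j then dir_x R j else dir_t R n.

Lemma sum_option (W : nmodType) (I : finType) (F : option I -> W) :
  \sum_r F r = F None + \sum_i F (Some i).
Proof.
rewrite (bigD1 None)//=; congr (_ + _).
rewrite (@reindex_omap _ _ _ _ _ Some id) /=; last by case.
by apply: eq_bigl => i; rewrite eqxx.
Qed.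

Definition dir_coord (z : V) (r : option 'I_n) : R :=
  if r is Some j then z.2 0 j else z.1.

Lemma dir_basis : coordinate_basis dir dir_coord.
Proof.
split=> [[t x]|[t x] [j|]] /=.
- rewrite sum_option /dir_coord /dir /dir_t /dir_x /=.
  transitivity (t *: (1, 0) + (0, \sum_i x 0 i *: delta_mx 0 i) : V).
    rewrite -row_sum_delta; congr (_, _) => /=; first by rewrite [_ *: _]mulr1 addr0.
    by rewrite scaler0 add0r.
  congr (_ + _); apply: injective_projections => /=.
    rewrite (big_morph fst (id1 := 0) (op1 := +%R))//.
    by rewrite big1// => i _; rewrite /= scaler0.
  by rewrite (big_morph snd (id1 := 0) (op1 := +%R)).
- rewrite prod_normE /= le_max; apply/orP; right; exact: (rV_basis _ _).2.
- by rewrite prod_normE /= le_max lexx.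
Qed.

Lemma st_ball_compact r : compact (@st_ball R n r).
Proof.
have c1 : compact `[- r, r]%classic by exact: segment_compact.
have c2 : compact (@rV_ball R n r).
  apply: bounded_closed_compact.
    by exists r; split; [exact: num_real|move=> M rM x /= /le_trans; apply; exact: ltW].
  exact: (@closed_comp _ _ (fun x : 'rV[R]_n => `|x|) _ (in1W (@norm_continuous _ _))
    (@closed_le R r)).
rewrite (_ : st_ball r = `[- r, r]%classic `*` rV_ball r); first exact: compact_setX.
apply/seteqP; split => -[t x]; rewrite /st_ball /rV_ball /= prod_normE /= ge_max in_itv /=.
  by rewrite -ler_norml => /andP.
by rewrite -ler_norml => -[-> ->].
Qed.

Lemma bounded_support_bound r (f : V -> R) : continuous f ->
  (forall z, ~ st_ball r z -> f z = 0) ->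
  exists2 C : R, 0 <= C & forall z, `|f z| <= C.
Proof.
move=> cf f0.
have : compact (f @` st_ball r).
  by apply: continuous_compact; [exact: continuous_subspaceT|exact: st_ball_compact].
move=> /compact_bounded [M [Mr hM]].
exists (Num.max 0 (M + 1)); first by rewrite le_max lexx.
move=> x; have [rx|nrx] := pselect (st_ball r x); last first.
  by rewrite f0// normr0 le_max lexx.
rewrite le_max; apply/orP; right.
by apply: hM; [rewrite ltrDl|exists x].
Qed.

Lemma st_support_integrable (S : set V) r C (f : V -> R) :
  measurable (S : set (spacetime_type R n)) ->
  measurable_fun (S : set (spacetime_type R n)) f ->
  (forall z, S z -> `|f z| <= C) -> (forall z, S z -> ~ st_ball r z -> f z = 0) ->
  st.-integrable S (EFin \o f).
Proof.
move=> mS mf fC f0.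
exact: (bounded_support_integrable mS (st_ball_measurable r) (st_ball_lty _ _) mf fC f0).
Qed.

Lemma continuous_supported_integrable (S : set V) r (f : V -> R) :
  measurable (S : set (spacetime_type R n)) -> continuous f ->
  (forall z, ~ st_ball r z -> f z = 0) -> st.-integrable S (EFin \o f).
Proof.
move=> mS cf f0; have [C _ fC] := bounded_support_bound cf f0.
apply: (@st_support_integrable S r C f mS _ (fun z _ => fC z) (fun z _ => f0 z)).
by apply: measurable_funTS; exact: continuous_st_measurable.
Qed.

Lemma derive_support r (f : V -> R) v : (forall z, ~ st_ball r z -> f z = 0) ->
  forall z, ~ st_ball r z -> 'D_v f z = 0.
Proof.
move=> f0 z nz; have [->|v0] := eqVneq v 0; first exact: derive0.
rewrite -[RHS](derive_cst (0 : R) z v); apply: near_eq_derive => //.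
have oC : open (~` @st_ball R n r).
  rewrite openC; exact: (@closed_comp _ _ (fun z : V => `|z|) _
    (in1W (@norm_continuous _ _)) (@closed_le R r)).
have := open_nbhs_nbhs (conj oC nz); apply: filterS => y /f0 -> //.
Qed.

Lemma bounded_support_lipschitz r (f : V -> R) : of_class 1 f ->
  (forall z, ~ st_ball r z -> f z = 0) ->
  exists2 L : R, 0 <= L & forall x y, `|f x - f y| <= L * `|x - y|.
Proof.
move=> [df cf] f0.
have /choice[C Ch] : forall i, exists C : R, 0 <= C /\ forall z, `|'D_(dir i) f z| <= C.
  move=> i; have [C C0 h] := bounded_support_bound (cf (dir i)) (derive_support (dir i) f0).
  by exists C.
have C0 : 0 <= \sum_i C i by apply: sumr_ge0 => i _; case: (Ch i).
exists (#|{: option 'I_n}|%:R * \sum_i C i); first by rewrite mulr_ge0.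
move=> x y; apply: (lipschitz_of_bounded_derive dir_basis (A := setT)) => //.
move=> z i _; apply: (le_trans ((Ch i).2 z)).
by rewrite (bigD1 i)//= lerDl sumr_ge0// => j _; case: (Ch j).
Qed.

Lemma bounded_support_taylor r (f : V -> R) : of_class 2 f ->
  (forall z, ~ st_ball r z -> f z = 0) ->
  exists2 C : R, 0 <= C & forall x h, `|f (x + h) - f x - 'D_h f x| <= C * `|h| ^+ 2.
Proof.
move=> [df cf] f0.
have /choice[C Ch] : forall i, exists C : R, 0 <= C /\
    forall x y, `|'D_(dir i) f x - 'D_(dir i) f y| <= C * `|x - y|.
  move=> i; have [C C0 h] := bounded_support_lipschitz (cf (dir i)) (derive_support (dir i) f0).
  by exists C.
have C0 : 0 <= \sum_i C i by apply: sumr_ge0 => i _; case: (Ch i).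
exists (#|{: option 'I_n}|%:R * \sum_i C i); first by rewrite mulr_ge0.
move=> x h.
have := @taylor_bound _ _ _ _ _ dir_basis setT f (\sum_i C i) C0 (fun _ _ _ _ _ _ => I) df.
move=> /(_ _ x (x + h) I I); rewrite [x + h - x]addrAC subrr add0r; apply => y z i _ _.
apply: (le_trans ((Ch i).2 _ _)).
by rewrite ler_wpM2r// (bigD1 i)//= lerDl sumr_ge0// => j _; case: (Ch j).
Qed.

(** A direction with no time component preserves the strip, so by translation invariance every
    difference quotient has integral 0. The quotients are bounded by the Lipschitz constant on one
    ball, and dominated convergence gives the derivative. *)
Lemma integral_derive_x T r (f : V -> R) v : v.1 = 0 -> of_class 1 f ->
  (forall z, ~ st_ball r z -> f z = 0) ->
  \int[st]_(z in strip T) 'D_v f z = 0.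
Proof.
move=> v0 sf f0; have cf := of_class_continuous sf.
have [L L0 Lf] := bounded_support_lipschitz sf f0.
have mS := @strip_measurable R n T.
(* The steps are at most 1, so enlarging the radius by the norm of [v] contains the support of every
   translate. *)
have fs i z : ~ st_ball (r + `|v|) z -> f (z + i.+1%:R^-1 *: v) = 0.
  rewrite /st_ball /= => nz; apply: f0 => zr; apply: nz.
  rewrite -[z](addrK (i.+1%:R^-1 *: v)).
  apply: (le_trans (ler_normB _ _)); rewrite lerD// normrZ ler_piMl//.
  by rewrite ger0_norm ?invr_ge0// invf_le1 ?ler1n// ltr0n.
have sh i z : ~ st_ball (r + `|v|) z -> dq f v i z = 0.
  move=> nz; rewrite /dq fs// f0 ?subrr ?mulr0// => zr; apply: nz.
  by rewrite /st_ball /=; apply: le_trans zr _; rewrite lerDl.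
have z0 i : \int[st]_(z in strip T) dq f v i z = 0.
  have cs : continuous (fun z : V => f (z + i.+1%:R^-1 *: v)).
    move=> z; apply: (@continuous_comp _ _ _ (fun z : V => z + i.+1%:R^-1 *: v) f); last exact: cf.
    by apply: (@continuousD _ _ _ id (cst _)); [exact: cvg_id|exact: cst_continuous].
  have i1 := continuous_supported_integrable mS cs (fs i).
  have i2 := continuous_supported_integrable mS cf f0.
  have i3 := integrableB mS i1 i2.
  rewrite /dq RintegralZl//= RintegralB//.
  by rewrite Rintegral_strip_translation ?subrr ?mulr0//= v0 scaler0.
have h : \int[st]_(z in strip T) dq f v i z @[i --> \oo] -->
    \int[st]_(z in strip T) 'D_v f z.
  apply: (bounded_dominated_cvg mS (st_ball_measurable (r + `|v|))
    (st_ball_lty _ _) (C := L * `|v|)).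
  - by move=> i; apply: measurable_funTS; apply: continuous_st_measurable;
      exact: dq_continuous.
  - by apply: measurable_funTS; apply: continuous_st_measurable; case: sf => _ /(_ v).
  - by move=> i z _; exact: dq_le.
  - by move=> i z _; exact: sh.
  - by apply: aeW => z _; apply: dq_cvg; apply: diff_derivable; case: sf.
rewrite -(cvg_lim _ h)//.
by rewrite (_ : (fun i => _) = fun=> 0) ?lim_cst//; apply/funext.
Qed.

(** Fubini with the time integral inside; on each line the fundamental theorem of calculus leaves
    [- f (0, x)], since [f] vanishes at time [T]. *)
Lemma integral_derive_t T r (f : V -> R) : 0 < T -> of_class 1 f ->
  (forall z, ~ st_ball r z -> f z = 0) -> (forall x, f (T, x) = 0) ->
  \int[st]_(z in strip T) 'D_(dir_t R n) f z + \int[space_lebesgue R n]_x f (0, x) = 0.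
Proof.
move=> T0 [df cf] f0 fT.
have cDf : continuous (fun z => 'D_(dir_t R n) f z) by exact: cf.
have cf0 : continuous f by move=> z; exact/differentiable_continuous/df.
have mD := continuous_measurable_prod cDf.
have mS : measurable (strip T : set (measurableTypeR R * 'rV[R]_n)).
  by apply: measurableX => //; exact: measurable_itv.
have [C C0 fC] := bounded_support_bound cDf (derive_support (dir_t R n) f0).
rewrite -(preserving_Rintegral (@st_preserving R n) mS (measurable_funTS mD)).
set mu := (lebesgue_measure \x lebesgue_rV R n)%E.
have iS : mu.-integrable (strip T) (EFin \o (fun z => 'D_(dir_t R n) f z)).
  apply: (bounded_support_integrable mS (measurable_prod_ball r) _ (C := C)) => //.
  - have := st_ball_lty n r; rewrite -(@st_preserving R n).2//.
    exact: measurable_prod_ball.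
  - exact: measurable_funTS.
  - by move=> z _; exact: derive_support.
have cx (x : 'rV[R]_n) : continuous (fun t : R => (t, x)).
  by move=> t; exact: (@cvg_pair _ _ _ (nbhs t) (nbhs t) (nbhs x) _ _ _ id (cst x)
    cvg_id (cvg_cst x)).
rewrite /Rintegral integral_mkcond -integral21_prod_meas1; last first.
  exact/(integrable_mkcond _ mS).
have -> : (fun x => fubini_G lebesgue_measure
     ((fun z => ('D_(dir_t R n) f z)%:E) \_ (strip T)) x) =
   (fun x => (- f (0, x))%:E).
  apply/funext => x; rewrite /fubini_G.
  transitivity (\int[lebesgue_measure]_(t in `[0%R, T]) ('D_(dir_t R n) f (t, x))%:E)%E.
    rewrite [RHS]integral_mkcond; apply: eq_integral => t _; rewrite !patchE.
    rewrite (_ : (t, x) \in strip T = (t \in `[0%R, T]%classic))//.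
    by apply/idP/idP; rewrite !inE; [case|split].
  have D (t : R) : is_derive t (1 : R) (fun t => f (t, x)) ('D_(dir_t R n) f (t, x)).
    have E (s : R) : (s, x) = (0, x) + s *: dir_t R n.
      by rewrite /dir_t; apply: injective_projections;
        rewrite /= ?add0r ?[_ *: 1]mulr1// scaler0 addr0.
    rewrite E (_ : (fun t => f (t, x)) = (fun s => f ((0, x) + s *: dir_t R n))).
      by apply: derive_comp_line; exact: diff_derivable.
    by apply/funext => s; rewrite -E.
  have cF (t : R) : {for t, continuous (fun t => f (t, x))}.
    by apply: (@continuous_comp _ _ _ (fun t => (t, x)) f); [exact: cx|exact: cf0].
  rewrite (@continuous_FTC2 _ _ (fun t => f (t, x)))//.
  - by rewrite fT sub0e.
  - apply: continuous_subspaceT => t.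
    by apply: (@continuous_comp _ _ _ (fun t => (t, x)) (fun z => 'D_(dir_t R n) f z));
      [exact: cx|exact: cDf].
  - split => [t _|/=|/=]; first by case: (D t).
      by apply: cvg_at_right_filter; exact: cF.
    by apply: cvg_at_left_filter; exact: cF.
  - by move=> t _; rewrite derive1E; case: (D t).
have c0 : continuous (fun x : 'rV[R]_n => f (0, x)).
  move=> x; apply: (@continuous_comp _ _ _ (fun x : 'rV[R]_n => ((0 : R), x)) f).
    exact: (@cvg_pair _ _ _ (nbhs x) (nbhs (0 : R)) (nbhs x) _ _ _ (cst 0) id
      (cvg_cst 0) cvg_id).
  exact: cf0.
have pr := @completion_preserving _ _ _ (lebesgue_rV R n).
have mf0 : measurable_fun setT (fun x : 'rV[R]_n => f (0, x)).
  exact: continuous_measurable_rV_R.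
rewrite -[X in _ + fine X](preserving_integral pr measurableT
    (f := fun x => (f (0, x))%:E)); last first.
  exact/measurable_EFinP.
rewrite [X in fine X + _](_ : _ = \int[lebesgue_rV R n]_x (- (f (0%R, x))%:E))%E; last first.
  by apply: eq_integral => x _; rewrite EFinN.
have [C' C'0 fC'] := bounded_support_bound cf0 f0.
have i0 : (lebesgue_rV R n).-integrable setT (EFin \o (fun x => f (0, x))).
  apply: (bounded_support_integrable measurableT (@rV_box_measurable R n r)
    (@lebesgue_rV_box_lty R n r) (C := C')) => // x _ nx.
  rewrite f0// /st_ball /= prod_normE /= ge_max => /andP[_ xr].
  by apply: nx; exact: rV_box_norm.
rewrite integralN; first by rewrite fineN addNr.
exact: (integrable_add_def measurableT i0).
Qed.

End spacetime_calculus.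

(** * Smooth bumps and kernels *)

Section flat_exponential.
Variable R : realType.

(* s^{-m} exp (- 1 / s): up to linear combinations this family is closed under
   differentiation, which gives the smoothness of exp (- 1 / s) at 0. *)
Definition gexp (m : nat) (s : R) : R :=
  if 0 < s then s^-1 ^+ m * expR (- s^-1) else 0.

Lemma gexp_gt0 m s : 0 < s -> 0 < gexp m s.
Proof. by move=> s0; rewrite /gexp s0 mulr_gt0 ?expR_gt0// exprn_gt0// invr_gt0. Qed.

Lemma gexp_eq0 m s : s <= 0 -> gexp m s = 0.
Proof. by move=> s0; rewrite /gexp ltNge s0. Qed.

Lemma gexp_ge0 m s : 0 <= gexp m s.
Proof. by case: (ltP 0 s) => s0; [exact/ltW/gexp_gt0|rewrite gexp_eq0]. Qed.

Lemma gexpS m s : gexp m s = s * gexp m.+1 s.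
Proof.
rewrite /gexp; case: ifPn => [s0|_]; last by rewrite mulr0.
by rewrite exprS !mulrA mulfV ?mul1r// gt_eqF.
Qed.

(** The inequality u / (N + 1) <= exp (u / (N + 1)), raised to the power N + 1. *)
Lemma exprn_le_expR N (u : R) : 0 <= u -> u ^+ N.+1 <= N.+1%:R ^+ N.+1 * expR u.
Proof.
move=> u0; have -> : expR u = expR (u / N.+1%:R) ^+ N.+1.
  by rewrite -expRM_natl mulrC divfK// pnatr_eq0.
rewrite -exprMn lerXn2r ?nnegrE// ?mulr_ge0 ?expR_ge0//.
rewrite -ler_pdivrMl ?ltr0n// mulrC; apply: le_trans (expR_ge1Dx _).
by rewrite lerDr.
Qed.

(** Flatness at 0: two powers of [s] are split off by passing to [gexp m.+2], which is bounded
    because the exponential beats every power of 1 / s. *)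
Lemma gexp_le m s : `|gexp m s| <= m.+2%:R ^+ m.+2 * s ^+ 2.
Proof.
rewrite ger0_norm ?gexp_ge0// 2!gexpS; case: (ltP 0 s) => s0; last first.
  by rewrite gexp_eq0// !mulr0 mulr_ge0 ?sqr_ge0.
rewrite mulrA -expr2 mulrC ler_wpM2r ?sqr_ge0//.
rewrite /gexp s0 expRN -ler_pdivlMr ?invr_gt0 ?expR_gt0// invrK.
by apply: exprn_le_expR; rewrite invr_ge0 ltW.
Qed.

(** Product rule for positive [s], a locally zero function for negative [s]. At 0 the quadratic
    bound of [gexp_le] makes the difference quotient at most a multiple of [h]. *)
Lemma is_derive_gexp m (s : R) :
  is_derive s (1 : R) (gexp m) (gexp m.+2 s - m%:R * gexp m.+1 s).
Proof.
have [s0|s0|s0] := ltgtP 0 s.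
- have near : \near s, s^-1 ^+ m * expR (- s^-1) = gexp m s.
    by have := lt_nbhsr s0; apply: filterS => y y0; rewrite /gexp y0.
  have sn0 : s != 0 by rewrite gt_eqF.
  apply: (near_eq_is_derive near).
  have dV : is_derive s (1 : R) (fun s : R => s^-1) (- s^-1 ^+ 2).
    have := is_deriveV sn0 (is_derive_id s (1 : R)).
    by rewrite -[_ *: 1]/(_ * 1) mulr1 exprVn.
  have dX : is_derive s (1 : R) (fun s : R => s^-1 ^+ m)
      (- (m%:R * s^-1 ^+ m.+1)).
    have := @is_deriveX _ _ (fun s : R => s^-1) m s 1 _ dV.
    rewrite exprfctE (_ : _ *: _ = - (m%:R * s^-1 ^+ m.+1))//.
    rewrite -[_ *: _]/(_ * _) mulrN -mulrA.
    by case: (m) => [|k]; rewrite ?mul0r// -exprD addn2.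
  have dE : is_derive s (1 : R) (fun s : R => expR (- s^-1)) (s^-1 ^+ 2 * expR (- s^-1)).
    have dN := is_deriveN dV; rewrite opprK in dN.
    have := @is_derive1_comp R expR (fun s => - s^-1) s _ _ (is_derive_expR _) dN.
    by rewrite mulrC.
  have := is_deriveM dX dE; rewrite /gexp s0.
  rewrite -![_ *: _]/(_ * _); congr (is_derive _ _ _ _).
  by rewrite !exprS; ring.
- have near : \near s, 0 = gexp m s.
    by have := lt_nbhsl s0; apply: filterS => y y0; rewrite gexp_eq0// ltW.
  apply: (near_eq_is_derive near).
  by rewrite !gexp_eq0 ?ltW// mulr0 subr0; exact: is_derive_cst.
- rewrite -s0 !gexp_eq0// mulr0 subr0.
  have h : (fun h : R => h^-1 *: ((gexp m \o shift 0) (h *: 1) - gexp m 0)) @ 0^' --> (0 : R).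
    apply/cvgrPdist_le => e e0; pose C := m.+2%:R ^+ m.+2 : R.
    have C0 : 0 < C by rewrite exprn_gt0.
    near=> h; have hn0 : h != 0 by near: h; exact: nbhs_dnbhs_neq.
    rewrite sub0r normrN /= addr0 [h *: 1]mulr1 (gexp_eq0 m (lexx 0)) subr0.
    rewrite normrM normfV ler_pdivrMl ?normr_gt0//.
    apply: (le_trans (gexp_le _ _)); rewrite -/C -(@real_normK _ h) ?num_real//.
    have he : `|h| <= e / C.
      by near: h; exact: (@dnbhs0_le R R _ (divr_gt0 e0 C0)).
    by rewrite expr2 mulrCA ler_wpM2l// mulrC -ler_pdivlMr.
  by split; [apply: cvgP; exact: h|exact: (cvg_lim _ h)].
Unshelve. all: by end_near. Qed.

(** Induction on [k] for all [m] at once, because differentiating [gexp m] leads to the indices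
    [m.+1] and [m.+2]. *)
Lemma of_class_gexp_comp (V : normedModType R) m k (p : V -> R) :
  (forall j, of_class j p) -> of_class k (fun z => gexp m (p z)).
Proof.
move=> sp; elim: k m => [|k ih] m.
  move=> z; apply: (@continuous_comp _ _ _ p (gexp m)); first exact: (sp 0%N).
  apply: differentiable_continuous; apply/derivable1_diffP.
  by case: (is_derive_gexp m (p z)).
have dg y : differentiable (gexp m) y.
  by apply/derivable1_diffP; case: (is_derive_gexp m y).
have dp z : differentiable p z by case: (sp 1%N).
split=> [z|v]; first exact: differentiable_comp.
have -> : (fun z => 'D_v (fun z => gexp m (p z)) z) =
    fun z => (gexp m.+2 (p z) - m%:R * gexp m.+1 (p z)) * 'D_v p z.
  apply/funext => z; rewrite deriveE; last exact: differentiable_comp.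
  have -> := @diff_comp _ _ _ _ p (gexp m) z (dp z) (dg (p z)).
  rewrite /= (deriveE v (dp z)) (diff1E (dg (p z))) derive1E.
  by case: (is_derive_gexp m (p z)) => _ ->; rewrite [LHS]mulrC.
apply: of_class_mul; last by case: (sp k.+1) => _ /(_ v).
apply: of_class_add; first exact: ih.
apply: of_class_opp; apply: of_class_mul; last exact: ih.
exact: of_class_cst.
Qed.

End flat_exponential.

(** * Bumps over paraboloids and a forward kernel *)

Section paraboloids.
Variables (R : realType) (n : nat).
Notation V := (R * 'rV[R]_n)%type.
Notation st := (spacetime_lebesgue R n).
Implicit Types (a b d e : R) (z v : V).

Lemma is_derive_linear (W : normedModType R) (f : W -> R) (x v : W) :
  (forall a x y, f (a *: x + y) = a * f x + f y) -> continuous f ->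
  is_derive x v f (f v).
Proof.
move=> lf cf; have lf' : linear f by move=> a u w; rewrite lf.
pose L : {linear W -> R} := HB.pack f (GRing.isLinear.Build _ _ _ _ f lf').
have dL : differentiable f x by exact: (@linear_differentiable _ _ _ L).
apply: DeriveDef; first exact: diff_derivable.
by rewrite deriveE//; have -> := @diff_lin _ _ _ L x cf.
Qed.

Lemma continuous_time : continuous (fun z : V => z.1).
Proof. by move=> z; exact: cvg_fst. Qed.

Lemma continuous_space_coord j : continuous (fun z : V => z.2 0 j).
Proof.
move=> z; apply: (@continuous_comp _ _ _ snd (fun x : 'rV[R]_n => x 0 j)).
  exact: cvg_snd.
exact: coord_continuous.
Qed.

Definition paraboloid a b d e z : R :=
  a + b * z.1 + d * (z.1 * z.1) + e * \sum_j (z.2 0 j * z.2 0 j).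

Lemma paraboloid_of_class m a b d e : of_class m (paraboloid a b d e).
Proof.
have t1 : of_class m (fun z : V => z.1).
  by apply: of_class_linear => //; exact: continuous_time.
have x1 j : of_class m (fun z : V => z.2 0 j).
  apply: of_class_linear => [c x y|]; first by rewrite /= !mxE.
  exact: continuous_space_coord.
apply: of_class_add; first apply: of_class_add; first apply: of_class_add.
- exact: of_class_cst.
- by apply: of_class_mul => //; exact: of_class_cst.
- by apply: of_class_mul; [exact: of_class_cst|exact: of_class_mul].
- apply: of_class_mul; first exact: of_class_cst.
  by apply: of_class_sum => j; exact: of_class_mul.
Qed.

Lemma is_derive_paraboloid a b d e z v : is_derive z v (paraboloid a b d e)
  (b * v.1 + d * (2 * z.1 * v.1) + e * \sum_j (2 * z.2 0 j * v.2 0 j)).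
Proof.
have dt : is_derive z v (fun z : V => z.1) v.1.
  by apply: is_derive_linear => //; exact: continuous_time.
have dx j : is_derive z v (fun z : V => z.2 0 j) (v.2 0 j).
  apply: (@is_derive_linear _ (fun z : V => z.2 0 j)) => [c x y|].
    by rewrite /= !mxE.
  exact: continuous_space_coord.
have dt2 := is_deriveM dt dt.
have dx2 := is_derive_sum (fun j => is_deriveM (dx j) (dx j)).
have da := is_derive_cst a z v.
have db := is_deriveM (is_derive_cst b z v) dt.
have dd := is_deriveM (is_derive_cst d z v) dt2.
have de := is_deriveM (is_derive_cst e z v) dx2.
have := is_deriveD (is_deriveD (is_deriveD da db) dd) de.
rewrite (_ : cst a + _ + _ + _ = paraboloid a b d e); last first.
  by apply/funext => y; rewrite /paraboloid /= !fctE fct_sumE.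
congr (is_derive _ _ _ _).
rewrite !scaler0 !addr0 add0r -![_ *: _]/(_ * _) /=; congr (_ + _ * _ + _ * _).
  by ring.
by apply: eq_bigr => j _; rewrite -![_ *: _]/(_ * _); ring.
Qed.

Definition bump a b d e z : R := gexp 0 (paraboloid a b d e z).

Lemma bump_of_class m a b d e : of_class m (bump a b d e).
Proof. by apply: of_class_gexp_comp => j; exact: paraboloid_of_class. Qed.

Lemma bump_ge0 a b d e z : 0 <= bump a b d e z.
Proof. exact: gexp_ge0. Qed.

Lemma derive_bump a b d e z v : 'D_v (bump a b d e) z =
  (b * v.1 + d * (2 * z.1 * v.1) + e * \sum_j (2 * z.2 0 j * v.2 0 j)) *
  gexp 2 (paraboloid a b d e z).
Proof.
have dp : differentiable (paraboloid a b d e) z.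
  by case: (paraboloid_of_class 1 a b d e).
have dg : differentiable (gexp 0) (paraboloid a b d e z).
  by apply/derivable1_diffP; case: (is_derive_gexp 0 (paraboloid a b d e z)).
rewrite deriveE; last exact: differentiable_comp.
have -> := @diff_comp _ _ _ _ (paraboloid a b d e) (gexp 0) z dp dg.
rewrite /= -(deriveE v dp) (diff1E dg) derive1E.
case: (is_derive_gexp 0 (paraboloid a b d e z)) => _ ->.
case: (is_derive_paraboloid a b d e z v) => _ ->.
by rewrite mul0r subr0.
Qed.

Lemma bump_dir_t a b d e z : 'D_(dir_t R n) (bump a b d e) z =
  (b + 2 * d * z.1) * gexp 2 (paraboloid a b d e z).
Proof.
rewrite derive_bump /= big1 => [|j _]; last by rewrite mxE mulr0.
by congr (_ * _); ring.
Qed.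

Lemma bump_dir_x a b d e z j : 'D_(dir_x R j) (bump a b d e) z =
  2 * e * z.2 0 j * gexp 2 (paraboloid a b d e z).
Proof.
rewrite derive_bump /= (bigD1 j)//= big1 => [|i ij]; last first.
  by rewrite mxE eqxx (negPf ij) mulr0.
by rewrite !mxE !eqxx /=; congr (_ * _); ring.
Qed.

Lemma space_sqr_le z j : z.2 0 j * z.2 0 j <= \sum_j (z.2 0 j * z.2 0 j).
Proof. by rewrite (bigD1 j)//= lerDl sumr_ge0// => i _; rewrite -expr2 sqr_ge0. Qed.

Lemma space_sqr_ge0 z : 0 <= \sum_j (z.2 0 j * z.2 0 j).
Proof. by rewrite sumr_ge0// => i _; rewrite -expr2 sqr_ge0. Qed.

Lemma norm_rV_le (x : 'rV[R]_n) r : 0 <= r -> (forall j, `|x 0 j| <= r) -> `|x| <= r.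
Proof.
move=> r0 h; rewrite [`|x|]mx_normrE.
by apply/bigmax_leP; split => // -[i j] _ /=; rewrite ord1.
Qed.

Definition st_box (t0 r : R) : set V := `[t0 - r, t0 + r]%classic `*` @rV_box R n r.

(** Serves to show that the kernel has positive mass before it is normalized. *)
Lemma st_box_gt0 (t0 r : R) : 0 < r -> (0 < st (st_box t0 r))%E.
Proof.
move=> r0; rewrite /st_box.
have mI : measurable (`[t0 - r, t0 + r]%classic : set (measurableTypeR R)).
  exact: measurable_itv.
have mB : measurable (`[t0 - r, t0 + r]%classic `*` @rV_box R n r
    : set (measurableTypeR R * 'rV[R]_n)).
  by apply: measurableX; [exact: measurable_itv|exact: rV_box_measurable].
have := (@st_preserving R n).2 _ mB; rewrite preimage_id => ->.
have pE := @product_measure1E _ _ _ _ _ lebesgue_measure (lebesgue_rV R n) _ _ mI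
  (rV_box_measurable r).
suff : (0 < lebesgue_measure (`[(t0 - r)%R, (t0 + r)%R]%classic : set R) *
    lebesgue_rV R n (rV_box r))%E by rewrite -pE => h; exact: h.
have lI (a b : R) : a < b -> (0 < lebesgue_measure (`[a, b]%classic : set R))%E.
  by move=> ab; rewrite lebesgue_measure_itv /= lte_fin ab -EFinB lte_fin subr_gt0.
rewrite mule_gt0 ?lI//; first by rewrite ltrD2l gt0_cp.
have := @lebesgue_rV_box R n (fun=> [set` (`[- r, r] : interval R)]) (fun=> measurable_itv _).
rewrite -[X in lebesgue_rV R n X]/(rV_box r) => ->.
apply: (big_ind (fun x => 0 < x)%E) => // [x y|i _]; first exact: mule_gt0.
by apply: lI; rewrite gt0_cp.
Qed.

Lemma st_box_dist t0 r z : 0 <= r -> st_box t0 r z -> `|(t0, 0) - z| <= r.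
Proof.
move=> r0 [/= z1 z2]; rewrite prod_normE /= ge_max sub0r normrN; apply/andP; split.
  by move: z1; rewrite in_itv /= ler_distlC.
by apply: norm_rV_le => // j; have := z2 j; rewrite in_itv /= ler_norml.
Qed.

(** The normalized bump over the Euclidean ball t^2 + |x|^2 < h t, which touches the slice t = 0
    from above; this makes the time component strictly positive on the support. *)
Lemma kernel_exists (h : R) : 0 < h -> exists rho : V -> R,
  [/\ forall m, of_class m rho, forall z, 0 <= rho z,
      forall z, rho z != 0 -> 0 < z.1 < h /\ `|z.2| <= h &
      \int[st]_z rho z = 1].
Proof.
move=> h0; pose p := bump 0 h (-1) (-1).
have psupp z : p z != 0 -> 0 < z.1 < h /\ `|z.2| <= h.
  rewrite /p /bump => pz.
  have : 0 < paraboloid 0 h (-1) (-1) z.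
    by rewrite ltNge; apply/negP => le0; move: pz; rewrite gexp_eq0// eqxx.
  rewrite /paraboloid => q0; have s0 := space_sqr_ge0 z.
  have t0 : 0 < z.1 by nra.
  have th : z.1 < h by nra.
  split; first by rewrite t0.
  apply: norm_rV_le; first exact: ltW.
  move=> j; have := space_sqr_le z j => sj.
  rewrite -(@ler_pXn2r _ 2)// ?nnegrE ?ltW// real_normK ?num_real// !expr2.
  nra.
have psupp' z : ~ st_ball h z -> p z = 0.
  move=> nz; apply: contra_notP nz => /eqP /psupp [/andP[z0 zh] z2].
  by rewrite /st_ball /= prod_normE /= ge_max z2 ger0_norm ?ltW.
have cp : continuous p by exact: (of_class_continuous (bump_of_class 0 0 h (-1) (-1))).
have ip := continuous_supported_integrable measurableT cp psupp'.
(* The centre of that ball. By continuity [p] exceeds half its value there on a small box, which has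
   positive measure. *)
pose z0 : V := (h / 2, 0).
have pz0 : 0 < p z0.
  apply: gexp_gt0; rewrite /paraboloid /= big1 => [|j _]; last by rewrite mxE mulr0.
  by nra.
have pz02 : 0 < p z0 / 2 by rewrite divr_gt0.
have /cvgrPdist_le/(_ _ pz02)/nbhs_normP[r /= r0 hr] := cp z0.
have r20 : 0 < r / 2 by rewrite divr_gt0.
pose B := st_box (h / 2) (r / 2).
have mB : measurable (B : set (spacetime_type R n)).
  apply: st_measurable; apply: measurableX; first exact: measurable_itv.
  exact: rV_box_measurable.
have Br z : B z -> `|z0 - z| <= r / 2 by exact: (st_box_dist (ltW r20)).
have pB z : B z -> p z0 / 2 <= p z.
  move=> /Br zr; have /hr : `|z0 - z| < r.
    by apply: le_lt_trans zr _; rewrite gtr_pMr// invf_lt1 ?ltr1n.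
  rewrite ler_distlC => /andP[+ _]; apply: le_trans.
  by rewrite [X in X - _]splitr addrK.
have Bball z : B z -> st_ball (h + r) z.
  move=> /Br zr; rewrite /st_ball /= -[z](subKr z0).
  apply: le_trans (ler_normB _ _) _; apply: lerD.
    rewrite prod_normE /= normr0 max_l// ger0_norm ?divr_ge0 ?ltW//.
    by rewrite ltr_pdivrMr// ltr_pMr// ltr1n.
  by apply: le_trans zr _; rewrite ler_piMr ?(ltW r0)// invf_le1 ?ler1n.
have B0 : 0 < fine (st B).
  have Boo : (st B < +oo)%E.
    by apply: le_lt_trans (st_ball_lty n (h + r)); apply: le_measure; rewrite ?inE//;
      exact: st_ball_measurable.
  by apply: fine_gt0; rewrite Boo andbT; exact: st_box_gt0.
have iB : st.-integrable setT (EFin \o (fun z => p z0 / 2 * \1_B z)).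
  apply: (@st_support_integrable _ _ _ (h + r) (p z0 / 2) _ measurableT).
  - by apply: measurable_funM; [exact: measurable_cst|exact: measurable_indic].
  - by move=> z _; rewrite normrM (ger0_norm (ltW pz02)) ger0_norm ?indicE ?ler0n//
      ler_piMr ?(ltW pz02)// lern1 leq_b1.
  - by move=> z _ nz; rewrite indicE memNset ?mulr0// => /Bball.
pose J := \int[st]_z p z.
have J0 : 0 < J.
  apply: (@lt_le_trans _ _ (\int[st]_z (p z0 / 2 * \1_B z))).
    rewrite RintegralZl//; last first.
      have := integrableZl measurableT (2 / p z0) iB.
      apply: eq_integrable => // z _ /=; rewrite -EFinM; congr EFin.
      by field; rewrite gt_eqF.
    rewrite /Rintegral integral_indic// setIT; exact: mulr_gt0.
  apply: le_Rintegral => // z _; have [Bz|nB] := pselect (B z).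
    by rewrite indicE mem_set// mulr1 pB.
  by rewrite indicE memNset// mulr0; exact: bump_ge0.
exists (fun z => J^-1 * p z); split.
- by move=> m; apply: of_class_mul; [exact: of_class_cst|exact: bump_of_class].
- by move=> z; rewrite mulr_ge0 ?invr_ge0 ?(ltW J0)//; exact: bump_ge0.
- by move=> z; rewrite mulf_eq0 negb_or => /andP[_]; exact: psupp.
- by rewrite RintegralZl// mulVf// gt_eqF.
Qed.

End paraboloids.

(** * One-sided mollification *)

Lemma ae_sub d (X : measurableType d) (R : realType) (m : {measure set X -> \bar R})
  (P Q : X -> Prop) : (forall x, P x -> Q x) ->
  (\forall x \ae m, P x) -> \forall x \ae m, Q x.
Proof. by move=> PQ; apply: filterS. Qed.

Lemma ae_and d (X : measurableType d) (R : realType) (m : {measure set X -> \bar R})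
  (P Q : X -> Prop) : (\forall x \ae m, P x) -> (\forall x \ae m, Q x) ->
  \forall x \ae m, P x /\ Q x.
Proof. by move=> aP aQ; apply: filterS2 aP aQ. Qed.

Section quadratic_differentiability.
Variables (R : realType) (V : normedModType R).

Lemma quadratic_differentiable (f : V -> R) (x : V) (df : {linear V -> R}) (C : R) :
  continuous df -> 0 <= C ->
  (forall h, `|h| <= 1 -> `|f (x + h) - f x - df h| <= C * `|h| ^+ 2) ->
  differentiable f x /\ forall v, 'D_v f x = df v.
Proof.
move=> cdf C0 hf.
have E : f \o shift x = cst (f x) + df +o_ (0 : V) id.
  apply/eqaddoP => e e0; near=> h => /=.
  have h1 : `|h| <= 1 by near: h; exact: (@nbhs0_le R V 1 ltr01).
  have he : `|h| <= e / (C + 1).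
    by near: h; apply: (@nbhs0_le R V); rewrite divr_gt0// ltr_wpDl.
  have := hf h h1; rewrite [x + h]addrC -[f (h + x) - f x - df h]addrA -opprD => k.
  apply: (le_trans k); rewrite expr2 mulrA ler_wpM2r//.
  apply: (@le_trans _ _ ((C + 1) * `|h|)); first by rewrite ler_wpM2r// lerDl.
  by rewrite mulrC -ler_pdivlMr// ltr_wpDl.
have dE := diff_unique cdf E.
have D : differentiable f x.
  by apply/diff_locallyP; rewrite dE.
by split => // v; rewrite deriveE// dE.
Unshelve. all: by end_near. Qed.

End quadratic_differentiability.

Section convolution.
Variables (R : realType) (n : nat).
Notation V := (R * 'rV[R]_n)%type.
Notation st := (spacetime_lebesgue R n).
Implicit Types (g rho u : V -> R) (z v : V).

(* The kernel is reflected: for rho supported in {0 <= t <= h}, [conv g rho z]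
   averages g over times in [z.1, z.1 + h]. *)
Definition conv g rho z : R := \int[st]_y (g y * rho (y - z)).

Definition supported h rho : Prop := forall z, ~ st_ball h z -> rho z = 0.

Lemma continuous_translate rho z : continuous rho -> continuous (fun y : V => rho (y - z)).
Proof.
move=> cr y; apply: (@continuous_comp _ _ _ (fun y : V => y - z) rho); last exact: cr.
by apply: (@continuousD _ _ _ id (cst _)); [exact: cvg_id|exact: cst_continuous].
Qed.

Lemma supported_translate h rho z y : supported h rho -> ~ st_ball (h + `|z|) y ->
  rho (y - z) = 0.
Proof.
move=> sr ny; apply: sr => yz; apply: ny.
by rewrite /st_ball /= -[y](subrK z); apply: le_trans (ler_normD _ _) _; rewrite lerD.
Qed.

Lemma conv_integrable h g rho z : continuous g -> continuous rho -> supported h rho ->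
  st.-integrable setT (EFin \o (fun y => g y * rho (y - z))).
Proof.
move=> cg cr sr; apply: (@continuous_supported_integrable R n setT (h + `|z|) _ measurableT).
  by apply: (@of_class_mul _ _ 0) => //; exact: continuous_translate.
by move=> y ny; rewrite (supported_translate sr ny) mulr0.
Qed.

Lemma st_integral0 : \int[st]_y (0 : R) = 0.
Proof. by rewrite /Rintegral integral0. Qed.

Lemma conv_sum h (I : Type) (r : seq I) g (c : I -> R) (rho : I -> V -> R) z :
  continuous g -> (forall i, continuous (rho i)) -> (forall i, supported h (rho i)) ->
  conv g (fun y => \sum_(i <- r) c i * rho i y) z = \sum_(i <- r) c i * conv g (rho i) z.
Proof.
move=> cg cr sr; elim: r => [|i r ih].
  rewrite big_nil /conv -[RHS]st_integral0; apply: eq_Rintegral => y _.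
  by rewrite big_nil mulr0.
rewrite big_cons -ih /conv -RintegralZl//; last exact: conv_integrable (cr i) (sr i).
have cs : continuous (fun y => \sum_(i <- r) c i * rho i y).
  apply: (@of_class_sum _ _ 0) => j; apply: (@of_class_mul _ _ 0) => //.
  exact: (@of_class_cst _ _ 0).
have ss : supported h (fun y => \sum_(i <- r) c i * rho i y).
  by move=> y ny; rewrite big1// => j _; rewrite sr// mulr0.
rewrite -RintegralD//.
- by apply: eq_Rintegral => y _; rewrite big_cons; ring.
- have := integrableZl measurableT (c i) (conv_integrable z cg (cr i) (sr i)).
  by apply: eq_integrable => // y _ /=; rewrite -EFinM.
- exact: conv_integrable cs ss.
Qed.

Lemma derive_linear_dir rho z v : differentiable rho z ->
  'D_v rho z = \sum_r dir_coord v r * 'D_(dir R r) rho z.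
Proof. exact: (derive_basis (@dir_basis R n)). Qed.

Lemma dir_coord_linear r (a : R) (x y : V) :
  dir_coord (a *: x + y) r = a * dir_coord x r + dir_coord y r.
Proof. by case: r => [j|] //=; rewrite /dir_coord /= !mxE. Qed.

Lemma dir_coord_continuous r : continuous (fun z : V => dir_coord z r).
Proof. by case: r => [j|]; [exact: continuous_space_coord|exact: continuous_time]. Qed.

(** The derivative falls on the kernel, with a minus sign because the kernel is reflected. The
    second order Taylor bound of [rho] is integrated into a quadratic remainder for the convolution.
    The differential is written in coordinates, so that it is visibly linear and continuous. *)
Lemma conv_differentiable h M g rho z :
  continuous g -> (forall y, `|g y| <= M) ->
  (forall m, of_class m rho) -> supported h rho ->
  differentiable (conv g rho) z /\
  forall v, 'D_v (conv g rho) z = conv g (fun y => - 'D_v rho y) z.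
Proof.
move=> cg gM sr supp.
have M0 : 0 <= M by apply: le_trans (gM 0).
have cr : continuous rho by exact: (sr 0%N).
have dr x : differentiable rho x by case: (sr 1%N).
have cDr v : continuous (fun y => 'D_v rho y) by case: (sr 1%N) => _ /(_ v).
have sDr v : supported h (fun y => 'D_v rho y) by exact: derive_support.
have convN v : conv g (fun y => - 'D_v rho y) z =
    \sum_r - dir_coord v r * conv g (fun y => 'D_(dir R r) rho y) z.
  rewrite -(@conv_sum h _ _ g (fun r => - dir_coord v r) (fun r y => 'D_(dir R r) rho y) z cg
    (fun r => @cDr (dir R r)) (fun r => @sDr (dir R r))).
  congr (conv g _ z); apply/funext => y; rewrite derive_linear_dir// -sumrN.
  by apply: eq_bigr => r _; rewrite mulNr.
pose df v := \sum_r - dir_coord v r * conv g (fun y => 'D_(dir R r) rho y) z.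
have lf : linear df.
  move=> a x y; rewrite /df scaler_sumr -big_split /=; apply: eq_bigr => r _.
  by rewrite dir_coord_linear -[_ *: _]/(_ * _); ring.
pose L : {linear V -> R} := HB.pack df (GRing.isLinear.Build _ _ _ _ df lf).
have cL : continuous L.
  apply: (@of_class_sum _ _ 0) => r; apply: (@of_class_mul _ _ 0).
    by apply: (@of_class_opp _ _ 0); exact: dir_coord_continuous.
  exact: (@of_class_cst _ _ 0).
have [C C0 tC] := bounded_support_taylor (sr 2%N) supp.
(* For increments of norm at most 1 all translated kernels live in this ball; [K] is its measure. *)
pose K := fine (st (@st_ball R n (h + (`|z| + 1)))).
have K0 : 0 <= K by rewrite fine_ge0.
have CK0 : 0 <= M * C * K by rewrite !mulr_ge0.
have [x x1|D E] := @quadratic_differentiable _ _ (conv g rho) z L (M * C * K) cL CK0;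
    last by split => // v; rewrite E convN.
- rewrite -[L x](convN x) /conv.
  have i1 := conv_integrable (z + x) cg cr supp.
  have i2 := conv_integrable z cg cr supp.
  have cD' : continuous (fun y => - 'D_x rho y) by exact: (@of_class_opp _ _ 0).
  have sD' : supported h (fun y => - 'D_x rho y).
    by move=> y ny; rewrite sDr// oppr0.
  have i3 := conv_integrable z cg cD' sD'.
  have i12 := integrableB measurableT i1 i2.
  rewrite -RintegralB// -RintegralB//.
  have K' : M * C * K * `|x| ^+ 2 = M * C * `|x| ^+ 2 * K by ring.
  rewrite K'; apply: (bounded_support_Rintegral measurableT
    (st_ball_measurable (h + (`|z| + 1))) (st_ball_lty _ _)).
  + apply: continuous_st_measurable; apply: (@of_class_add _ _ 0).
      apply: (@of_class_add _ _ 0); last apply: (@of_class_opp _ _ 0);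
        by apply: (@of_class_mul _ _ 0) => //; exact: continuous_translate.
    apply: (@of_class_opp _ _ 0); apply: (@of_class_mul _ _ 0) => //.
    move=> w; exact: (@continuous_translate (fun y => - 'D_x rho y) z cD' w).
  + by rewrite !mulr_ge0.
  + move=> y _; have -> : g y * rho (y - (z + x)) - g y * rho (y - z) -
        g y * - 'D_x rho (y - z) =
        g y * (rho (y - z + - x) - rho (y - z) - 'D_(- x) rho (y - z)).
      rewrite opprD addrA; rewrite [in RHS]deriveE// linearN /= -deriveE//; ring.
    by rewrite normrM -mulrA ler_pM//; have := tC (y - z) (- x); rewrite normrN.
  + move=> y _ ny.
    have k w : `|w| <= `|z| + 1 -> ~ st_ball (h + `|w|) y.
      move=> wz yb; apply: ny; apply: le_trans yb _; by rewrite lerD2l.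
    have nz : ~ st_ball (h + `|z|) y by apply: k; rewrite lerDl.
    have nzx : ~ st_ball (h + `|z + x|) y.
      by apply: k; apply: le_trans (ler_normD _ _) _; rewrite lerD2l.
    rewrite (supported_translate supp nzx) (supported_translate supp nz).
    by rewrite (supported_translate (sDr x) nz); ring.
Qed.

(** Differentiating replaces the kernel by [- 'D_v rho], again smooth and supported in the same
    ball, so the induction generalizes over [rho]. *)
Lemma conv_of_class m h M g rho : continuous g -> (forall y, `|g y| <= M) ->
  (forall m, of_class m rho) -> supported h rho -> of_class m (conv g rho).
Proof.
move=> cg gM; elim: m rho => [|m ih] rho sr supp.
  by move=> z; apply: differentiable_continuous; case: (conv_differentiable z cg gM sr supp).
split=> [z|v]; first by case: (conv_differentiable z cg gM sr supp).
rewrite (_ : (fun z => _) = conv g (fun y => - 'D_v rho y)); last first.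
  by apply/funext => z; case: (conv_differentiable z cg gM sr supp).
apply: ih => [j|z nz].
  by apply: of_class_opp; case: (sr j.+1) => _ /(_ v).
by rewrite (derive_support v supp)// oppr0.
Qed.

Section kernel.
Variables (h : R) (rho : V -> R).
Hypotheses (sr : forall m, of_class m rho) (rho0 : forall z, 0 <= rho z).
Hypotheses (supp : supported h rho) (rho1 : \int[st]_z rho z = 1).

Let cr : continuous rho := sr 0%N.

Lemma kernel_translate_mass z : \int[st]_y rho (y - z) = 1.
Proof. by rewrite (Rintegral_translation (- z) cr). Qed.

Lemma conv_norm_le u z (w : R) : 0 <= w -> continuous u ->
  (forall y, rho (y - z) != 0 -> `|u y| <= w) -> `|conv u rho z| <= w.
Proof.
move=> w0 cu uw.
have i1 := conv_integrable z cu cr supp.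
apply: (le_trans (le_normr_Rintegral measurableT i1)).
rewrite -[leRHS]mulr1 -(kernel_translate_mass z) -RintegralZl//; last first.
  apply: (@continuous_supported_integrable R n setT (h + `|z|) _ measurableT).
    exact: continuous_translate.
  by move=> y ny; exact: supported_translate ny.
apply: le_Rintegral => //.
- exact: (integrable_norm i1).
- apply: (@continuous_supported_integrable R n setT (h + `|z|) _ measurableT).
    by apply: (@of_class_mul _ _ 0); [exact: (@of_class_cst _ _ 0)|exact: continuous_translate].
  by move=> y ny; rewrite (supported_translate supp ny) mulr0.
- move=> y _; rewrite normrM (ger0_norm (rho0 _)).
  have [->|nz] := eqVneq (rho (y - z)) 0; first by rewrite !mulr0.
  by rewrite ler_wpM2r// uw.
Qed.

Lemma conv_sub u1 u2 z : continuous u1 -> continuous u2 ->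
  conv u1 rho z - conv u2 rho z = conv (fun y => u1 y - u2 y) rho z.
Proof.
move=> c1 c2; rewrite /conv -RintegralB//; try exact: conv_integrable cr supp.
by apply: eq_Rintegral => y _; rewrite mulrBl.
Qed.

Lemma conv_dist_le g z (a w : R) : 0 <= w -> continuous g ->
  (forall y, rho (y - z) != 0 -> `|g y - a| <= w) -> `|conv g rho z - a| <= w.
Proof.
move=> w0 cg gw.
have ca : continuous (fun _ : V => a) by exact: (@of_class_cst _ _ 0).
have -> : a = conv (fun=> a) rho z.
  rewrite /conv RintegralZl ?kernel_translate_mass ?mulr1//.
  apply: (@continuous_supported_integrable R n setT (h + `|z|) _ measurableT).
    exact: continuous_translate.
  by move=> y ny; exact: supported_translate ny.
rewrite conv_sub//; apply: conv_norm_le => //.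
by apply: (@of_class_add _ _ 0) => //; exact: (@of_class_opp _ _ 0).
Qed.

Lemma conv_translate g z a : continuous g ->
  conv g rho (z + a) = conv (fun y => g (y + a)) rho z.
Proof.
move=> cg; rewrite /conv.
rewrite -(@Rintegral_translation _ _ (fun y => g y * rho (y - (z + a))) a).
  by apply: eq_Rintegral => y _; rewrite opprD addrACA subrr addr0.
by apply: (@of_class_mul _ _ 0) => //; exact: continuous_translate.
Qed.

Lemma conv_dq g v i z : continuous g -> dq (conv g rho) v i z = conv (dq g v i) rho z.
Proof.
move=> cg; rewrite /dq conv_translate//.
have cs : continuous (fun y : V => g (y + i.+1%:R^-1 *: v)).
  move=> y; apply: (@continuous_comp _ _ _ (fun y : V => y + i.+1%:R^-1 *: v) g); last exact: cg.
  by apply: (@continuousD _ _ _ id (cst _)); [exact: cvg_id|exact: cst_continuous].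
rewrite conv_sub// /conv -RintegralZl//.
  by apply: eq_Rintegral => y _; rewrite mulrA.
apply: conv_integrable cr supp.
by apply: (@of_class_add _ _ 0) => //; exact: (@of_class_opp _ _ 0).
Qed.

(** Since [g] is only Lipschitz, the bound goes through its difference quotients, which commute with
    the averaging and obey the estimate uniformly. *)
Lemma conv_derive_le g (M L : R) v z : continuous g -> (forall y, `|g y| <= M) ->
  (forall x y, `|g x - g y| <= L * `|x - y|) -> 0 <= L ->
  `|'D_v (conv g rho) z| <= L * `|v|.
Proof.
move=> cg gM gL L0.
have [D _] := conv_differentiable z cg gM sr supp.
have k := @dq_cvg _ _ (conv g rho) v z (diff_derivable D).
rewrite -(cvg_lim _ (cvg_norm k))//; apply: limr_le; first exact: cvgP (cvg_norm k).
apply: nearW => i; rewrite conv_dq//; apply: conv_norm_le.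
- by rewrite mulr_ge0.
- exact: dq_continuous.
- by move=> y _; exact: dq_le.
Qed.

(* Freezing the coefficients at z costs w; the relation then passes under the
   integral through the difference quotients, which converge dominatedly. *)
Lemma conv_residual (I : finType) (c g : I -> V -> R) (v : I -> V) (M L w : R) z :
  (forall r, continuous (c r)) -> (forall r, continuous (g r)) ->
  (forall r y, `|c r y| <= M) -> (forall r y, `|g r y| <= M) ->
  (forall r x y, `|g r x - g r y| <= L * `|x - y|) -> 0 <= L -> 0 <= w ->
  (forall r y, rho (y - z) != 0 -> `|c r y - c r z| <= w) ->
  {ae st, forall y, rho (y - z) != 0 ->
     \sum_r c r y * dq (g r) (v r) i y @[i --> \oo] --> 0} ->
  `|\sum_r c r z * 'D_(v r) (conv (g r) rho) z| <= w * L * \sum_r `|v r|.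
Proof.
move=> cc cg cM gM gL L0 w0 cw ae.
pose S i y := \sum_r c r y * dq (g r) (v r) i y.
have cS i : continuous (S i).
  by apply: (@of_class_sum _ _ 0) => r; apply: (@of_class_mul _ _ 0);
    [exact: cc|exact: dq_continuous].
have Sz i : \sum_r c r z * dq (conv (g r) rho) (v r) i z =
    conv (fun y => \sum_r c r z * dq (g r) (v r) i y) rho z.
  rewrite /conv; under [RHS]eq_Rintegral do rewrite mulr_suml.
  transitivity (\sum_r \int[st]_y (c r z * dq (g r) (v r) i y * rho (y - z))).
    apply: eq_bigr => r _; rewrite conv_dq// /conv -RintegralZl//.
      by apply: eq_Rintegral => y _; rewrite mulrA.
    by apply: conv_integrable cr supp; exact: dq_continuous.
  have cr' r : continuous (fun y => c r z * dq (g r) (v r) i y).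
    by apply: (@of_class_mul _ _ 0); [exact: (@of_class_cst _ _ 0)|exact: dq_continuous].
  elim: (index_enum I) => [|r s ih].
    rewrite big_nil -[LHS]st_integral0; apply: eq_Rintegral => y _.
    by rewrite big_nil.
  rewrite big_cons ih -RintegralD//.
  - by apply: eq_Rintegral => y _; rewrite big_cons.
  - exact: conv_integrable (cr' r) cr supp.
  - have : continuous (fun y => \sum_(r <- s) c r z * dq (g r) (v r) i y).
      exact: (@of_class_sum _ _ 0).
    move=> /(conv_integrable z)/(_ cr supp); apply: eq_integrable => // y _ /=.
    by rewrite mulr_suml.
have S0 : conv (S i) rho z @[i --> \oo] --> (0 : R).
  rewrite -[X in _ --> X]st_integral0.
  have [C C0 rC] := bounded_support_bound cr supp.
  apply: (bounded_dominated_cvg measurableT (st_ball_measurable (h + `|z|))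
    (st_ball_lty _ _) (C := (\sum_r M * (L * `|v r|)) * C)).
  - move=> i; apply: continuous_st_measurable; apply: (@of_class_mul _ _ 0) => //.
    exact: continuous_translate.
  - exact: measurable_cst.
  - move=> i y _; rewrite normrM ler_pM//; apply: (le_trans (ler_norm_sum _ _ _)).
    by apply: ler_sum => r _; rewrite normrM ler_pM//; exact: dq_le.
  - by move=> i y _ ny; rewrite (supported_translate supp ny) mulr0.
  - apply: (ae_sub _ ae) => y hy _.
    have [->|nz] := eqVneq (rho (y - z)) 0.
      by rewrite (_ : (fun i => _) = fun=> 0); [exact: cvg_cst|apply/funext => i; rewrite mulr0].
    by rewrite -[X in _ --> X](mul0r (rho (y - z))); apply: cvgMl; exact: hy.
have Xlim : \sum_r c r z * dq (conv (g r) rho) (v r) i z @[i --> \oo] -->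
    \sum_r c r z * 'D_(v r) (conv (g r) rho) z.
  elim: (index_enum I) => [|r s ih].
    rewrite big_nil; under eq_fun do rewrite big_nil; exact: cvg_cst.
  rewrite big_cons; under eq_fun do rewrite big_cons.
  apply: cvgD => //; apply: cvgMr; apply: dq_cvg.
  apply: diff_derivable; exact: (conv_differentiable z (cg r) (gM r) sr supp).1.
have cz i : continuous (fun y => \sum_r c r z * dq (g r) (v r) i y).
  apply: (@of_class_sum _ _ 0) => r; apply: (@of_class_mul _ _ 0).
    exact: (@of_class_cst _ _ 0).
  exact: dq_continuous.
(* Subtracting the average of [S i], which tends to 0, does not change the limit; what remains under
   the integral is a sum of quotients weighted by [c r z - c r y]. *)
have k : (\sum_r c r z * dq (conv (g r) rho) (v r) i z - conv (S i) rho z)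
    @[i --> \oo] --> \sum_r c r z * 'D_(v r) (conv (g r) rho) z.
  by rewrite -[X in _ --> X]subr0; exact: cvgB Xlim S0.
rewrite -(cvg_lim _ (cvg_norm k))//; apply: limr_le; first exact: cvgP (cvg_norm k).
apply: nearW => i; rewrite Sz conv_sub//; apply: conv_norm_le.
- by rewrite !mulr_ge0// sumr_ge0.
- by apply: (@of_class_add _ _ 0) => //; exact: (@of_class_opp _ _ 0).
move=> y ry; rewrite -sumrB; apply: (le_trans (ler_norm_sum _ _ _)).
rewrite mulr_sumr; apply: ler_sum => r _; rewrite -mulrBl normrM -mulrA ler_pM//.
  by rewrite distrC cw.
exact: dq_le.
Qed.

End kernel.

End convolution.

(** * Averages against a probability measure *)

Section averages.
Variables (R : realType) (k : nat).
Implicit Types (m : probability 'rV[R]_k R) (g : 'rV[R]_k -> R).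

Lemma rV_ball_measurable r : measurable (@rV_ball R k r).
Proof.
rewrite -[X in measurable X]setCK; apply: measurableC; apply: open_measurable_rV.
rewrite openC; exact: (@closed_comp _ _ (fun z : 'rV[R]_k => `|z|) _
  (in1W (@norm_continuous _ _)) (@closed_le R r)).
Qed.

Definition concentrated r m : Prop := m (~` @rV_ball R k r) = 0%E.

(** Every point outside the support lies in a ball of measure zero with rational centre and radius 1
    / (i + 1). These balls are countably many, so their union is null. *)
Lemma msupport_concentrated r m : msupport m `<=` @rV_ball R k r -> concentrated r m.
Proof.
move=> sub.
pose B (p : 'rV[rat]_k * nat) : set 'rV[R]_k :=
  ball (map_mx ratr p.1 : 'rV[R]_k) (p.2.+1%:R^-1).
have mB p : measurable (B p) by apply: open_measurable_rV; exact: ball_open.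
pose F (i : nat) : set 'rV[R]_k :=
  if unpickle i is Some p then if m (B p) == 0%E then B p else set0 else set0.
have mC : measurable (~` @rV_ball R k r) by apply: measurableC; exact: rV_ball_measurable.
apply: measure_negligible => //; apply: (@negligibleS _ _ _ m (\bigcup_i F i)); last first.
  apply: negligible_bigcup => i; rewrite /F.
  case: (unpickle i) => [p|]; last exact: negligible_set0.
  case: ifPn => [/eqP p0|_]; last exact: negligible_set0.
  exact/negligibleP.
move=> x nx; have : ~ msupport m x by move=> /sub.
rewrite /msupport /= => /existsNP[A /not_implyP[[oA Ax] mA]].
have {}mA : m A = 0%E.
  by apply/eqP; rewrite eq_le measure_ge0 andbT leNgt; apply/negP.
have /nbhs_ballP [e /= e0 eA] := open_nbhs_nbhs (conj oA Ax).
have e20 : 0 < e / 2 by rewrite divr_gt0.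
have [i _ /(_ i (leqnn i)) ie] := near_infty_natSinv_lt (PosNum e20).
rewrite /= in ie.
have i0 : 0 < (i.+1%:R^-1 : R) by rewrite invr_gt0.
have [c cP] := rV_approx x i0.
exists (pickle (c, i)) => //; rewrite /F pickleK.
have BA : B (c, i) `<=` A.
  move=> y cy; apply: eA; apply: (@le_ball _ _ _ (i.+1%:R^-1 + i.+1%:R^-1)).
    by rewrite (splitr e) lerD// ltW.
  exact: ball_triangle cP cy.
have -> : m (B (c, i)) == 0%E.
  by rewrite eq_le measure_ge0 andbT -mA le_measure ?inE//; exact: open_measurable_rV.
exact: ball_sym.
Qed.

Section concentrated_measure.
Variables (r : R) (m : probability 'rV[R]_k R).
Hypothesis mr : concentrated r m.

Let mBall := rV_ball_measurable r.

Lemma avg_integrable g : continuous g -> m.-integrable setT (EFin \o g).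
Proof.
move=> cg; have mg := continuous_measurable_rV_R cg.
have [C C0 gC] := rV_ball_bound r cg.
have mabs : measurable_fun setT (fun x => `|(g x)%:E|)%E.
  by apply: measurableT_comp => //; exact/measurable_EFinP.
apply/integrableP; split; first exact/measurable_EFinP.
rewrite (@ge0_negligible_integral _ _ _ m setT (~` @rV_ball R k r))//; last first.
  exact: measurableC.
rewrite setTD setCK.
apply: (@le_lt_trans _ _ (\int[m]_(x in @rV_ball R k r) (C%:E))%E).
  apply: ge0_le_integral => //.
  - exact: measurable_funTS.
rewrite integral_cst//; apply: lte_mul_pinfty; rewrite ?lee_fin//.
by apply: le_lt_trans (probability_le1 m mBall) _; rewrite ltry.
Qed.

Lemma avgE g : continuous g -> avg m g = \int[m]_(x in @rV_ball R k r) g x.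
Proof.
move=> cg; rewrite /avg /Rintegral.
rewrite (@negligible_integral _ _ _ m setT (~` @rV_ball R k r))//.
- by rewrite setTD setCK.
- exact: measurableC.
- exact: avg_integrable.
Qed.

Lemma avg_cst (c : R) : avg m (fun=> c) = c.
Proof.
have p1 : m setT = 1%E by exact: probability_setT.
by rewrite /avg Rintegral_cst// [X in c * fine X]p1 mulr1.
Qed.

Lemma avg_add f g : continuous f -> continuous g ->
  avg m (fun x => f x + g x) = avg m f + avg m g.
Proof. by move=> cf cg; rewrite /avg RintegralD//; exact: avg_integrable. Qed.

Lemma avg_scale (c : R) g : continuous g -> avg m (fun x => c * g x) = c * avg m g.
Proof. by move=> cg; rewrite /avg RintegralZl//; exact: avg_integrable. Qed.

Lemma avg_sub f g : continuous f -> continuous g ->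
  avg m (fun x => f x - g x) = avg m f - avg m g.
Proof. by move=> cf cg; rewrite /avg RintegralB//; exact: avg_integrable. Qed.

Lemma avg_sum (I : Type) (s : seq I) (f : I -> 'rV[R]_k -> R) :
  (forall i, continuous (f i)) ->
  avg m (fun x => \sum_(i <- s) f i x) = \sum_(i <- s) avg m (f i).
Proof.
move=> cf; elim: s => [|i s ih].
  by rewrite big_nil -[RHS](avg_cst 0); congr (avg m _); apply/funext => x; rewrite big_nil.
rewrite big_cons -ih -avg_add//; last exact: (@of_class_sum _ _ 0).
by congr (avg m _); apply/funext => x; rewrite big_cons.
Qed.

Lemma avg_le f g : continuous f -> continuous g ->
  (forall x, rV_ball r x -> f x <= g x) -> avg m f <= avg m g.
Proof.
move=> cf cg fg; rewrite !avgE//; apply: le_Rintegral => //.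
- by apply: integrableS (avg_integrable cf).
- by apply: integrableS (avg_integrable cg).
Qed.

Lemma avg_norm_le g (C : R) : continuous g ->
  (forall x, rV_ball r x -> `|g x| <= C) -> `|avg m g| <= C.
Proof.
move=> cg gC; have cC (c : R) : continuous (fun _ : 'rV[R]_k => c).
  exact: (@of_class_cst _ _ 0).
rewrite ler_norml; apply/andP; split.
  rewrite -(avg_cst (- C)); apply: avg_le => // x /gC; by rewrite ler_norml => /andP[].
rewrite -(avg_cst C); apply: avg_le => // x /gC; by rewrite ler_norml => /andP[].
Qed.

(** The squared Euclidean distance, whereas the norm is the maximum norm. It is what the Hessian
    bound controls, and it is polynomial in both arguments. *)
Definition sqdist (u x : 'rV[R]_k) : R := \sum_i (x 0 i - u 0 i) * (x 0 i - u 0 i).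

Lemma sqdist_ge0 u x : 0 <= sqdist u x.
Proof. by apply: sumr_ge0 => i _; rewrite -expr2 sqr_ge0. Qed.

Lemma continuous_coord i : continuous (fun x : 'rV[R]_k => x 0 i).
Proof. exact: coord_continuous. Qed.

Lemma sqdist_continuous u : continuous (sqdist u).
Proof.
apply: (@of_class_sum _ _ 0) => i.
have h : of_class 0 (fun x : 'rV[R]_k => x 0 i - u 0 i).
  by apply: of_class_add; [exact: continuous_coord|exact: (@of_class_cst _ _ 0)].
exact: of_class_mul.
Qed.

Lemma sqdist_eq0 u x : sqdist u x = 0 -> x = u.
Proof.
move=> h; apply/rowP => i; apply/eqP; rewrite -subr_eq0 -[_ == 0]orbb -mulf_eq0.
have k0 : forall j, true -> 0 <= (x 0 j - u 0 j) * (x 0 j - u 0 j).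
  by move=> j _; rewrite -expr2 sqr_ge0.
by rewrite (psumr_eq0P k0 h).
Qed.

(** A nonnegative function with zero integral vanishes almost everywhere, so the complement of [u]
    has measure zero; a Borel set then has mass 1 or 0 according to whether it contains [u]. *)
Lemma avg_eq0_dirac u : avg m (sqdist u) = 0 ->
  forall B, measurable B -> m B = (\d_u B : \bar R).
Proof.
move=> h0.
have cs := @sqdist_continuous u.
have iE : (\int[m]_x `|(sqdist u x)%:E| = \int[m]_x (sqdist u x)%:E)%E.
  by apply: eq_integral => x _; rewrite gee0_abs// lee_fin sqdist_ge0.
have i0 : (\int[m]_x `|(sqdist u x)%:E| = 0)%E.
  rewrite iE -[LHS]fineK; last exact: integrable_fin_num (avg_integrable cs).
  by congr EFin.
have mD : measurable ([set~ u] : set 'rV[R]_k).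
  rewrite (_ : [set~ u] = setT `&` sqdist u @^-1` [set~ 0]).
    by apply: (continuous_measurable_rV_R cs) => //; apply: measurableC; exact: measurable_set1.
  apply/seteqP; split => [x xu|x [_ x0] xu]; last first.
    by apply: x0; rewrite xu; apply: big1 => i _; rewrite subrr mul0r.
  by split => // /sqdist_eq0.
have n0 : m [set~ u] = 0%E.
  apply: measure_negligible => //.
  have /(ae_eq_integral_abs m measurableT) : measurable_fun setT (EFin \o sqdist u).
    by apply/measurable_EFinP; exact: continuous_measurable_rV_R.
  move=> [/(_ i0) ae _]; move: ae => [N [mN N0 sN]]; exists N; split => //.
  move=> x xu; apply: sN => /= /(_ I) [] /sqdist_eq0; exact: xu.
move=> B mB; rewrite /dirac indicE.
have [uB|nuB] := boolP (u \in B); last first.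
  transitivity (0%E : \bar R) => //.
  apply/eqP; rewrite eq_le measure_ge0 andbT -n0; apply: le_measure; rewrite ?inE//.
  by move=> x Bx xu; move: nuB; rewrite notin_setE; apply; rewrite -xu.
have : m (~` B) = 0%E.
  apply/eqP; rewrite eq_le measure_ge0 andbT -n0; apply: le_measure; rewrite ?inE//.
    exact: measurableC.
  by move=> x nBx xu; apply: nBx; rewrite xu; exact: set_mem.
move=> c0; have := probability_setC m (measurableC mB).
by rewrite setCK c0 sube0.
Qed.

End concentrated_measure.

Lemma avg_measurable_fun d (X : measurableType d) (D : set X)
    (nu : X -> probability 'rV[R]_k R)  g : measurable D ->
  (forall B, measurable B -> measurable_fun D (fun z => nu z B)) ->
  continuous g -> measurable_fun D (fun z => avg (nu z) g).
Proof.
move=> mD mnu cg.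
have [->|/set0P[z0 Dz0]] := eqVneq D set0; first exact: measurable_fun_set0.
(* Measurability of [nu] is known on [D] only. A fixed measure of the family replaces it elsewhere,
   which gives a kernel on the whole space. *)
pose l z := if z \in D then nu z else nu z0.
have ml B : measurable B -> measurable_fun setT (fun z => l z B).
  move=> mB; rewrite (_ : (fun z => _) = fun z => if z \in D then nu z B else nu z0 B).
    apply: measurable_fun_if => //.
    - by apply: (measurable_fun_bool true); rewrite setTI (_ : _ @^-1` _ = D)//;
        apply/seteqP; split => x /=; [exact: set_mem|exact: mem_set].
    - rewrite setTI (_ : _ @^-1` _ = D); first exact: mnu.
      by apply/seteqP; split => x /=; [exact: set_mem|exact: mem_set].
  by apply/funext => z; rewrite /l; case: ifP.
have mg : measurable_fun setT (EFin \o g).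
  by apply/measurable_EFinP; exact: continuous_measurable_rV_R.
have m1 := measurable_fun_integral_kernel ml (funepos_ge0 (EFin \o g)) (measurable_funepos mg).
have m2 := measurable_fun_integral_kernel ml (funeneg_ge0 (EFin \o g)) (measurable_funeneg mg).
have ma : measurable_fun setT (fun z => avg (l z) g).
  rewrite /avg /Rintegral; apply: measurableT_comp; first exact: fine_measurable.
  rewrite (_ : (fun z => _) = (fun z => \int[l z]_y (EFin \o g)^\+ y -
      \int[l z]_y (EFin \o g)^\- y)%E); first exact: emeasurable_funB.
  by apply/funext => z; rewrite integralE.
apply: (eq_measurable_fun (fun z => avg (l z) g)); last exact: measurable_funTS.
by move=> z zD; rewrite /l zD.
Qed.

End averages.

(** * Algebra of the entropy pair *)

Lemma uniform_constant (R : numDomainType) (I : finType) (Q : I -> R -> Prop) :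
  (forall i C D, C <= D -> Q i C -> Q i D) ->
  (forall i, exists2 C : R, 0 <= C & Q i C) -> exists2 C : R, 0 <= C & forall i, Q i C.
Proof.
move=> mono ex; have /choice[C Ch] : forall i, exists C : R, 0 <= C /\ Q i C.
  by move=> i; have [C C0 QC] := ex i; exists C.
exists (\sum_i C i) => [|i]; first by apply: sumr_ge0 => i _; case: (Ch i).
apply: mono (Ch i).2; rewrite (bigD1 i)//= lerDl sumr_ge0// => j _.
by case: (Ch j).
Qed.

Section entropy_structure.
Variables (R : realType) (n k : nat) (F : 'rV[R]_k -> 'M[R]_(k, n)).
Variables (eta : 'rV[R]_k -> R) (q : 'rV[R]_k -> 'rV[R]_n) (c0 : R).
Hypotheses (sF : of_class 2 F) (entropy : strictly_convex_entropy F eta q c0).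
Implicit Types (u v xi : 'rV[R]_k).

Definition D_ (l : 'I_k) (f : 'rV[R]_k -> R) u : R := 'D_(delta_mx 0 l) f u.

Let seta : of_class 2 eta. Proof. by case: entropy. Qed.
Let sFij i j : of_class 2 (fun u => F u i j). Proof. exact: of_class_coord. Qed.
Let sqj j : of_class 2 (fun u => q u 0 j).
Proof. by apply: of_class_coord; case: entropy. Qed.

Lemma D_of_class m l (f : 'rV[R]_k -> R) : of_class m.+1 f -> of_class m (D_ l f).
Proof. by case=> _; exact. Qed.

Lemma D_comm (f : 'rV[R]_k -> R) a b u : of_class 2 f ->
  D_ a (D_ b f) u = D_ b (D_ a f) u.
Proof. by move=> sf; exact: (@derive_comm _ _ f u (delta_mx 0 a) (delta_mx 0 b) sf). Qed.

Lemma differential_D_ (f : 'rV[R]_k -> R) u v : differentiable f u ->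
  'D_v f u = \sum_l D_ l f u * v 0 l.
Proof.
move=> df; rewrite (derive_basis (@rV_basis R k))//.
by apply: eq_bigr => l _; rewrite mulrC.
Qed.

Lemma taylor_D_ (f : 'rV[R]_k -> R) r : of_class 2 f ->
  exists2 C : R, 0 <= C & forall u v, rV_ball r u -> rV_ball r v ->
  `|f v - f u - \sum_l D_ l f u * (v 0 l - u 0 l)| <= C * `|v - u| ^+ 2.
Proof.
move=> sf; have [C C0 h] := rV_ball_taylor r sf; exists C => // u v ru rv.
have := h u v ru rv; rewrite differential_D_; last by case: sf.
by congr (`|_ - _| <= _); apply: eq_bigr => l _; rewrite !mxE.
Qed.

Lemma entropy_lower u xi : c0 / 2 * sqdist u xi <=
  eta xi - eta u - \sum_i D_ i eta u * (xi 0 i - u 0 i).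
Proof.
case: entropy => _ _ _ hess _.
have := strongly_convex_lower_bound seta hess u (xi - u).
rewrite subrKC differential_D_; last by case: seta.
rewrite (_ : \sum_i _ = sqdist u xi); last first.
  by apply: eq_bigr => i _; rewrite !mxE expr2.
by congr (_ <= _ - _); apply: eq_bigr => l _; rewrite !mxE.
Qed.

Lemma flux_taylor r : exists2 C : R, 0 <= C &
  forall m j u v, rV_ball r u -> rV_ball r v ->
  `|F v m j - F u m j - \sum_l D_ l (fun u => F u m j) u * (v 0 l - u 0 l)|
    <= C * `|v - u| ^+ 2.
Proof.
have [|C C0 h] := @uniform_constant R ('I_k * 'I_n)%type (fun p C =>
    forall u v, rV_ball r u -> rV_ball r v ->
    `|F v p.1 p.2 - F u p.1 p.2 -
      \sum_l D_ l (fun u => F u p.1 p.2) u * (v 0 l - u 0 l)| <= C * `|v - u| ^+ 2) _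
  (fun p => taylor_D_ r (sFij p.1 p.2)).
  by move=> p C D CD h u v ru rv; apply: le_trans (h u v ru rv) _; rewrite ler_wpM2r// sqr_ge0.
by exists C => // m j; exact: (h (m, j)).
Qed.

Lemma entropy_compat u v j : \sum_i D_ i eta u * 'D_v (fun x => F x i j) u =
  'D_v (fun x => q x 0 j) u.
Proof.
case: entropy => _ _ _ _ comp.
rewrite (derive_basis (@rV_basis R k) v); last by case: (sqj j).
under eq_bigr => i _.
  rewrite (derive_basis (@rV_basis R k) v); last by case: (sFij i j).
  rewrite mulr_sumr.
  over.
rewrite exchange_big /=; apply: eq_bigr => l _.
rewrite -comp mulr_sumr; apply: eq_bigr => i _; rewrite /D_; ring.
Qed.

(** By compatibility the first order part of [q] is D eta times that of [F], so only the two
    quadratic Taylor remainders are left. *)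
Lemma entropy_flux_taylor r : exists2 C : R, 0 <= C &
  forall j u v, rV_ball r u -> rV_ball r v ->
  `|q v 0 j - q u 0 j - \sum_i D_ i eta u * (F v i j - F u i j)| <= C * `|v - u| ^+ 2.
Proof.
have [|Cq Cq0 hq] := @uniform_constant R 'I_n (fun j C =>
    forall u v, rV_ball r u -> rV_ball r v ->
    `|q v 0 j - q u 0 j - \sum_l D_ l (fun u => q u 0 j) u * (v 0 l - u 0 l)|
    <= C * `|v - u| ^+ 2) _ (fun j => taylor_D_ r (sqj j)).
  by move=> j C D CD h u v ru rv; apply: le_trans (h u v ru rv) _; rewrite ler_wpM2r// sqr_ge0.
have [CF CF0 hF] := flux_taylor r.
have [P P0 hP] := rV_ball_boundI r (fun i => of_class_continuous (D_of_class i seta)).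
exists (Cq + \sum_(i < k) P * CF).
  by rewrite addr_ge0// sumr_ge0// => i _; rewrite mulr_ge0.
move=> j u v ru rv.
have -> : q v 0 j - q u 0 j - \sum_i D_ i eta u * (F v i j - F u i j) =
    (q v 0 j - q u 0 j - \sum_l D_ l (fun u => q u 0 j) u * (v 0 l - u 0 l)) -
    \sum_i D_ i eta u * (F v i j - F u i j -
      \sum_l D_ l (fun u => F u i j) u * (v 0 l - u 0 l)).
  have -> : \sum_l D_ l (fun u => q u 0 j) u * (v 0 l - u 0 l) =
      \sum_i D_ i eta u * \sum_l D_ l (fun u => F u i j) u * (v 0 l - u 0 l).
    transitivity ('D_(v - u) (fun u => q u 0 j) u).
      rewrite differential_D_; last by case: (sqj j).
      by apply: eq_bigr => l _; rewrite !mxE.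
    rewrite -entropy_compat; apply: eq_bigr => i _; congr (_ * _).
    rewrite differential_D_; last by case: (sFij i j).
    by apply: eq_bigr => l _; rewrite !mxE.
  rewrite -[RHS]addrA -opprD -big_split /=; congr (_ - _).
  by apply: eq_bigr => i _; rewrite -mulrDr subrKC.
apply: le_trans (ler_normB _ _) _; rewrite mulrDl lerD//; first exact: hq.
apply: le_trans (ler_norm_sum _ _ _) _; rewrite mulr_suml.
apply: ler_sum => i _; rewrite normrM -mulrA ler_pM//; first exact: hP.
exact: hF.
Qed.

(** Differentiating the compatibility relation expresses the sum as a second derivative of [q] minus
    D eta contracted with second derivatives of [F] ([key]); both are symmetric in the two
    directions. *)
Lemma entropy_symmetry u j i l :
  \sum_m D_ l (D_ m eta) u * D_ i (fun x => F x m j) u =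
  \sum_m D_ i (D_ m eta) u * D_ l (fun x => F x m j) u.
Proof.
have key a b : \sum_m D_ a (D_ m eta) u * D_ b (fun x => F x m j) u =
    D_ a (D_ b (fun x => q x 0 j)) u -
    \sum_m D_ m eta u * D_ a (D_ b (fun x => F x m j)) u.
  apply/eqP; rewrite eq_sym subr_eq; apply/eqP.
  have -> : D_ b (fun x => q x 0 j) =
      \sum_(m < k) (fun x => D_ m eta x * D_ b (fun x => F x m j) x).
    by apply/funext => x; rewrite fct_sumE /D_ -entropy_compat.
  have dP m x : differentiable (D_ m eta) x by case: (D_of_class m seta).
  have dF m x : differentiable (D_ b (fun x => F x m j)) x.
    by case: (D_of_class b (sFij m j)).
  rewrite /D_ derive_sum; last first.
    by move=> m; apply: diff_derivable; exact: (differentiableM (dP m u) (dF m u)).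
  rewrite -big_split /=; apply: eq_bigr => m _.
  rewrite (@deriveM _ _ (D_ m eta) (D_ b (fun x => F x m j))); last 2 first.
    exact: diff_derivable.
    exact: diff_derivable.
  by rewrite addrC /= [X in _ + X]mulrC.
refine (etrans (key l i) (etrans _ (esym (key i l)))).
rewrite (D_comm l i u (sqj j)).
apply: (congr1 (fun w => D_ i (D_ l (fun x => q x 0 j)) u - w)).
by apply: eq_bigr => m _; rewrite (D_comm l i u (sFij m j)).
Qed.

Variables (V : normedModType R) (U : V -> 'rV[R]_k) (L : R).
Hypothesis UL : forall x y, `|U x - U y| <= L * `|x - y|.

(** A chain rule at the level of quotients, where [U] itself may have no derivative along [v]: the
    increment of [U] is at most a multiple of the step, so the o-remainder of [f] divided by the
    step tends to 0. *)
Lemma dq_chain (f : 'rV[R]_k -> R) (v y : V) : differentiable f (U y) ->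
  dq (fun x => f (U x)) v i y - \sum_l D_ l f (U y) * dq (fun x => U x 0 l) v i y
    @[i --> \oo] --> (0 : R).
Proof.
move=> df.
pose w (i : nat) : 'rV[R]_k := U (y + i.+1%:R^-1 *: v) - U y.
have wn i : `|w i| <= (L * `|v|) / i.+1%:R.
  apply: le_trans (UL _ _) _; rewrite addrC addKr normrZ.
  by rewrite ger0_norm ?invr_ge0// [_^-1 * _]mulrC mulrA.
have L0 : 0 <= L * `|v|.
  by have := wn 0%N; rewrite divr1; apply: le_trans.
have w0 : w @ \oo --> (0 : 'rV[R]_k).
  apply/cvgrPdist_le => e e0.
  have e' : 0 < e / (L * `|v| + 1) by rewrite divr_gt0// ltr_wpDl.
  have := @cvg_harmonic R => /cvgrPdist_le/(_ _ e').
  apply: filterS => i; rewrite sub0r normrN (ger0_norm (harmonic_ge0 _)) /harmonic /= => ie.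
  rewrite sub0r normrN (le_trans (wn i))//.
  rewrite ler_pdivlMr ?ltr_wpDl// in ie; apply: le_trans ie.
  by rewrite mulrC ler_wpM2l ?invr_ge0// lerDl.
have [_ E] := (diff_locallyP _ _).1 df.
move/eqaddoP: E => E.
apply/cvgrPdist_le => e e0.
have e' : 0 < e / (L * `|v| + 1) by rewrite divr_gt0// ltr_wpDl.
have near : \forall i \near \oo,
    `|f (w i + U y) - (f (U y) + 'd f (U y) (w i))| <= e / (L * `|v| + 1) * `|w i|.
  exact: (w0 _ (E _ e')).
apply: filterS near => i h.
rewrite sub0r normrN.
have -> : dq (fun x => f (U x)) v i y - \sum_l D_ l f (U y) * dq (fun x => U x 0 l) v i y
    = i.+1%:R * (f (w i + U y) - f (U y) - 'D_(w i) f (U y)).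
  rewrite differential_D_// mulrBr; congr (_ - _); first by rewrite /dq subrK.
  by rewrite mulr_sumr; apply: eq_bigr => l _; rewrite /dq /w !mxE mulrCA.
rewrite deriveE//; rewrite opprD addrA in h.
rewrite normrM normr_nat -ler_pdivlMl ?ltr0n//; apply: le_trans h _.
apply: le_trans (ler_wpM2l (ltW e') (wn i)) _.
set a := L * `|v| in L0 *.
have -> : e / (a + 1) * (a / i.+1%:R) = i.+1%:R^-1 * (e * (a / (a + 1))) by ring.
rewrite ler_wpM2l ?invr_ge0// ler_piMr ?(ltW e0)//.
by rewrite ler_pdivrMr ?ltr_wpDl// mul1r lerDl.
Qed.

End entropy_structure.

(** * Difference quotients of P, sigma and tau along a Lipschitz solution *)

Section mollified_fields.
Variables (R : realType) (n k : nat) (F : 'rV[R]_k -> 'M[R]_(k, n)).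
Variables (eta : 'rV[R]_k -> R) (q : 'rV[R]_k -> 'rV[R]_n) (c0 : R).
Hypotheses (sF : of_class 2 F) (entropy : strictly_convex_entropy F eta q c0).
Notation V := (R * 'rV[R]_n)%type.
Notation st := (spacetime_lebesgue R n).

(* sigma and tau are the potentials with d sigma = - U . dP and
   d tau_j = - F_j(U) . dP for P = D eta (U). *)
Definition entropy_dual (u : 'rV[R]_k) : R := eta u - \sum_i D_ i eta u * u 0 i.
Definition flux_dual (j : 'I_n) (u : 'rV[R]_k) : R :=
  q u 0 j - \sum_i D_ i eta u * F u i j.

Variables (W : V -> 'rV[R]_k) (r L : R).
Hypotheses (Wr : forall z, rV_ball r (W z)).
Hypothesis WL : forall x y, `|W x - W y| <= L * `|x - y|.

Let seta : of_class 2 eta. Proof. by case: entropy. Qed.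
Let sFij i j : of_class 2 (fun u => F u i j). Proof. exact: of_class_coord. Qed.
Let sqj j : of_class 2 (fun u => q u 0 j).
Proof. by apply: of_class_coord; case: entropy. Qed.
Let scoord m (i : 'I_k) : of_class m (fun u : 'rV[R]_k => u 0 i).
Proof.
apply: of_class_linear => [a x y|]; first by rewrite !mxE.
exact: continuous_coord.
Qed.

Lemma lipschitz_constant_ge0 : 0 <= L.
Proof.
have := WL (1, 0) 0; rewrite subr0 prod_normE /= normr1 normr0 max_l// mulr1.
exact: le_trans.
Qed.

Lemma lipschitz_continuous : continuous W.
Proof.
move=> x; apply/cvgrPdist_le => e e0; have L0 := lipschitz_constant_ge0.
have e' : 0 < e / (L + 1) by rewrite divr_gt0// ltr_wpDl.
near=> y; apply: (le_trans (WL _ _)).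
have xy : `|x - y| <= e / (L + 1).
  by near: y; apply: cvgr_dist_le.
apply: le_trans (ler_wpM2l L0 xy) _.
by rewrite mulrA ler_pdivrMr ?ltr_wpDl// mulrC ler_wpM2l ?(ltW e0)// lerDl.
Unshelve. all: by end_near. Qed.

Lemma composition_constant (I : finType) (f : I -> 'rV[R]_k -> R) :
  (forall i, of_class 1 (f i)) -> exists2 C : R, 0 <= C & forall i,
    (forall z, `|f i (W z)| <= C) /\
    (forall x y, `|f i (W x) - f i (W y)| <= C * `|x - y|).
Proof.
move=> sf; have L0 := lipschitz_constant_ge0.
apply: (@uniform_constant R I (fun i C => (forall z, `|f i (W z)| <= C) /\
    (forall x y, `|f i (W x) - f i (W y)| <= C * `|x - y|))).
  move=> i C D CD [h1 h2]; split=> [z|x y]; first exact: le_trans (h1 z) CD.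
  by apply: le_trans (h2 x y) _; rewrite ler_wpM2r.
move=> i; have [B B0 hB] := rV_ball_bound r (of_class_continuous (sf i)).
have [C C0 hC] := rV_ball_lipschitz r (sf i).
exists (B + C * L); first by rewrite addr_ge0// mulr_ge0.
split=> [z|x y]; first by apply: le_trans (hB _ (Wr z)) _; rewrite lerDl mulr_ge0.
apply: le_trans (hC _ _ (Wr y) (Wr x)) _.
apply: le_trans (ler_wpM2l C0 (WL x y)) _.
by rewrite mulrA ler_wpM2r// lerDr.
Qed.

Lemma quadratic_dq_cvg0 (x : nat -> R) (C : R) : 0 <= C ->
  (forall i, `|x i| <= C * (i.+1%:R^-1) ^+ 2) -> i.+1%:R * x i @[i --> \oo] --> (0 : R).
Proof.
move=> C0 hx; apply/cvgrPdist_le => e e0.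
have e' : 0 < e / (C + 1) by rewrite divr_gt0// ltr_wpDl.
have := @cvg_harmonic R => /cvgrPdist_le/(_ _ e').
apply: filterS => i; rewrite sub0r normrN (ger0_norm (harmonic_ge0 _)) /harmonic /= => ie.
rewrite sub0r normrN normrM normr_nat -ler_pdivlMl ?ltr0n//.
apply: le_trans (hx i) _; rewrite expr2 mulrCA ler_wpM2l ?invr_ge0//.
rewrite ler_pdivlMr ?ltr_wpDl// in ie; apply: le_trans ie.
by rewrite mulrC ler_wpM2l ?invr_ge0// lerDl.
Qed.

Lemma increment_le v (y : V) (i : nat) :
  `|W y - W (y + i.+1%:R^-1 *: v)| ^+ 2 <= (L * `|v|) ^+ 2 * (i.+1%:R^-1) ^+ 2.
Proof.
have L0 := lipschitz_constant_ge0.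
rewrite -exprMn lerXn2r ?nnegrE ?mulr_ge0 ?invr_ge0//.
apply: le_trans (WL _ _) _; rewrite opprD addrA subrr sub0r normrN normrZ.
by rewrite (@ger0_norm _ i.+1%:R^-1) ?invr_ge0// -mulrA [X in L * X]mulrC.
Qed.

(** Expanding [eta] about the shifted point instead of [W y] makes the combination exactly a Taylor
    remainder divided by the step. That remainder is quadratic in the step, and no derivative of [W]
    enters. *)
Lemma entropy_dual_dq (v y : V) :
  dq (fun y => entropy_dual (W y)) v i y +
  \sum_l W y 0 l * dq (fun y => D_ l eta (W y)) v i y @[i --> \oo] --> (0 : R).
Proof.
have [C C0 hC] := taylor_D_ r seta.
pose x (i : nat) := - (eta (W y) - eta (W (y + i.+1%:R^-1 *: v)) -
  \sum_l D_ l eta (W (y + i.+1%:R^-1 *: v)) * (W y 0 l - W (y + i.+1%:R^-1 *: v) 0 l)).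
rewrite (_ : (fun i => _) = fun i => i.+1%:R * x i).
  apply: (@quadratic_dq_cvg0 _ (C * (L * `|v|) ^+ 2)).
    by rewrite mulr_ge0// sqr_ge0.
  move=> i; rewrite normrN; apply: (le_trans (hC _ _ (Wr _) (Wr _))).
  by rewrite -mulrA ler_wpM2l// increment_le.
apply/funext => i; rewrite /x /dq /entropy_dual; set w := W (y + _).
have -> : \sum_l W y 0 l * (i.+1%:R * (D_ l eta w - D_ l eta (W y))) =
    i.+1%:R * (\sum_l D_ l eta w * W y 0 l - \sum_l D_ l eta (W y) * W y 0 l).
  by rewrite -sumrB mulr_sumr; apply: eq_bigr => l _; ring.
have -> : \sum_l D_ l eta w * (W y 0 l - w 0 l) =
    \sum_l D_ l eta w * W y 0 l - \sum_l D_ l eta w * w 0 l.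
  by rewrite -sumrB; apply: eq_bigr => l _; ring.
ring.
Qed.

(** The same expansion based at the shifted point, with [entropy_flux_taylor] in place of the Taylor
    bound of [eta]. *)
Lemma flux_dual_dq j (v y : V) :
  dq (fun y => flux_dual j (W y)) v i y +
  \sum_l F (W y) l j * dq (fun y => D_ l eta (W y)) v i y @[i --> \oo] --> (0 : R).
Proof.
have [C C0 hC] := entropy_flux_taylor sF entropy r.
pose x (i : nat) := - (q (W y) 0 j - q (W (y + i.+1%:R^-1 *: v)) 0 j -
  \sum_l D_ l eta (W (y + i.+1%:R^-1 *: v)) * (F (W y) l j - F (W (y + i.+1%:R^-1 *: v)) l j)).
rewrite (_ : (fun i => _) = fun i => i.+1%:R * x i).
  apply: (@quadratic_dq_cvg0 _ (C * (L * `|v|) ^+ 2)).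
    by rewrite mulr_ge0// sqr_ge0.
  move=> i; rewrite normrN; apply: (le_trans (hC _ _ _ (Wr _) (Wr _))).
  by rewrite -mulrA ler_wpM2l// increment_le.
apply/funext => i; rewrite /x /dq /flux_dual; set w := W (y + _).
have -> : \sum_l F (W y) l j * (i.+1%:R * (D_ l eta w - D_ l eta (W y))) =
    i.+1%:R * (\sum_l D_ l eta w * F (W y) l j - \sum_l D_ l eta (W y) * F (W y) l j).
  by rewrite -sumrB mulr_sumr; apply: eq_bigr => l _; ring.
have -> : \sum_l D_ l eta w * (F (W y) l j - F w l j) =
    \sum_l D_ l eta w * F (W y) l j - \sum_l D_ l eta w * F w l j.
  by rewrite -sumrB; apply: eq_bigr => l _; ring.
ring.
Qed.

Lemma cvg_sum0 (I : Type) (s : seq I) (x : I -> nat -> R) (l : I -> R) :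
  (forall i, x i m @[m --> \oo] --> l i) ->
  \sum_(i <- s) x i m @[m --> \oo] --> \sum_(i <- s) l i.
Proof.
move=> hx; elim: s => [|i s ih].
  by rewrite big_nil; under eq_fun do rewrite big_nil; exact: cvg_cst.
rewrite big_cons; under eq_fun do rewrite big_cons.
by apply: cvgD.
Qed.

(* The symmetry of D^2 eta . DF_j turns the equation for W into the adjoint
   equation for D eta (W). *)
Lemma adjoint_dq (y : V) :
  (forall i, derivable (fun y => W y 0 i) y (dir_t R n)) ->
  (forall i j, derivable (fun y => F (W y) i j) y (dir_x R j)) ->
  (forall i, 'D_(dir_t R n) (fun y => W y 0 i) y
     + \sum_(j < n) 'D_(dir_x R j) (fun y => F (W y) i j) y = 0) ->
  forall i, dq (fun y => D_ i eta (W y)) (dir_t R n) s y +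
    \sum_(p : 'I_k * 'I_n) D_ i (fun u => F u p.1 p.2) (W y) *
      dq (fun y => D_ p.1 eta (W y)) (dir_x R p.2) s y @[s --> \oo] --> (0 : R).
Proof.
move=> dW dF eqn i.
have dP m u : differentiable (D_ m eta) u by case: (D_of_class m seta).
have dFij m j u : differentiable (fun u => F u m j) u by case: (sFij m j).
pose A m l := D_ l (D_ m eta) (W y).
pose B l m j := D_ l (fun u => F u m j) (W y).
have eP m v := @dq_chain _ _ _ W L WL (D_ m eta) v y (dP m (W y)).
have eF m j v := @dq_chain _ _ _ W L WL (fun u => F u m j) v y (dFij m j (W y)).
pose dw l v s := dq (fun y => W y 0 l) v s y.
have tlim : dq (fun y => D_ i eta (W y)) (dir_t R n) s y @[s --> \oo] -->
    \sum_l A i l * 'D_(dir_t R n) (fun y => W y 0 l) y.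
  rewrite -[X in _ --> X]add0r.
  rewrite (_ : (fun s => _) = fun s =>
    (dq (fun y => D_ i eta (W y)) (dir_t R n) s y - \sum_l A i l * dw l (dir_t R n) s) +
    \sum_l A i l * dw l (dir_t R n) s); last by apply/funext => s; rewrite subrK.
  apply: cvgD; first exact: eP.
  apply: (@cvg_sum0 _ _ (fun l s => A i l * dw l (dir_t R n) s)) => l.
  by apply: cvgMr; apply: dq_cvg.
have sumB (c d e : 'I_k -> R) :
    \sum_m c m * (d m - e m) = \sum_m c m * d m - \sum_m c m * e m.
  by rewrite -sumrB; apply: eq_bigr => m _; rewrite mulrBr.
have swap j (d : 'I_k -> R) : \sum_m B i m j * (\sum_l A m l * d l) =
    \sum_m A i m * (\sum_l B l m j * d l).
  transitivity (\sum_l (\sum_m A m l * B i m j) * d l).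
    rewrite (eq_bigr (fun m => \sum_l A m l * B i m j * d l)) => [|m _]; last first.
      by rewrite mulr_sumr; apply: eq_bigr => l _; ring.
    by rewrite exchange_big /=; apply: eq_bigr => l _; rewrite mulr_suml.
  rewrite [RHS](eq_bigr (fun m => \sum_l A i m * B l m j * d l)) => [|m _]; last first.
    by rewrite mulr_sumr; apply: eq_bigr => l _; ring.
  rewrite [RHS]exchange_big /=; apply: eq_bigr => l _; rewrite -mulr_suml.
  apply: (congr1 (fun w => w * d l)); apply: etrans (entropy_symmetry sF entropy (W y) j i l) _.
  by apply: eq_bigr => m _; rewrite (D_comm i m (W y) seta).
(* Only [F (W)] has derivatives in space, not [W]. The quotients of D eta (W) are reduced to those
   of [W], [swap] exchanges the two matrices, and the quotients of [W] are reassembled into those of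
   [F (W)]. *)
have xlim j : \sum_m B i m j * dq (fun y => D_ m eta (W y)) (dir_x R j) s y
    @[s --> \oo] --> \sum_m A i m * 'D_(dir_x R j) (fun y => F (W y) m j) y.
  rewrite (_ : (fun s => _) = fun s =>
    \sum_m B i m j * (dq (fun y => D_ m eta (W y)) (dir_x R j) s y
                      - \sum_l A m l * dw l (dir_x R j) s)
    + (\sum_m A i m * dq (fun y => F (W y) m j) (dir_x R j) s y
    - \sum_m A i m * (dq (fun y => F (W y) m j) (dir_x R j) s y
                      - \sum_l B l m j * dw l (dir_x R j) s))); last first.
    apply/funext => s; rewrite !sumB (swap j (fun l => dw l (dir_x R j) s)).
    by ring.
  rewrite -[X in _ --> X]add0r -[X in _ --> 0 + X]subr0.
  have z0 (c : 'I_k -> R) (e : 'I_k -> nat -> R) : (forall m, e m s @[s --> \oo] --> (0 : R)) ->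
      \sum_m c m * e m s @[s --> \oo] --> (0 : R).
    move=> he; rewrite [X in _ --> X](_ : 0 = \sum_(m < k) c m * 0); last first.
      by rewrite big1// => m _; rewrite mulr0.
    by apply: (@cvg_sum0 _ _ (fun m s => c m * e m s)) => m; apply: cvgMr.
  apply: cvgD; first by apply: (z0 _ (fun m s => _)) => m; exact: eP.
  apply: cvgB; last by apply: (z0 _ (fun m s => _)) => m; exact: eF.
  apply: (@cvg_sum0 _ _ (fun m s => A i m * dq (fun y => F (W y) m j) (dir_x R j) s y)) => m.
  by apply: cvgMr; exact: dq_cvg.
have e0 : (0 : R) = \sum_l A i l * 'D_(dir_t R n) (fun y => W y 0 l) y +
    \sum_j \sum_m A i m * 'D_(dir_x R j) (fun y => F (W y) m j) y.
  rewrite exchange_big -big_split /= big1// => l _.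
  by rewrite -mulr_sumr -mulrDr eqn mulr0.
rewrite [X in _ --> X]e0.
apply: cvgD => //.
have h := @cvg_sum0 _ (index_enum 'I_n) _ _ xlim.
apply: cvg_trans h.
by apply: near_eq_cvg; apply: nearW => s; rewrite exchange_big pair_bigA.
Qed.

End mollified_fields.

(** * Smooth approximations of P, sigma and tau *)

Section approximation.
Variables (R : realType) (n k : nat) (F : 'rV[R]_k -> 'M[R]_(k, n)).
Variables (eta : 'rV[R]_k -> R) (q : 'rV[R]_k -> 'rV[R]_n) (c0 : R).
Hypotheses (sF : of_class 2 F) (entropy : strictly_convex_entropy F eta q c0).
Notation V := (R * 'rV[R]_n)%type.
Notation st := (spacetime_lebesgue R n).
Variables (W : V -> 'rV[R]_k) (r L : R).
Hypotheses (Wr : forall z, rV_ball r (W z)).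
Hypothesis WL : forall x y, `|W x - W y| <= L * `|x - y|.

Let seta : of_class 2 eta. Proof. by case: entropy. Qed.
Let sFij i j : of_class 2 (fun u => F u i j). Proof. exact: of_class_coord. Qed.
Let sqj j : of_class 2 (fun u => q u 0 j).
Proof. by apply: of_class_coord; case: entropy. Qed.

Let bounded_lipschitz (C : R) (f : 'rV[R]_k -> R) : Prop :=
  [/\ continuous (fun y => f (W y)), forall z, `|f (W z)| <= C &
      forall x y, `|f (W x) - f (W y)| <= C * `|x - y|].

Lemma dir_norm_le1 s : `|dir R s : V| <= 1.
Proof.
case: s => [j|]; rewrite /dir prod_normE /= ge_max normr0 ?normr1 ?lexx ?ler01 //=.
apply: norm_rV_le => // i; rewrite mxE eqxx /=.
by case: (i == j); rewrite ?normr1 ?normr0.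
Qed.

Section kernel.
Variables (h : R) (rho : V -> R) (C : R).
Hypotheses (sr : forall m, of_class m rho) (rho0 : forall z, 0 <= rho z).
Hypotheses (supp : supported h rho) (rho1 : \int[st]_z rho z = 1).
Hypotheses (h0 : 0 <= h) (C0 : 0 <= C).

Lemma kernel_near y z : rho (y - z) != 0 -> `|y - z| <= h.
Proof.
move=> nz; rewrite leNgt; apply: contra nz => yz; apply/eqP; apply: supp.
by rewrite /st_ball /= => /(lt_le_trans yz); rewrite ltxx.
Qed.

Lemma mollified_residual (I : finType) (c g : I -> 'rV[R]_k -> R) (g0 : 'rV[R]_k -> R)
    (v : I -> V) (v0 : V) z :
  (forall i, bounded_lipschitz C (c i)) -> (forall i, bounded_lipschitz C (g i)) ->
  bounded_lipschitz C g0 -> (forall i, `|v i| <= 1) -> `|v0| <= 1 ->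
  {ae st, forall y, rho (y - z) != 0 ->
     dq (fun y => g0 (W y)) v0 s y + \sum_i c i (W y) * dq (fun y => g i (W y)) (v i) s y
       @[s --> \oo] --> (0 : R)} ->
  `|'D_v0 (conv (fun y => g0 (W y)) rho) z +
    \sum_i c i (W z) * 'D_(v i) (conv (fun y => g i (W y)) rho) z|
  <= C * h * C * (#|{: option I}|)%:R.
Proof.
move=> bc bg bg0 v1 v01 ae.
(* [None] carries the leading term with coefficient 1, which is why the coefficients are bounded by
   [C + 1] below. *)
pose c' (s : option I) := if s is Some i then (fun y => c i (W y)) else fun=> 1.
pose g' (s : option I) y := if s is Some i then g i (W y) else g0 (W y).
pose v' (s : option I) := if s is Some i then v i else v0.
have := @conv_residual _ _ h rho sr rho0 supp rho1 (option I) c' g' v' (C + 1) C (C * h) z.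
rewrite sum_option /= mul1r => res; apply: (le_trans (res _ _ _ _ _ _ _ _ _)) => //.
- by case=> [i|]; [case: (bc i)|exact: (@of_class_cst _ _ 0)].
- by case=> [i|]; [case: (bg i)|case: bg0].
- case=> [i|] y /=; last by rewrite normr1 lerDr.
  by have [_ bi _] := bc i; apply: le_trans (bi y) _; rewrite lerDl.
- have h1 x : `|x : R| <= C -> `|x| <= C + 1 by move/le_trans; apply; rewrite lerDl.
  by case=> [i|] y /=; apply: h1; [case: (bg i)|case: bg0].
- by case=> [i|] x y /=; [case: (bg i)|case: bg0].
- by rewrite mulr_ge0.
- case=> [i|] y ry /=; last by rewrite subrr normr0 mulr_ge0.
  have [_ _ li] := bc i; apply: le_trans (li _ _) _.
  by rewrite ler_wpM2l// kernel_near.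
- apply: (ae_sub _ ae) => y hy ry; move: (hy ry).
  by under [X in X @ _ --> _ -> _]eq_fun do rewrite -[dq _ v0 _ _]mul1r;
    under [X in _ -> X @ _ --> _]eq_fun do rewrite sum_option.
rewrite ler_wpM2l ?mulr_ge0// -sumr_const.
apply: (@le_trans _ _ (\sum_(s : option I) 1)); first by apply: ler_sum => -[i|] _ /=.
by rewrite sumr_const.
Qed.

End kernel.

(** The relations between P = D eta (W), sigma and tau up to [e], with smooth [p], [s], [t] but
    exact coefficients taken at [W z]. The bound [K] is kept apart from [e] because it does not
    shrink with the kernel. *)
Definition mollified (e K : R) (p : 'I_k -> V -> R) (s : V -> R) (t : 'I_n -> V -> R)
    (z : V) : Prop :=
  [/\ [/\ forall i, `|p i z - D_ i eta (W z)| <= e,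
          `|s z - entropy_dual eta (W z)| <= e &
          forall j, `|t j z - flux_dual F eta q j (W z)| <= e],
      forall i j, `|'D_(dir_x R j) (p i) z| <= K,
      `|'D_(dir_t R n) s z + \sum_i W z 0 i * 'D_(dir_t R n) (p i) z| <= e,
      forall j, `|'D_(dir_x R j) (t j) z +
         \sum_i F (W z) i j * 'D_(dir_x R j) (p i) z| <= e &
      forall i, `|'D_(dir_t R n) (p i) z + \sum_(a : 'I_k * 'I_n)
         D_ i (fun u => F u a.1 a.2) (W z) * 'D_(dir_x R a.2) (p a.1) z| <= e].

Lemma approximation (T T' : R) : 0 < T' < T ->
  {ae st, forall z : V, 0 < z.1 < T ->
     [/\ forall i, derivable (fun y => W y 0 i) z (dir_t R n),
         forall i j, derivable (fun y => F (W y) i j) z (dir_x R j) &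
         forall i, 'D_(dir_t R n) (fun y => W y 0 i) z
           + \sum_(j < n) 'D_(dir_x R j) (fun y => F (W y) i j) z = 0]} ->
  exists2 K : R, 0 <= K & forall e, 0 < e -> exists p s t,
    [/\ forall m i, of_class m (p i), forall m, of_class m s,
        forall m j, of_class m (t j) &
        forall z : V, 0 <= z.1 <= T' -> mollified e K p s t z].
Proof.
move=> /andP[T'0 T'T] ae.
(* One finite type indexes every function of the state that occurs, fields and coefficients alike,
   so that a single constant [C] bounds them all along [W]. *)
pose fam (a : 'I_k + ('I_k + (option 'I_n + ('I_k * 'I_n + 'I_k * ('I_k * 'I_n)))))
    : 'rV[R]_k -> R :=
  match a with
  | inl i => D_ i eta
  | inr (inl i) => fun u => u 0 i
  | inr (inr (inl None)) => entropy_dual eta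
  | inr (inr (inl (Some j))) => flux_dual F eta q j
  | inr (inr (inr (inl p))) => fun u => F u p.1 p.2
  | inr (inr (inr (inr p))) => D_ p.1 (fun u => F u p.2.1 p.2.2)
  end.
have scoord m (i : 'I_k) : of_class m (fun u : 'rV[R]_k => u 0 i).
  apply: of_class_linear => [a x y|]; first by rewrite !mxE.
  exact: continuous_coord.
have sP i : of_class 1 (D_ i eta) by exact: D_of_class.
have sfam a : of_class 1 (fam a).
  case: a => [i|[i|[[j|]|[p|p]]]] /=.
  - exact: sP.
  - exact: (scoord 1%N i).
  - apply: (@of_class_add _ _ 1 (fun u => q u 0 j) (fun u => - \sum_i D_ i eta u * F u i j));
      first exact: of_classS_le (sqj j).
    apply: of_class_opp; apply: of_class_sum => i; apply: of_class_mul => //.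
    exact: of_classS_le (sFij i j).
  - apply: (@of_class_add _ _ 1 eta (fun u => - \sum_i D_ i eta u * u 0 i));
      first exact: of_classS_le seta.
    by apply: of_class_opp; apply: of_class_sum => i; apply: of_class_mul.
  - exact: of_classS_le (sFij p.1 p.2).
  - exact: D_of_class (sFij p.2.1 p.2.2).
have [C C0 hC] := composition_constant Wr WL sfam.
have cW := lipschitz_continuous WL.
have bl a : bounded_lipschitz C (fam a).
  split; [|exact: (hC a).1|exact: (hC a).2].
  by move=> y; apply: (@continuous_comp _ _ _ W (fam a));
    [exact: cW|exact: (of_class_continuous (sfam a))].
exists C => // e e0.
pose N : R := (#|{: option 'I_k}|)%:R + (#|{: option ('I_k * 'I_n)}|)%:R.
have N0 : 0 <= N by rewrite addr_ge0.
have D0 : 0 < 1 + C + C * C * N by rewrite -addrA ltr_wpDr// addr_ge0 ?mulr_ge0.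
(* The first bound keeps the averages before time [T]; the second makes the distance [C * h] and the
   residuals [C * h * C] times the number of terms at most [e]. *)
pose h := Num.min (T - T') (e / (1 + C + C * C * N)).
have h0 : 0 < h by rewrite lt_min subr_gt0 T'T divr_gt0.
have hT : h <= T - T' by rewrite ge_min lexx.
have he : h * (1 + C + C * C * N) <= e by rewrite -ler_pdivlMr// ge_min lexx orbT.
have hC1 : C * h <= e by apply: le_trans he; rewrite mulrC ler_wpM2l ?(ltW h0)//; nra.
have hC2 (x : R) : 0 <= x <= N -> C * h * C * x <= e.
  move=> /andP[x0 xN]; apply: le_trans he.
  have -> : C * h * C * x = h * (C * C * x) by ring.
  rewrite ler_wpM2l ?(ltW h0)//; apply: (@le_trans _ _ (C * C * N)).
    by rewrite ler_wpM2l ?mulr_ge0.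
  by rewrite lerDr addr_ge0.
have [rho [sr rho0 rsupp rho1]] := @kernel_exists R n h h0.
have supp : supported h rho.
  move=> z nz; apply: contra_notP nz => /eqP /rsupp [/andP[z0 zh] z2].
  by rewrite /st_ball /= prod_normE /= ge_max z2 ger0_norm ?(ltW z0) ?(ltW zh).
pose cv (f : 'rV[R]_k -> R) := conv (fun y => f (W y)) rho.
have scv m a : of_class m (cv (fam a)).
  by have [c1 c2 _] := bl a; exact: conv_of_class c1 c2 sr supp.
have near y z : rho (y - z) != 0 -> `|y - z| <= h by exact: kernel_near.
have dist a z : `|cv (fam a) z - fam a (W z)| <= e.
  have [c1 c2 c3] := bl a; apply: le_trans hC1.
  apply: (conv_dist_le sr rho0 supp rho1) => //; first by rewrite mulr_ge0 ?(ltW h0).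
  by move=> y ry; apply: le_trans (c3 _ _) _; rewrite ler_wpM2l// near.
(* Here the forward kernel matters: even for [z.1 = 0] the averaged times are strictly positive. *)
have interior y z : 0 <= z.1 <= T' -> rho (y - z) != 0 -> 0 < y.1 < T.
  move=> /andP[z0 zT] /rsupp [/andP[/= y0 yh] _].
  rewrite -[y.1](subrK z.1) ltr_wpDr//= -ltrBrDr; apply: lt_le_trans yh _.
  by apply: le_trans hT _; rewrite lerB.
have N1 : (0 : R) <= (#|{: option 'I_k}|)%:R <= N.
  by apply/andP; split; [exact: ler0n|rewrite /N lerDl; exact: ler0n].
have N2 : (0 : R) <= (#|{: option ('I_k * 'I_n)}|)%:R <= N.
  by apply/andP; split; [exact: ler0n|rewrite /N lerDr; exact: ler0n].
exists (fun i => cv (fam (inl i))), (cv (fam (inr (inr (inl None))))),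
  (fun j => cv (fam (inr (inr (inl (Some j)))))).
split => // z zT; split.
- by split=> [i||j]; [exact: (dist (inl i))|exact: (dist (inr (inr (inl None))))
    |exact: (dist (inr (inr (inl (Some j)))))].
- move=> i j; have [c1 c2 c3] := bl (inl i).
  apply: le_trans (conv_derive_le sr rho0 supp rho1 _ z c1 c2 c3 C0) _.
  by rewrite ler_piMr// (dir_norm_le1 (Some j)).
- apply: le_trans (hC2 _ N1).
  apply: (@mollified_residual h rho C sr rho0 supp rho1 (ltW h0) C0 'I_k
    (fun i => fam (inr (inl i))) (fun i => fam (inl i)) (fam (inr (inr (inl None))))
    (fun=> dir_t R n) (dir_t R n)) => //.
  + by move=> _; exact: (dir_norm_le1 None).
  + exact: (dir_norm_le1 None).
  + by apply: aeW => y _; exact: (entropy_dual_dq entropy Wr WL).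
- move=> j; apply: le_trans (hC2 _ N1).
  apply: (@mollified_residual h rho C sr rho0 supp rho1 (ltW h0) C0 'I_k
    (fun i => fam (inr (inr (inr (inl (i, j)))))) (fun i => fam (inl i))
    (fam (inr (inr (inl (Some j))))) (fun=> dir_x R j) (dir_x R j)) => //.
  + by move=> _; exact: (dir_norm_le1 (Some j)).
  + exact: (dir_norm_le1 (Some j)).
  + by apply: aeW => y _; exact: (flux_dual_dq sF entropy Wr WL).
- move=> i; apply: le_trans (hC2 _ N2).
  apply: (@mollified_residual h rho C sr rho0 supp rho1 (ltW h0) C0 ('I_k * 'I_n)%type
    (fun a => fam (inr (inr (inr (inr (i, a)))))) (fun a => fam (inl a.1))
    (fam (inl i)) (fun a => dir_x R a.2) (dir_t R n)) => //.
  + by move=> a; exact: (dir_norm_le1 (Some a.2)).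
  + exact: (dir_norm_le1 None).
  + apply: (ae_sub _ ae) => y hy ry; have [d1 d2 d3] := hy (interior y z zT ry).
    exact: (adjoint_dq sF entropy WL d1 d2 d3).
Qed.

End approximation.

(** * The relative entropy inequality *)

Section pointwise_algebra.
Variables (R : realType) (k n : nat).
Variables (psi psit : R) (psix : 'I_n -> R).
Variables (E : R) (Q : 'I_n -> R) (X : 'I_k -> R) (Phi : 'I_k -> 'I_n -> R).
Variables (p pt : 'I_k -> R) (px : 'I_k -> 'I_n -> R) (s st : R) (t tx : 'I_n -> R).
Variables (u P : 'I_k -> R) (f : 'I_k -> 'I_n -> R) (df : 'I_k -> 'I_k * 'I_n -> R).
Variables (sigma : R) (tau : 'I_n -> R).

(** Values at one point, abstracted to scalars. [E], [Q], [X], [Phi] stand for the averages of eta,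
    q, xi, F; [p], [s], [t] for the mollified fields; [u], [P], [f], [df], [sigma], [tau] for exact
    quantities at U; a suffix [t] or [x] marks a derivative. The products psi p_i, psi s and psi t_j
    appear differentiated by the Leibniz rule. *)
Definition tested_balance : R :=
  psit * E + \sum_j psix j * Q j
  - \sum_i ((psi * pt i + p i * psit) * X i
            + \sum_j (psi * px i j + p i * psix j) * Phi i j)
  - (psi * st + s * psit) - \sum_j (psi * tx j + t j * psix j).

Definition flux_remainder (a : 'I_k * 'I_n) : R :=
  Phi a.1 a.2 - f a.1 a.2 - \sum_l df l a * (X l - u l).

(** The averaged relative entropy and relative fluxes, weighted by the derivatives of psi. *)
Definition main_terms : R :=
  psit * (E - \sum_i P i * X i - sigma)
  + \sum_j psix j * (Q j - \sum_i P i * Phi i j - tau j).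

(** Each summand contains a difference between an exact and a mollified field, or one of the three
    residuals. *)
Definition error_terms : R :=
  psit * (\sum_i (P i - p i) * X i + (sigma - s))
  + \sum_j psix j * (\sum_i (P i - p i) * Phi i j + (tau j - t j))
  - psi * ((st + \sum_i u i * pt i) + \sum_j (tx j + \sum_i f i j * px i j)
           + \sum_i (X i - u i) * (pt i + \sum_a df i a * px a.1 a.2)).

(** The linearization [df] applied to [X - u] enters once through [flux_remainder] and once through
    the adjoint residual, with opposite signs; this is what leaves only second order flux terms
    outside the errors. *)
Lemma tested_balanceE : tested_balance =
  main_terms - psi * (\sum_a px a.1 a.2 * flux_remainder a) + error_terms.
Proof.
(* Once all sums are reduced to these scalars, the identity is polynomial. *)
pose S1 := \sum_i pt i * X i; pose S2 := \sum_i p i * X i.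
pose S3 := \sum_(a : 'I_k * 'I_n) px a.1 a.2 * Phi a.1 a.2.
pose S4 := \sum_j psix j * \sum_i p i * Phi i j.
pose S5 := \sum_j tx j; pose S6 := \sum_j t j * psix j; pose S7 := \sum_j psix j * Q j.
pose S8 := \sum_(a : 'I_k * 'I_n) px a.1 a.2 * f a.1 a.2.
pose S9 := \sum_(a : 'I_k * 'I_n) px a.1 a.2 * \sum_l df l a * (X l - u l).
pose S10 := \sum_i u i * pt i; pose S11 := \sum_i P i * X i.
have e1 : \sum_i ((psi * pt i + p i * psit) * X i
    + \sum_j (psi * px i j + p i * psix j) * Phi i j) =
    psi * S1 + psit * S2 + psi * S3 + S4.
  rewrite big_split /= -[RHS]addrA; congr (_ + _).
    by rewrite /S1 /S2 !mulr_sumr -big_split; apply: eq_bigr => i _ /=; ring.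
  rewrite (eq_bigr (fun i => \sum_j psi * (px i j * Phi i j) +
      \sum_j psix j * (p i * Phi i j))) => [|i _]; last first.
    by rewrite -big_split; apply: eq_bigr => j _ /=; ring.
  rewrite big_split /=; congr (_ + _).
    by rewrite /S3 mulr_sumr pair_bigA.
  by rewrite exchange_big; apply: eq_bigr => j _; rewrite mulr_sumr.
have e2 : \sum_j (psi * tx j + t j * psix j) = psi * S5 + S6.
  by rewrite big_split /= mulr_sumr.
have e3 : \sum_j psix j * (Q j - \sum_i P i * Phi i j - tau j) +
    \sum_j psix j * (\sum_i (P i - p i) * Phi i j + (tau j - t j)) = S7 - S4 - S6.
  rewrite -big_split -!sumrB /=; apply: eq_bigr => j _.
  have -> : \sum_i (P i - p i) * Phi i j = \sum_i P i * Phi i j - \sum_i p i * Phi i j.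
    by rewrite -sumrB; apply: eq_bigr => i _; rewrite mulrBl.
  by ring.
have e4 : \sum_i (P i - p i) * X i = S11 - S2.
  by rewrite -sumrB; apply: eq_bigr => i _; rewrite mulrBl.
have e5 : \sum_a px a.1 a.2 * flux_remainder a = S3 - S8 - S9.
  by rewrite -!sumrB; apply: eq_bigr => a _; rewrite !mulrBr.
have e6 : \sum_j (tx j + \sum_i f i j * px i j) = S5 + S8.
  rewrite big_split /=; congr (_ + _); rewrite exchange_big pair_bigA /=.
  by apply: eq_bigr => a _; rewrite mulrC.
have e7 : \sum_i (X i - u i) * (pt i + \sum_a df i a * px a.1 a.2) = S1 - S10 + S9.
  rewrite (eq_bigr (fun i => (pt i * X i - u i * pt i) +
      \sum_a px a.1 a.2 * (df i a * (X i - u i)))) => [|i _]; last first.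
    rewrite mulrDr mulr_sumr; congr (_ + _); first by ring.
    by apply: eq_bigr => a _; ring.
  rewrite big_split /= sumrB; congr (_ + _); rewrite exchange_big /=.
  by apply: eq_bigr => a _; rewrite mulr_sumr.
rewrite /tested_balance /main_terms /error_terms e1 e2 e4 e5 e6 e7.
rewrite -/S7 -/S10 -/S11.
have eA := esym (addrK (\sum_j psix j * (\sum_i (P i - p i) * Phi i j + (tau j - t j)))
  (\sum_j psix j * (Q j - \sum_i P i * Phi i j - tau j))).
rewrite e3 in eA; rewrite eA; ring.
Qed.

Variables (e K B : R).
Hypothesis psi0 : 0 <= psi.
Hypotheses (Pp : forall i, `|p i - P i| <= e) (ssigma : `|s - sigma| <= e).
Hypotheses (ttau : forall j, `|t j - tau j| <= e) (pxK : forall i j, `|px i j| <= K).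
Hypotheses (r1 : `|st + \sum_i u i * pt i| <= e).
Hypotheses (r2 : forall j, `|tx j + \sum_i f i j * px i j| <= e).
Hypotheses (r3 : forall i, `|pt i + \sum_a df i a * px a.1 a.2| <= e).
Hypotheses (XB : forall i, `|X i| <= B) (uB : forall i, `|u i| <= B).
Hypotheses (PhiB : forall i j, `|Phi i j| <= B).

Lemma error_terms_le : error_terms <=
  e * ((B *+ k + 1) * (`|psit| + \sum_j `|psix j|) + psi * (1 + 1 *+ n + (B + B) *+ k)).
Proof.
have cst m (c : R) : c *+ m = \sum_(i < m) c by rewrite sumr_const card_ord.
have sumk (x y : 'I_k -> R) : (forall i, `|x i| <= e) -> (forall i, `|y i| <= B) ->
    `|\sum_i x i * y i| <= e * (B *+ k).
  move=> hx hy; apply: le_trans (ler_norm_sum _ _ _) _.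
  rewrite cst mulr_sumr; apply: ler_sum => i _.
  by rewrite normrM ler_pM.
have Pp' i : `|P i - p i| <= e by rewrite distrC.
have t1 : psit * (\sum_i (P i - p i) * X i + (sigma - s)) <= e * ((B *+ k + 1) * `|psit|).
  apply: le_trans (ler_norm _) _; rewrite normrM mulrA mulrC ler_wpM2r//.
  apply: le_trans (ler_normD _ _) _; rewrite mulrDr mulr1 lerD//; first exact: sumk.
  by rewrite distrC.
have t2 : \sum_j psix j * (\sum_i (P i - p i) * Phi i j + (tau j - t j)) <=
    e * ((B *+ k + 1) * \sum_j `|psix j|).
  rewrite !mulr_sumr; apply: ler_sum => j _.
  apply: le_trans (ler_norm _) _; rewrite normrM mulrA mulrC ler_wpM2r//.
  apply: le_trans (ler_normD _ _) _; rewrite mulrDr mulr1 lerD//; first exact: sumk.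
  by rewrite distrC.
rewrite /error_terms; set b := (st + \sum_i u i * pt i) + _ + _.
have t3 : `|b| <= e * (1 + 1 *+ n + (B + B) *+ k).
  apply: le_trans (ler_normD _ _) _; rewrite mulrDr lerD//.
    apply: le_trans (ler_normD _ _) _; rewrite mulrDr mulr1 lerD//.
    apply: le_trans (ler_norm_sum _ _ _) _.
    rewrite cst mulr_sumr; apply: ler_sum => j _.
    by rewrite mulr1.
  apply: le_trans (ler_norm_sum _ _ _) _.
  rewrite cst mulr_sumr; apply: ler_sum => i _.
  rewrite normrM mulrC ler_pM//.
  by apply: le_trans (ler_normB _ _) _; rewrite lerD.
have t4 : - (psi * b) <= psi * (e * (1 + 1 *+ n + (B + B) *+ k)).
  rewrite -mulrN ler_wpM2l//; apply: le_trans t3.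
  by rewrite -normrN ler_norm.
apply: le_trans (lerD (lerD t1 t2) t4) _.
by rewrite le_eqVlt; apply/orP; left; apply/eqP; ring.
Qed.

Lemma tested_balance_le : tested_balance <=
  main_terms + psi * (K * \sum_a `|flux_remainder a|) +
  e * ((B *+ k + 1) * (`|psit| + \sum_j `|psix j|) + psi * (1 + 1 *+ n + (B + B) *+ k)).
Proof.
rewrite tested_balanceE lerD ?error_terms_le// lerD2l -mulrN ler_wpM2l//.
apply: le_trans (ler_norm _) _; rewrite normrN.
apply: le_trans (ler_norm_sum _ _ _) _; rewrite mulr_sumr.
by apply: ler_sum => a _; rewrite normrM ler_wpM2r.
Qed.

End pointwise_algebra.

(** * Extension of the solution to all times *)

Section extension.
Variables (R : realType) (n k : nat) (F : 'rV[R]_k -> 'M[R]_(k, n)) (T : R).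
Notation V := (R * 'rV[R]_n)%type.
Variable U : V -> 'rV[R]_k.
Hypotheses (T0 : 0 < T) (solution : bounded_lipschitz_solution T F U).

(** A contraction of spacetime onto the strip. Composing with it extends [U] as a bounded Lipschitz
    map to all of spacetime, where the convolutions are defined. *)
Definition clamp (z : V) : V := (Num.max 0 (Num.min z.1 T), z.2).

Lemma clamp_strip z : strip T (clamp z).
Proof.
split => //=; rewrite in_itv /= le_max lexx ge_max (ltW T0) /=.
by rewrite ge_min lexx orbT.
Qed.

Lemma clamp_id z : strip T z -> clamp z = z.
Proof.
by case: z => [a x] [/=]; rewrite in_itv /= /clamp /= => /andP[a0 aT] _;
  rewrite min_l// max_r.
Qed.

Lemma clamp_contraction x y : `|clamp x - clamp y| <= `|x - y|.
Proof.
have key (a b : R) : a <= b ->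
    0 <= Num.max 0 (Num.min b T) - Num.max 0 (Num.min a T) <= b - a.
  move=> ab; have c0 : 0 <= b - a by rewrite subr_ge0.
  rewrite subr_ge0 lerBlDr; apply/andP; split.
    rewrite ge_max le_max lexx le_max; apply/orP; right.
    by rewrite le_min !ge_min ab lexx orbT.
  rewrite ge_max addr_ge0 ?le_max ?lexx//=.
  apply: (@le_trans _ _ (b - a + Num.min a T)); last by rewrite lerD2l le_max lexx orbT.
  by rewrite addr_minr subrK le_min !ge_min lexx lerDr c0 orbT.
rewrite !prod_normE /= ge_max !le_max lexx orbT andbT; apply/orP; left.
have [xy|/ltW yx] := lerP x.1 y.1.
  have /andP[k0 k1] := key _ _ xy.
  by rewrite distrC (ger0_norm k0).
have /andP[k0 k1] := key _ _ yx.
by rewrite (ger0_norm k0).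
Qed.

Lemma solution_extension : exists W : V -> 'rV[R]_k, exists r L : R,
  [/\ forall z, strip T z -> W z = U z, forall z, rV_ball r (W z),
      forall x y, `|W x - W y| <= L * `|x - y| &
      {ae spacetime_lebesgue R n, forall z : V, 0 < z.1 < T ->
       [/\ forall i, derivable (fun y => W y 0 i) z (dir_t R n),
         forall i j, derivable (fun y => F (W y) i j) z (dir_x R j) &
         forall i, 'D_(dir_t R n) (fun y => W y 0 i) z
           + \sum_(j < n) 'D_(dir_x R j) (fun y => F (W y) i j) z = 0]}].
Proof.
have [[M [_ bM]] [L [_ LU]] ae] := solution.
(* Bounds are available for every constant strictly above [M] or [L], hence the [+ 1]; the maximum
   with 0 makes the Lipschitz constant nonnegative. *)
exists (U \o clamp), (M + 1), (Num.max 0 L + 1); split.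
- by move=> z sz; rewrite /= clamp_id.
- by move=> z; apply: bM; [rewrite ltrDl|exact: clamp_strip].
- move=> x y; apply: (@le_trans _ _ ((Num.max 0 L + 1) * `|clamp x - clamp y|)).
    apply: (LU (Num.max 0 L + 1) _ (clamp x, clamp y)).
      by rewrite ltr_pwDr// le_max lexx orbT.
    by split; exact: clamp_strip.
  by rewrite ler_wpM2l ?clamp_contraction// addr_ge0// le_max lexx.
apply: (ae_sub _ ae) => z hz zT.
(* At interior times [clamp] is the identity on a neighbourhood, so derivatives of the extension are
   those of [U]. *)
have loc (f : 'rV[R]_k -> R) : {near z, (fun y => f (U y)) =1 (fun y => f (U (clamp y)))}.
  have oI : open [set y : V | 0 < y.1 < T].
    have -> : [set y : V | 0 < y.1 < T] = fst @^-1` `]0, T[%classic.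
      by apply/seteqP; split => y /=; rewrite in_itv.
    by apply: open_comp; [move=> y _; exact: cvg_fst|exact: interval_open].
  have := open_nbhs_nbhs (conj oI zT); apply: filterS => y /andP[y0 yT].
  by rewrite clamp_id//; split => //=; rewrite in_itv /= !ltW.
split=> [i|i j|i].
- have [d _ _] := hz zT i.
  exact: (near_eq_derivable (loc (fun u => u 0 i)) d).
- have [_ d _] := hz zT i.
  exact: (near_eq_derivable (loc (fun u => F u i j)) (d j)).
- have [_ _ e0] := hz zT i; rewrite -[RHS]e0; congr (_ + _).
    by symmetry; apply: near_eq_derive; exact: (loc (fun u => u 0 i)).
  apply: eq_bigr => j _; symmetry; apply: near_eq_derive.
  exact: (loc (fun u => F u i j)).
Qed.

End extension.

(** * Cutoffs supported in paraboloids *)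

Section cutoffs.
Variables (R : realType) (n : nat) (T c CY CZ : R).
Hypotheses (T0 : 0 < T) (c0 : 0 < c) (CY0 : 0 <= CY) (CZ0 : 0 <= CZ).
Notation V := (R * 'rV[R]_n)%type.

(** Origin of the constants: c times [slope] is the flux bound 2 n s CY, valid for |x_j| <= s, plus
    1 to spare for the zeroth order term. [curvature] solves N T'^2 = s^2 + M T', which makes s^2 -
    M t - N t^2 nonpositive for |t| >= T', negative times included. [scale] dominates (1 + CZ) times
    the square of s^2, the largest value of the argument at nonnegative times. *)
Let slope (s : R) : R := (2 * n%:R * s * CY + 1) / c.
Let curvature (T' s : R) : R := (s * s + slope s * T') / (T' * T').
Let scale (s : R) : R := (s * s) * (s * s) * (1 + CZ).

(* exp (- scale / (s^2 - M t - N t^2 - |x|^2)): M exceeds the speed of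
   propagation, N confines the support to |t| < T', and the scale factor turns
   the M-term into the zeroth order decay needed for Gronwall. *)
Definition cutoff (T' s : R) : V -> R :=
  bump (s * s / scale s) (- slope s / scale s) (- curvature T' s / scale s) (- (scale s)^-1).

Variables (T' s : R).
Hypotheses (T'0 : 0 < T') (T'T : T' < T) (s1 : 1 <= s).

Let s0 : 0 < s. Proof. exact: lt_le_trans s1. Qed.
Let slope0 : 0 < slope s.
Proof. by rewrite divr_gt0// ltr_wpDl// !mulr_ge0// ltW. Qed.
Let curvature0 : 0 < curvature T' s.
Proof. by rewrite divr_gt0 ?mulr_gt0// addr_gt0// mulr_gt0. Qed.
Let scale0 : 0 < scale s.
Proof. by rewrite mulr_gt0 ?ltr_pwDl// !mulr_gt0. Qed.

Let arg (z : V) : R := s * s - slope s * z.1 - curvature T' s * (z.1 * z.1)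
  - \sum_j (z.2 0 j * z.2 0 j).

Let argE (z : V) : paraboloid (s * s / scale s) (- slope s / scale s)
  (- curvature T' s / scale s) (- (scale s)^-1) z = arg z / scale s.
Proof. by rewrite /paraboloid /arg; ring. Qed.

Lemma cutoff_ge0 z : 0 <= cutoff T' s z.
Proof. exact: bump_ge0. Qed.

Lemma cutoff_of_class m : of_class m (cutoff T' s).
Proof. exact: bump_of_class. Qed.

Let cutoff_arg z : cutoff T' s z != 0 -> 0 < arg z.
Proof.
rewrite /cutoff /bump argE; apply: contraNT; rewrite -leNgt => h.
by rewrite gexp_eq0// pmulr_lle0// invr_gt0.
Qed.

Lemma cutoff_time z : cutoff T' s z != 0 -> `|z.1| < T'.
Proof.
move=> /cutoff_arg; rewrite /arg => h; rewrite ltNge; apply/negP => tT.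
have Q0 := space_sqr_ge0 z.
have tt : `|z.1| * T' <= z.1 * z.1.
  by rewrite -[z.1 * z.1]/(z.1 * z.1) -expr2 -real_normK ?num_real// expr2 ler_wpM2l.
have T2 : T' * T' <= z.1 * z.1 by apply: le_trans tt; rewrite ler_wpM2r// ltW.
have NE : curvature T' s * (T' * T') = s * s + slope s * T'.
  by rewrite /curvature divfK// mulf_neq0// gt_eqF.
have k1 : s * s + slope s * `|z.1| <= curvature T' s * (z.1 * z.1).
  have := slope0; rewrite /curvature; move: (slope s) => M M0.
  rewrite [leRHS]mulrAC ler_pdivlMr ?mulr_gt0// !mulrDl lerD//.
    by rewrite ler_wpM2l// mulr_ge0 ?(ltW s0).
  have -> : M * `|z.1| * (T' * T') = (M * T') * (`|z.1| * T') by ring.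
  by rewrite ler_wpM2l// mulr_ge0 ?(ltW M0) ?(ltW T'0).
have k2 : - slope s * z.1 <= slope s * `|z.1|.
  by rewrite mulNr -mulrN ler_wpM2l ?(ltW slope0)// -normrN ler_norm.
by lra.
Qed.

Lemma cutoff_gt0 z : 0 < arg z -> 0 < cutoff T' s z.
Proof.
move=> az; rewrite /cutoff /bump argE; apply: gexp_gt0.
by rewrite divr_gt0.
Qed.

(** On the support |x|^2 is at most A = s^2 + slope T', and 1 + A bounds the square root of A. *)
Definition cutoff_radius : R := T' + (1 + s * s + slope s * T').

Lemma cutoff_supported : supported cutoff_radius (cutoff T' s).
Proof.
move=> z nz; apply: contra_notP nz => /eqP nz0.
have t1 := cutoff_time nz0; have := cutoff_arg nz0; rewrite /arg => h.
have k2 : - slope s * z.1 <= slope s * `|z.1|.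
  by rewrite mulNr -mulrN ler_wpM2l ?(ltW slope0)// -normrN ler_norm.
have k3 : slope s * `|z.1| <= slope s * T' by rewrite ler_wpM2l ?ltW.
have k4 : 0 <= curvature T' s * (z.1 * z.1).
  by rewrite mulr_ge0 ?(ltW curvature0)// -expr2 sqr_ge0.
have B0 : 0 <= s * s + slope s * T' by rewrite addr_ge0// mulr_ge0// ltW.
rewrite /st_ball /= prod_normE /= ge_max /cutoff_radius; apply/andP; split.
  by lra.
apply: norm_rV_le; first by have := T'0; lra.
move=> j; have sj := space_sqr_le z j.
have : `|z.2 0 j| <= 1 + s * s + slope s * T'.
  rewrite -(@ler_pXn2r _ 2)// ?nnegrE//; last by lra.
  by rewrite real_normK ?num_real// !expr2; nra.
by have := T'0; lra.
Qed.

Lemma cutoff_test : test_function T (cutoff T' s).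
Proof.
have cl (A : set V) : closed A -> [set z | cutoff T' s z != 0] `<=` A ->
    closure [set z | cutoff T' s z != 0] `<=` A.
  by move=> cA sA; rewrite (closure_id A).1//; exact: closureS.
split; first exact: cutoff_of_class.
  apply: (subclosed_compact _ (@st_ball_compact R n cutoff_radius)).
    exact: closed_closure.
  apply: cl.
    by apply: compact_closed; [exact: norm_hausdorff|exact: st_ball_compact].
  by move=> z /eqP nz; apply: contrapT => /cutoff_supported.
(* The strict inequality T' < T leaves room for taking the closure of the support. *)
move=> z /(cl [set z : V | `|z.1| <= T']) zT; split => //=.
rewrite in_itv /= -ltr_norml; apply: le_lt_trans T'T; apply: zT.
  have ct : continuous (fun z : V => `|z.1|).
    move=> y; apply: (@continuous_comp _ _ _ fst (fun t : R => `|t|)).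
      exact: cvg_fst.
    exact: norm_continuous.
  exact: (@closed_comp _ _ (fun z : V => `|z.1|) _ (in1W ct) (@closed_le R T')).
by move=> y /cutoff_time /ltW.
Qed.

(** Write l = 1 / scale, let phi be the argument of the exponential bump and g2 = gexp 2 phi, so
    that the cutoff is phi^2 g2. The time derivative contributes at most - g2 l slope c D; at
    nonnegative times the curvature only helps. The flux contributes at most g2 l 2 n s CY D, and
    the zeroth order term with CZ + 1 at most g2 l D. These three bounds add up to 0, and the extra
    unit in CZ + 1 is the right-hand side. *)
Lemma cutoff_decay z (H D : R) (Y : 'I_n -> R) : 0 <= z.1 -> 0 <= D -> c * D <= H ->
  (forall j, `|Y j| <= CY * D) ->
  'D_(dir_t R n) (cutoff T' s) z * H + \sum_j 'D_(dir_x R j) (cutoff T' s) z * Y j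
  + cutoff T' s z * (CZ * D) <= - (cutoff T' s z * D).
Proof.
move=> t0 D0 HD YD; rewrite bump_dir_t.
under eq_bigr => j _ do rewrite bump_dir_x.
rewrite /cutoff /bump argE; set phi := arg z / scale s.
have [phi0|phi0] := lerP phi 0.
  rewrite !gexp_eq0// mulr0 !mul0r oppr0 add0r addr0 big1// => j _.
  by rewrite mulr0 mul0r.
have arg0 : 0 < arg z by move: phi0; rewrite /phi pmulr_lgt0// invr_gt0.
have Q0 := space_sqr_ge0 z.
have k1 : 0 <= slope s * z.1 by rewrite mulr_ge0// ltW.
have k2 : 0 <= curvature T' s * (z.1 * z.1).
  by rewrite mulr_ge0 ?(ltW curvature0)// -expr2 sqr_ge0.
have argle : arg z <= s * s by rewrite /arg; lra.
have Qle : \sum_j (z.2 0 j * z.2 0 j) <= s * s by move: arg0; rewrite /arg; lra.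
have xs j : `|z.2 0 j| <= s.
  rewrite -(@ler_pXn2r _ 2)// ?nnegrE ?(ltW s0)// real_normK ?num_real// !expr2.
  exact: le_trans (space_sqr_le z j) Qle.
(* Brings out the factor [gexp 2], which the derivatives of the cutoff already carry. *)
rewrite (gexpS 0) (gexpS 1); set g2 := gexp 2 phi.
have g0 : 0 <= g2 by exact: gexp_ge0.
pose l := (scale s)^-1; have l0 : 0 < l by rewrite invr_gt0.
have lE : l * scale s = 1 by rewrite mulVf// gt_eqF.
have gl : 0 <= g2 * l by rewrite mulr_ge0// ltW.
have b1 : (- slope s / scale s + 2 * (- curvature T' s / scale s) * z.1) * g2 * H <=
    g2 * l * (- (slope s * (c * D))).
  have -> : (- slope s / scale s + 2 * (- curvature T' s / scale s) * z.1) * g2 * H =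
     g2 * l * (- (slope s * H) - 2 * (curvature T' s * z.1 * H)) by rewrite /l; ring.
  have H0 : 0 <= H by apply: le_trans HD; rewrite mulr_ge0// ltW.
  have k3 : 0 <= curvature T' s * z.1 * H.
    by rewrite mulr_ge0 ?H0 // mulr_ge0 ?(ltW curvature0).
  have k4 : slope s * (c * D) <= slope s * H by rewrite ler_wpM2l// ltW.
  by rewrite ler_wpM2l//; lra.
have b2 : \sum_j 2 * - (scale s)^-1 * z.2 0 j * g2 * Y j <=
    g2 * l * (n%:R * (2 * s * (CY * D))).
  have -> : n%:R * (2 * s * (CY * D)) = \sum_(j < n) (2 * s * (CY * D)).
    by rewrite sumr_const card_ord mulr_natl.
  rewrite mulr_sumr; apply: ler_sum => j _.
  have -> : 2 * - (scale s)^-1 * z.2 0 j * g2 * Y j = g2 * l * (2 * - (z.2 0 j * Y j)).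
    by rewrite /l; ring.
  rewrite ler_wpM2l// -mulrA ler_wpM2l//.
  apply: le_trans (ler_norm _) _; rewrite normrN normrM.
  by rewrite ler_pM.
have b3 : phi * (phi * g2) * ((CZ + 1) * D) <= g2 * l * D.
  have -> : phi * (phi * g2) * ((CZ + 1) * D) = g2 * l * D * (arg z * arg z * (CZ + 1) * l).
    by rewrite /phi /l; ring.
  rewrite ler_piMr ?mulr_ge0// ?(ltW l0)//.
  apply: (@le_trans _ _ (scale s * l)); last by rewrite mulrC lE.
  rewrite ler_wpM2r ?(ltW l0)//.
  rewrite /scale [1 + CZ]addrC ler_wpM2r ?addr_ge0//.
  by rewrite ler_pM// ltW.
have cE : slope s * (c * D) = (2 * n%:R * s * CY + 1) * D.
  by rewrite /slope mulrA divfK// gt_eqF.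
have key : g2 * l * (- (slope s * (c * D))) + g2 * l * (n%:R * (2 * s * (CY * D))) +
    g2 * l * D = 0 by rewrite cE; ring.
have e3 : phi * (phi * g2) * (CZ * D) = phi * (phi * g2) * ((CZ + 1) * D) -
  phi * (phi * g2) * D by ring.
rewrite e3 addrA; apply: (@le_trans _ _ (0 - phi * (phi * g2) * D)); last by rewrite sub0r.
by rewrite lerD2r; apply: le_trans (lerD (lerD b1 b2) b3) _; rewrite key.
Qed.

End cutoffs.

Section cutoff_exhaustion.
Variables (R : realType) (n : nat) (c CY CZ : R).
Hypotheses (c0 : 0 < c) (CY0 : 0 <= CY) (CZ0 : 0 <= CZ).
Notation V := (R * 'rV[R]_n)%type.

(** With th = t / T' the argument is s^2 (1 - th^2) minus terms that grow at most linearly in s,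
    since the slope is affine in s; as th < 1, the square wins for large s. *)
Lemma cutoff_eventually (T' : R) (z : V) : 0 <= z.1 < T' ->
  exists j : nat, 0 < cutoff c CY CZ T' j.+1%:R z.
Proof.
move=> /andP[t0 tT]; have T'0 : 0 < T' by exact: le_lt_trans tT.
pose Q := \sum_j (z.2 0 j * z.2 0 j); have Q0 : 0 <= Q by exact: space_sqr_ge0.
pose th := z.1 / T'.
have th0 : 0 <= th by rewrite divr_ge0// ltW.
have th1 : th < 1 by rewrite ltr_pdivrMr// mul1r.
have d0 : 0 < 1 - th * th by nra.
pose g := z.1 + T' * (th * th).
have g0 : 0 <= g.
  by apply: addr_ge0 => //; apply: mulr_ge0; [exact: ltW|exact: mulr_ge0].
pose al := 2 * n%:R * CY / c; have al0 : 0 <= al by rewrite divr_ge0 ?mulr_ge0// ltW.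
have be0 : 0 <= c^-1 by rewrite invr_ge0 ltW.
pose x := (al * g + c^-1 * g + Q + 1) / (1 - th * th).
have x0 : 0 <= x by rewrite divr_ge0 ?(ltW d0)// !addr_ge0// mulr_ge0.
exists (Num.trunc x); set s : R := _.+1%:R.
have s1 : 1 <= s by rewrite ler1n.
have xs : x < s by exact: truncnS_gt.
apply: cutoff_gt0 => //.
have -> : s * s - (2 * n%:R * s * CY + 1) / c * z.1 -
    (s * s + (2 * n%:R * s * CY + 1) / c * T') / (T' * T') * (z.1 * z.1) - Q =
    s * (s * (1 - th * th)) - (al * s + c^-1) * g - Q.
  by rewrite /g /al /th; field; rewrite !gt_eqF.
have sd : al * g + c^-1 * g + Q + 1 <= s * (1 - th * th).
  by rewrite -ler_pdivrMr// ltW.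
have sg : s * (al * g + c^-1 * g + Q + 1) <= s * (s * (1 - th * th)).
  by rewrite ler_wpM2l// ler0n.
have k1 : 0 <= (s - 1) * (c^-1 * g + Q + 1).
  by rewrite mulr_ge0 ?subr_ge0// !addr_ge0// mulr_ge0.
nra.
Qed.

(** The ratio is strictly between 0 and 1, so each of these times is admissible as T', and they
    increase to T. *)
Lemma time_exhaustion (T t : R) : 0 < T -> t < T ->
  exists i : nat, t < T * (i.+1%:R / i.+2%:R).
Proof.
move=> T0 tT; pose x := T / (T - t).
have x0 : 0 <= x by rewrite divr_ge0// ?subr_ge0 ltW.
exists (Num.trunc x); set i := Num.trunc x.
have xi : x < i.+1%:R by exact: truncnS_gt.
have Tt : T < i.+1%:R * (T - t) by rewrite -ltr_pdivrMr// subr_gt0.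
rewrite mulrA ltr_pdivlMr// -[i.+2]addn1 natrD.
have := ltW tT; nra.
Qed.

End cutoff_exhaustion.

(** * Integrability of the averaged terms *)

Section integrability.
Variables (R : realType) (n k : nat) (T : R).
Notation V := (R * 'rV[R]_n)%type.
Notation st := (spacetime_lebesgue R n).
Notation sp := (space_lebesgue R n).
Variables (nu : V -> probability 'rV[R]_k R) (r : R).
Hypothesis nu_measurable : forall B : set 'rV[R]_k, measurable B ->
  measurable_fun (strip T : set (spacetime_type R n))
    (fun z : spacetime_type R n => nu z B).
Hypothesis nu_ball : forall z, strip T z -> concentrated r (nu z).

Definition strip_integrable (f : V -> R) : Prop :=
  st.-integrable (strip T) (EFin \o f).

Definition space_integrable (f : 'rV[R]_n -> R) : Prop :=
  sp.-integrable setT (EFin \o f).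

Let mS := @strip_measurable R n T.

Lemma strip_integrableD f g : strip_integrable f -> strip_integrable g ->
  strip_integrable (fun z => f z + g z).
Proof. by move=> fi gi; exact: (integrableD mS fi gi). Qed.

Lemma strip_integrableN f : strip_integrable f -> strip_integrable (fun z => - f z).
Proof. by move=> fi; exact: (integrableN fi). Qed.

Lemma strip_integrableZ c f : strip_integrable f -> strip_integrable (fun z => c * f z).
Proof. by move=> fi; exact: (integrableZl mS c fi). Qed.

Lemma strip_integrable0 : strip_integrable (fun=> 0).
Proof. exact: integrable0. Qed.

Lemma strip_integrable_sum (I : Type) (s : seq I) (f : I -> V -> R) :
  (forall i, strip_integrable (f i)) -> strip_integrable (fun z => \sum_(i <- s) f i z).
Proof.
move=> fi; elim: s => [|i s ih].
  by under eq_fun do rewrite big_nil; exact: strip_integrable0.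
by under eq_fun do rewrite big_cons; exact: strip_integrableD.
Qed.

Lemma Rintegral_strip_sum (I : Type) (s : seq I) (f : I -> V -> R) :
  (forall i, strip_integrable (f i)) ->
  \int[st]_(z in strip T) (\sum_(i <- s) f i z) =
  \sum_(i <- s) \int[st]_(z in strip T) f i z.
Proof.
move=> fi; elim: s => [|i s ih].
  rewrite big_nil; under eq_Rintegral do rewrite big_nil.
  by rewrite /Rintegral integral0.
rewrite big_cons -ih -RintegralD; [|exact: mS|exact: (fi i)|exact: strip_integrable_sum].
by apply: eq_Rintegral => z _; rewrite big_cons.
Qed.

Lemma continuous_strip_integrable w rad : continuous w -> supported rad w ->
  strip_integrable w.
Proof.
move=> cw sw; have := continuous_supported_integrable measurableT cw sw.
by apply: integrableS.
Qed.

Lemma avg_bounded g : continuous g -> exists2 C : R, 0 <= C &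
  forall z, strip T z -> `|avg (nu z) g| <= C.
Proof.
move=> cg; have [C C0 gC] := rV_ball_bound r cg; exists C => // z sz.
exact: (avg_norm_le (nu_ball sz)).
Qed.

Lemma avg_strip_integrable w rad g : continuous w -> supported rad w -> continuous g ->
  strip_integrable (fun z => w z * avg (nu z) g).
Proof.
move=> cw sw cg; have [C C0 gC] := avg_bounded cg.
have [M M0 wM] := bounded_support_bound cw sw.
apply: (@st_support_integrable _ _ _ rad (M * C) _ mS).
- apply: measurable_funM.
    by apply: measurable_funTS; exact: continuous_st_measurable.
  exact: (avg_measurable_fun mS nu_measurable cg).
- by move=> z sz; rewrite normrM ler_pM// gC.
- by move=> z _ nz; rewrite sw// mul0r.
Qed.

Lemma continuous_slice (w : V -> R) t : continuous w ->
  continuous (fun x : 'rV[R]_n => w (t, x)).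
Proof.
move=> cw x; apply: (@continuous_comp _ _ _ (fun x : 'rV[R]_n => (t, x)) w).
  exact: (@cvg_pair _ _ _ (nbhs x) (nbhs t) (nbhs x) _ _ _ (cst t) id (cvg_cst t) cvg_id).
exact: cw.
Qed.

Lemma continuous_space_integrable (w : V -> R) rad : continuous w -> supported rad w ->
  space_integrable (fun x => w (0, x)).
Proof.
move=> cw sw.
have pr := @completion_preserving _ _ _ (lebesgue_rV R n).
have [M M0 wM] := bounded_support_bound cw sw.
have mf : measurable_fun setT (fun x : 'rV[R]_n => w (0, x)).
  by apply: continuous_measurable_rV_R; exact: continuous_slice.
have i0 : (lebesgue_rV R n).-integrable setT (EFin \o (fun x => w (0, x))).
  apply: (bounded_support_integrable measurableT (@rV_box_measurable R n rad)
    (@lebesgue_rV_box_lty R n rad) (C := M)) => // x _ nx.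
  rewrite sw// /st_ball /= prod_normE /= ge_max => /andP[_ xr].
  by apply: nx; exact: rV_box_norm.
exact: (preserving_integrable pr measurableT i0).
Qed.

Lemma space_integrableD f g : space_integrable f -> space_integrable g ->
  space_integrable (fun z => f z + g z).
Proof. by move=> fi gi; exact: (integrableD measurableT fi gi). Qed.

Lemma space_integrable_sum (I : Type) (s : seq I) (f : I -> 'rV[R]_n -> R) :
  (forall i, space_integrable (f i)) -> space_integrable (fun z => \sum_(i <- s) f i z).
Proof.
move=> fi; elim: s => [|i s ih].
  by under eq_fun do rewrite big_nil; exact: integrable0.
by under eq_fun do rewrite big_cons; exact: space_integrableD.
Qed.

Lemma Rintegral_space_sum (I : Type) (s : seq I) (f : I -> 'rV[R]_n -> R) :
  (forall i, space_integrable (f i)) ->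
  \int[sp]_x (\sum_(i <- s) f i x) = \sum_(i <- s) \int[sp]_x f i x.
Proof.
move=> fi; elim: s => [|i s ih].
  rewrite big_nil; under eq_Rintegral do rewrite big_nil.
  by rewrite /Rintegral integral0.
rewrite big_cons -ih -RintegralD; [|exact: measurableT|exact: (fi i)|exact: space_integrable_sum].
by apply: eq_Rintegral => z _; rewrite big_cons.
Qed.

Lemma supported_mul rad w (g : V -> R) : supported rad w -> supported rad (fun z => w z * g z).
Proof. by move=> sw z nz; rewrite sw// mul0r. Qed.

Lemma test_function_mul (psi g : V -> R) : test_function T psi ->
  (forall m, of_class m g) -> test_function T (fun z => psi z * g z).
Proof.
move=> [spsi cpsi psiT] sg.
have sub : closure [set z | psi z * g z != 0] `<=` closure [set z | psi z != 0].
  by apply: closureS => z /=; rewrite mulf_eq0 negb_or => /andP[].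
split; first by move=> m; exact: of_class_mul.
  by apply: subclosed_compact cpsi sub; exact: closed_closure.
exact: subset_trans psiT.
Qed.

End integrability.

(** * Testing the weak formulation *)

Section weak_inequality.
Variables (R : realType) (n k : nat) (T : R) (F : 'rV[R]_k -> 'M[R]_(k, n)).
Variables (eta : 'rV[R]_k -> R) (q : 'rV[R]_k -> 'rV[R]_n).
Notation V := (R * 'rV[R]_n)%type.
Notation st := (spacetime_lebesgue R n).
Notation sp := (space_lebesgue R n).
Variables (W : V -> 'rV[R]_k) (nu : V -> probability 'rV[R]_k R) (r : R).
Hypotheses (T0 : 0 < T) (cW : continuous W).
Hypotheses (cF : continuous F) (ceta : continuous eta) (cq : continuous q).
Hypothesis mvs : bounded_admissible_mvs T F eta q (fun x => W (0, x)) nu.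
Hypothesis nu_ball : forall z, strip T z -> concentrated r (nu z).

Definition balance_at (psi : V -> R) (p : 'I_k -> V -> R) (s : V -> R) (t : 'I_n -> V -> R)
    (z : V) : R :=
  tested_balance (psi z) ('D_(dir_t R n) psi z) (fun j => 'D_(dir_x R j) psi z)
    (avg (nu z) eta) (fun j => avg (nu z) (fun xi => q xi 0 j))
    (fun i => avg (nu z) (fun xi => xi 0 i)) (fun i j => avg (nu z) (fun xi => F xi i j))
    (fun i => p i z) (fun i => 'D_(dir_t R n) (p i) z) (fun i j => 'D_(dir_x R j) (p i) z)
    (s z) ('D_(dir_t R n) s z) (fun j => t j z) (fun j => 'D_(dir_x R j) (t j) z).

(** The boundary contribution of time 0. It vanishes for the exact fields, because eta (U) = P . U +
    sigma. *)
Definition initial_defect (p : 'I_k -> V -> R) (s : V -> R) (x : 'rV[R]_n) : R :=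
  eta (W (0, x)) - \sum_i p i (0, x) * W (0, x) 0 i - s (0, x).

(** Integrability belongs to the conclusion because the pointwise bound on the integrand is later
    integrated by monotonicity. *)
Lemma weak_inequality psi rad p s t :
  test_function T psi -> (forall z, 0 <= psi z) -> supported rad psi ->
  (forall m i, of_class m (p i)) -> (forall m, of_class m s) ->
  (forall m j, of_class m (t j)) ->
  strip_integrable T (balance_at psi p s t) /\
  0 <= \int[st]_(z in strip T) balance_at psi p s t z
     + \int[sp]_x (psi (0, x) * initial_defect p s x).
Proof.
move=> tpsi psi0 spsi sp_ ss stj.
have nm := mvs_measurable mvs.
have spsi' m : of_class m psi by case: tpsi.
have cD (f : V -> R) v : (forall m, of_class m f) -> continuous (fun z => 'D_v f z).
  by move=> sf; case: (sf 1%N) => _ /(_ v).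
have dd (f : V -> R) v z : (forall m, of_class m f) -> derivable f z v.
  by move=> sf; apply: diff_derivable; case: (sf 1%N).
have cpsi : continuous psi by exact: (spsi' 0%N).
have cX i : continuous (fun xi : 'rV[R]_k => xi 0 i) by exact: continuous_coord.
have cFij i j : continuous (fun xi => F xi i j) by exact: (@of_class_coord _ _ 0).
have cqj j : continuous (fun xi => q xi 0 j) by exact: (@of_class_coord _ _ 0 1 n q 0 j).
have sDpsi v : supported rad (fun z => 'D_v psi z) by exact: derive_support.
have smul (g : V -> R) : (forall m, of_class m g) -> forall m, of_class m (fun z => psi z * g z).
  by move=> sg m; exact: of_class_mul.
have DM (g : V -> R) v z : (forall m, of_class m g) ->
    'D_v (fun z => psi z * g z) z = psi z * 'D_v g z + g z * 'D_v psi z.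
  by move=> sg; have := @deriveM _ _ psi g z v (dd psi v z spsi') (dd g v z sg).
pose fE z := 'D_(dir_t R n) psi z * avg (nu z) eta +
  \sum_(j < n) 'D_(dir_x R j) psi z * avg (nu z) (fun xi => q xi 0 j).
pose fS i z := 'D_(dir_t R n) (fun z => psi z * p i z) z * avg (nu z) (fun xi => xi 0 i) +
  \sum_(j < n) 'D_(dir_x R j) (fun z => psi z * p i z) z * avg (nu z) (fun xi => F xi i j).
pose fs z := 'D_(dir_t R n) (fun z => psi z * s z) z.
pose ft j z := 'D_(dir_x R j) (fun z => psi z * t j z) z.
have iE : strip_integrable T fE.
  apply: strip_integrableD.
    exact: (avg_strip_integrable nm nu_ball (cD _ _ spsi') (sDpsi _) ceta).
  apply: strip_integrable_sum => j.
  exact: (avg_strip_integrable nm nu_ball (cD _ _ spsi') (sDpsi _) (cqj j)).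
have sD (g : V -> R) v : (forall m, of_class m g) ->
    supported rad (fun z => 'D_v (fun z => psi z * g z) z).
  by move=> sg; apply: derive_support; exact: supported_mul.
have iS i : strip_integrable T (fS i).
  apply: strip_integrableD.
    exact: (avg_strip_integrable nm nu_ball (cD _ _ (smul _ (sp_^~ i))) (sD _ _ (sp_^~ i)) (cX i)).
  apply: strip_integrable_sum => j.
  exact: (avg_strip_integrable nm nu_ball (cD _ _ (smul _ (sp_^~ i)))
    (sD _ _ (sp_^~ i)) (cFij i j)).
have is_ : strip_integrable T fs.
  exact: (continuous_strip_integrable T (cD _ _ (smul _ ss)) (sD _ _ ss)).
have it j : strip_integrable T (ft j).
  exact: (continuous_strip_integrable T (cD _ _ (smul _ (stj^~ j))) (sD _ _ (stj^~ j))).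
have balE z : balance_at psi p s t z =
    fE z - \sum_i fS i z - fs z - \sum_j ft j z.
  rewrite /balance_at /tested_balance /fE /fs DM//; congr (_ - _ - _ - _).
    apply: eq_bigr => i _; rewrite /fS DM//; congr (_ + _).
    by apply: eq_bigr => j _; rewrite DM.
  by apply: eq_bigr => j _; rewrite /ft DM.
have iSS := strip_integrable_sum (index_enum 'I_k) iS.
have itt := strip_integrable_sum (index_enum 'I_n) it.
have i1 := strip_integrableD iE (strip_integrableN iSS).
have i2 := strip_integrableD i1 (strip_integrableN is_).
have i3 := strip_integrableD i2 (strip_integrableN itt).
have mS := @strip_measurable R n T.
have balI : \int[st]_(z in strip T) balance_at psi p s t z =
    \int[st]_(z in strip T) fE z - \sum_i \int[st]_(z in strip T) fS i z
    - \int[st]_(z in strip T) fs z - \sum_j \int[st]_(z in strip T) ft j z.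
  rewrite -!Rintegral_strip_sum// -!RintegralB//.
  by apply: eq_Rintegral => z _; exact: balE.
split; first by move: i3; apply: eq_integrable => // z _ /=; rewrite balE.
have cw (g : V -> R) : continuous g -> space_integrable (fun x => psi (0, x) * g (0, x)).
  move=> cg; apply: (@continuous_space_integrable _ _ (fun z => psi z * g z) rad).
    exact: (@of_class_mul _ _ 0).
  exact: supported_mul.
have cWi i : continuous (fun z => W z 0 i).
  by move=> z; apply: (@continuous_comp _ _ _ W (fun u : 'rV[R]_k => u 0 i));
    [exact: cW|exact: cX].
have j1 : space_integrable (fun x => psi (0, x) * eta (W (0, x))).
  apply: (cw (fun z => eta (W z))) => z.
  by apply: (@continuous_comp _ _ _ W eta); [exact: cW|exact: ceta].
have j2 i : space_integrable (fun x => psi (0, x) * p i (0, x) * W (0, x) 0 i).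
  have := cw (fun z => p i z * W z 0 i); rewrite /space_integrable.
  move=> h; have {h} := h (@of_class_mul _ _ 0 _ _ (sp_ 0%N i) (cWi i)).
  by apply: eq_integrable => // x _ /=; rewrite mulrA.
have j3 : space_integrable (fun x => psi (0, x) * s (0, x)) by exact: (cw s (ss 0%N)).
have j22 := space_integrable_sum (index_enum 'I_k) j2.
have defI : \int[sp]_x (psi (0, x) * initial_defect p s x) =
    \int[sp]_x (psi (0, x) * eta (W (0, x)))
    - \sum_i \int[sp]_x (psi (0, x) * p i (0, x) * W (0, x) 0 i)
    - \int[sp]_x (psi (0, x) * s (0, x)).
  rewrite -Rintegral_space_sum// -RintegralB// -RintegralB//; last first.
    exact: (integrableB measurableT j1 j22).
  apply: eq_Rintegral => x _; rewrite /initial_defect !mulrBr mulr_sumr.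
  by congr (_ - _ - _); apply: eq_bigr => i _; rewrite mulrA.
have entropy := mvs_entropy mvs tpsi psi0.
have system i := mvs_system mvs i (test_function_mul tpsi (sp_^~ i)).
(* The support lies in times strictly below [T], so integrating by parts in time leaves a boundary
   term at time 0 only. *)
have psiT x : psi (T, x) = 0.
  have [_ _ sub] := tpsi; apply/eqP; apply: contraT => nz.
  have /sub[/=] : closure [set z | psi z != 0] (T, x) by apply: subset_closure.
  by rewrite in_itv /= ltxx andbF.
have psT x : psi (T, x) * s (T, x) = 0 by rewrite psiT mul0r.
have divt := integral_derive_t T0 (smul s ss 1%N) (supported_mul s spsi) psT.
have divx j : \int[st]_(z in strip T) ft j z = 0.
  exact: (integral_derive_x T (v := dir_x R j) erefl (smul _ (stj^~ j) 1%N)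
    (supported_mul (t j) spsi)).
have sys : \sum_i \int[st]_(z in strip T) fS i z =
    - \sum_i \int[sp]_x (psi (0, x) * p i (0, x) * W (0, x) 0 i).
  rewrite -sumrN; apply: eq_bigr => i _; apply/eqP; rewrite -addr_eq0; apply/eqP.
  exact: system.
have divs : \sum_j \int[st]_(z in strip T) ft j z = 0 by rewrite big1.
rewrite balI defI sys divs.
move: entropy divt; rewrite -/fE -/fs.
set a := Rintegral _ _ _; set b := Rintegral _ _ _; set c := Rintegral _ _ _.
set d := Rintegral _ _ _; set e := bigop _ _ _ => h1 h2.
have -> : a - - e - c - 0 + (b - e - d) = a + b - (c + d) by ring.
by rewrite h2 subr0.
Qed.

End weak_inequality.

(** * The relative entropy estimate *)

Section relative_entropy.
Variables (R : realType) (n k : nat) (T : R) (F : 'rV[R]_k -> 'M[R]_(k, n)).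
Variables (eta : 'rV[R]_k -> R) (q : 'rV[R]_k -> 'rV[R]_n) (c0 : R).
Hypotheses (sF : of_class 2 F) (entropy : strictly_convex_entropy F eta q c0).
Notation V := (R * 'rV[R]_n)%type.
Notation st := (spacetime_lebesgue R n).
Notation sp := (space_lebesgue R n).
Variables (W : V -> 'rV[R]_k) (r L : R).
Hypotheses (T0 : 0 < T) (Wr : forall z, rV_ball r (W z)).
Hypothesis WL : forall x y, `|W x - W y| <= L * `|x - y|.
Hypothesis W_solution : {ae st, forall z : V, 0 < z.1 < T ->
     [/\ forall i, derivable (fun y => W y 0 i) z (dir_t R n),
         forall i j, derivable (fun y => F (W y) i j) z (dir_x R j) &
         forall i, 'D_(dir_t R n) (fun y => W y 0 i) z
           + \sum_(j < n) 'D_(dir_x R j) (fun y => F (W y) i j) z = 0]}.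
Variable nu : V -> probability 'rV[R]_k R.
Hypothesis mvs : bounded_admissible_mvs T F eta q (fun x => W (0, x)) nu.
Hypothesis nu_ball : forall z, strip T z -> concentrated r (nu z).

Let seta : of_class 2 eta. Proof. by case: entropy. Qed.
Let sFij i j : of_class 2 (fun u => F u i j). Proof. exact: of_class_coord. Qed.
Let sqj j : of_class 2 (fun u => q u 0 j).
Proof. by apply: of_class_coord; case: entropy. Qed.
Let cX (i : 'I_k) : continuous (fun xi : 'rV[R]_k => xi 0 i).
Proof. exact: continuous_coord. Qed.

Lemma norm_sqr_le_sqdist (u x : 'rV[R]_k) : `|x - u| ^+ 2 <= sqdist u x.
Proof.
have s0 := sqdist_ge0 u x.
rewrite -[leRHS]sqr_sqrtr// lerXn2r ?nnegrE ?sqrtr_ge0//.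
apply: norm_rV_le; first exact: sqrtr_ge0.
move=> i; rewrite -sqrtr_sqr ler_sqrt// /sqdist (bigD1 i)//= !mxE expr2 lerDl.
by rewrite sumr_ge0// => j _; rewrite -expr2 sqr_ge0.
Qed.

(** The common shape of all Taylor remainders in the state variable; averaging them produces the
    relative quantities. *)
Lemma avg_affine m (f : 'rV[R]_k -> R) (I : finType) (c b : I -> R)
    (g : I -> 'rV[R]_k -> R) (a : R) : concentrated r m -> continuous f ->
  (forall i, continuous (g i)) ->
  continuous (fun x => f x - a - \sum_i c i * (g i x - b i)) /\
  avg m (fun x => f x - a - \sum_i c i * (g i x - b i)) =
  avg m f - a - \sum_i c i * (avg m (g i) - b i).
Proof.
move=> mr cf cg.
have cc (w : R) : continuous (fun _ : 'rV[R]_k => w) by exact: (@of_class_cst _ _ 0).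
have cB (f1 f2 : 'rV[R]_k -> R) : continuous f1 -> continuous f2 ->
    continuous (fun x => f1 x - f2 x).
  by move=> h1 h2; apply: (@of_class_add _ _ 0) => //; exact: (@of_class_opp _ _ 0).
have cM (w : R) (f1 : 'rV[R]_k -> R) : continuous f1 -> continuous (fun x => w * f1 x).
  by move=> h1; exact: (@of_class_mul _ _ 0).
have cS : continuous (fun x => \sum_i c i * (g i x - b i)).
  by apply: (@of_class_sum _ _ 0) => i; apply: cM; exact: cB.
split; first by apply: (cB _ _ _ cS); exact: cB.
rewrite (avg_sub mr (cB _ _ cf (cc a)) cS) (avg_sub mr cf (cc a)) (avg_cst m).
rewrite (avg_sum mr); last by move=> i; apply: cM; exact: cB.
congr (_ - _); apply: eq_bigr => i _.
by rewrite (avg_scale mr _ (cB _ _ (cg i) (cc (b i)))) (avg_sub mr (cg i) (cc (b i))) (avg_cst m).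
Qed.

Lemma avg_abs_le m (f g : 'rV[R]_k -> R) : concentrated r m -> continuous f ->
  continuous g -> (forall x, rV_ball r x -> `|f x| <= g x) -> `|avg m f| <= avg m g.
Proof.
move=> mr cf cg fg.
have cN : continuous (fun x => -1 * g x).
  by apply: (@of_class_mul _ _ 0) => //; exact: (@of_class_cst _ _ 0).
rewrite ler_norml; apply/andP; split.
  have := avg_le mr cN cf; rewrite (avg_scale mr) // mulN1r; apply => x /fg.
  by rewrite ler_norml mulN1r => /andP[].
by apply: (avg_le mr cf cg) => x /fg; rewrite ler_norml => /andP[].
Qed.

Definition distance (z : V) : R := avg (nu z) (sqdist (W z)).

Lemma sum_sub (I : finType) (c x b : I -> R) :
  \sum_i c i * (x i - b i) = \sum_i c i * x i - \sum_i c i * b i.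
Proof. by rewrite -sumrB; apply: eq_bigr => i _; rewrite mulrBr. Qed.

Lemma distance_ge0 z : strip T z -> 0 <= distance z.
Proof.
move=> sz; rewrite -(avg_cst (nu z) 0).
apply: (avg_le (nu_ball sz)); first exact: (@of_class_cst _ _ 0).
  exact: sqdist_continuous.
by move=> x _; exact: sqdist_ge0.
Qed.

(** Convexity and the Taylor bounds, averaged over xi. The values of [W] and the mass of [nu] lie in
    one ball, so the constants do not depend on [z]. *)
Lemma relative_entropy_bounds : exists CY, exists CF, [/\ 0 <= CY, 0 <= CF &
  forall z, strip T z -> let u := W z in let m := nu z in
  [/\ c0 / 2 * distance z <= avg m eta - \sum_i D_ i eta u * avg m (fun xi => xi 0 i)
        - entropy_dual eta u,
      forall j, `|avg m (fun xi => q xi 0 j)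
        - \sum_i D_ i eta u * avg m (fun xi => F xi i j) - flux_dual F eta q j u|
        <= CY * distance z &
      forall a : 'I_k * 'I_n, `|flux_remainder (fun i => avg m (fun xi => xi 0 i))
        (fun i j => avg m (fun xi => F xi i j)) (fun i => u 0 i) (fun i j => F u i j)
        (fun l a => D_ l (fun u => F u a.1 a.2) u) a| <= CF * distance z]].
Proof.
have [CY CY0 hY] := entropy_flux_taylor sF entropy r.
have [CF CF0 hF] := flux_taylor sF r.
exists CY, CF; split => // z sz u m.
have mr := nu_ball sz; have ur : rV_ball r u by exact: Wr.
have cs := @sqdist_continuous R k u.
have csc (w : R) : continuous (fun x => w * sqdist u x).
  by apply: (@of_class_mul _ _ 0) => //; exact: (@of_class_cst _ _ 0).
have le_dist (C : R) x : 0 <= C -> C * `|x - u| ^+ 2 <= C * sqdist u x.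
  by move=> C0; rewrite ler_wpM2l// norm_sqr_le_sqdist.
split.
- have [ca ea] := avg_affine (fun i => D_ i eta u) (fun i => u 0 i) (eta u) mr
    (of_class_continuous seta) cX.
  have -> : avg m eta - \sum_i D_ i eta u * avg m (fun xi => xi 0 i) - entropy_dual eta u =
      avg m (fun x => eta x - eta u - \sum_i D_ i eta u * (x 0 i - u 0 i)).
    by rewrite ea sum_sub /entropy_dual; ring.
  rewrite -(avg_scale mr _ cs); apply: (avg_le mr) => // x _.
  exact: (entropy_lower entropy).
- move=> j.
  have [ca ea] := avg_affine (fun i => D_ i eta u) (fun i => F u i j) (q u 0 j) mr
    (of_class_continuous (sqj j)) (fun i => of_class_continuous (sFij i j)).
  have -> : avg m (fun xi => q xi 0 j) - \sum_i D_ i eta u * avg m (fun xi => F xi i j)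
      - flux_dual F eta q j u =
      avg m (fun x => q x 0 j - q u 0 j - \sum_i D_ i eta u * (F x i j - F u i j)).
    by rewrite ea sum_sub /flux_dual; ring.
  rewrite -(avg_scale mr _ cs); apply: (avg_abs_le mr) => // x xr.
  by apply: le_trans (hY j u x ur xr) _; exact: le_dist.
- move=> a; rewrite /flux_remainder.
  have [ca ea] := avg_affine (fun l => D_ l (fun u => F u a.1 a.2) u) (fun l => u 0 l)
    (F u a.1 a.2) mr (of_class_continuous (sFij a.1 a.2)) cX.
  rewrite -ea -(avg_scale mr _ cs); apply: (avg_abs_le mr) => // x xr.
  by apply: le_trans (hF a.1 a.2 u x ur xr) _; exact: le_dist.
Qed.

Lemma strip_ae_eq0 (f : V -> R) : strip_integrable T f ->
  (forall z, strip T z -> 0 <= f z) -> \int[st]_(z in strip T) f z <= 0 ->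
  {ae st, forall z, strip T z -> f z = 0}.
Proof.
move=> fi f0 If.
have mS := @strip_measurable R n T.
have I0 : \int[st]_(z in strip T) f z = 0.
  by apply/eqP; rewrite eq_le If Rintegral_ge0.
have mf : measurable_fun (strip T : set (spacetime_type R n)) (EFin \o f).
  by case/integrableP: fi.
have E : (\int[st]_(z in strip T) `|(EFin \o f) z| = 0)%E.
  transitivity (\int[st]_(z in strip T) (EFin \o f) z)%E.
    by apply: eq_integral => z /set_mem sz; rewrite gee0_abs// lee_fin f0.
  have := I0; rewrite /Rintegral => h; rewrite -[LHS]fineK; first by congr EFin.
  exact: integrable_fin_num.
have [/(_ E) ae _] := ae_eq_integral_abs st mS mf.
by apply: (ae_sub _ ae) => z h sz; have [] := h sz.
Qed.

Lemma derive_bump_eq0 (a b d e : R) (v z : V) : bump a b d e z = 0 ->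
  'D_v (bump a b d e) z = 0.
Proof.
rewrite derive_bump /bump => h.
by rewrite (@gexp_eq0 _ 2) ?mulr0// leNgt; apply/negP => /(gexp_gt0 0); rewrite h ltxx.
Qed.

Lemma tested_balance0 E Q X Phi p pt px s st t tx :
  @tested_balance R k n 0 0 (fun=> 0) E Q X Phi p pt px s st t tx = 0.
Proof.
have z0 (m : nat) (f : 'I_m -> R) : (forall i, f i = 0) -> \sum_i f i = 0.
  by move=> h; rewrite big1.
have e1 : \sum_(j < n) 0 * Q j = 0 by apply: (z0 _ _) => j; rewrite mul0r.
have e2 : \sum_(i < k) ((0 * pt i + p i * 0) * X i
    + \sum_(j < n) (0 * px i j + p i * 0) * Phi i j) = 0.
  apply: (z0 _ _) => i; rewrite mul0r mulr0 addr0 mul0r add0r; apply: (z0 _ _) => j.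
  by rewrite mul0r addr0 mul0r.
have e3 : \sum_(j < n) (0 * tx j + t j * 0) = 0.
  by apply: (z0 _ _) => j; rewrite mul0r mulr0 addr0.
by rewrite /tested_balance e1 e2 e3; ring.
Qed.

(** Measurability is clear only for averages of a fixed function of xi. Expanding the square writes
    the distance as the average of |xi|^2 minus 2 W . <nu, xi> plus |W|^2, with the dependence on
    [W] outside the averages. *)
Lemma distance_integrable psi rad : continuous psi -> supported rad psi ->
  strip_integrable T (fun z => psi z * distance z).
Proof.
move=> cpsi spsi; have cW := lipschitz_continuous WL.
have nm := mvs_measurable mvs.
have cu i : continuous (fun z => W z 0 i).
  by move=> z; apply: (@continuous_comp _ _ _ W (fun u : 'rV[R]_k => u 0 i));
    [exact: cW|exact: cX].
have cM (f g : V -> R) : continuous f -> continuous g -> continuous (fun z => f z * g z).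
  exact: (@of_class_mul _ _ 0).
pose f0 (xi : 'rV[R]_k) := \sum_i xi 0 i * xi 0 i.
have cf0 : continuous f0.
  by apply: (@of_class_sum _ _ 0) => i; exact: (@of_class_mul _ _ 0).
have cu2 : continuous (fun z => \sum_i W z 0 i * W z 0 i).
  by apply: (@of_class_sum _ _ 0) => i; exact: cM.
have c2u i : continuous (fun z => psi z * (2 * W z 0 i)).
  by apply: (cM _ _) => //; apply: (cM _ _) => //; exact: (@of_class_cst _ _ 0).
have i1 := avg_strip_integrable nm nu_ball cpsi spsi cf0.
have i2 := strip_integrable_sum (index_enum 'I_k) (fun i =>
  avg_strip_integrable nm nu_ball (c2u i) (@supported_mul _ _ rad psi _ spsi) (@cX i)).
have i3 := continuous_strip_integrable T (cM _ _ cpsi cu2) (@supported_mul _ _ rad psi _ spsi).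
have ii := strip_integrableD (strip_integrableD i1 (strip_integrableN i2)) i3.
move: ii; apply: eq_integrable; first exact: strip_measurable.
move=> z /set_mem sz /=; congr EFin.
have [_ ea] := avg_affine (fun i => 2 * W z 0 i) (fun i => W z 0 i)
  (\sum_i W z 0 i * W z 0 i) (nu_ball sz) cf0 cX.
have -> : distance z = avg (nu z) (fun x => f0 x - \sum_i W z 0 i * W z 0 i -
    \sum_i 2 * W z 0 i * (x 0 i - W z 0 i)).
  congr (avg _ _); apply/funext => x; rewrite /f0 -!sumrB; apply: eq_bigr => i _.
  ring.
rewrite ea sum_sub.
have -> : \sum_i psi z * (2 * W z 0 i) * avg (nu z) (fun xi => xi 0 i) =
    psi z * \sum_i 2 * W z 0 i * avg (nu z) (fun xi => xi 0 i).
  by rewrite mulr_sumr; apply: eq_bigr => i _; ring.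
have -> : \sum_i 2 * W z 0 i * W z 0 i = 2 * \sum_i W z 0 i * W z 0 i.
  by rewrite mulr_sumr; apply: eq_bigr => i _; ring.
ring.
Qed.

Lemma le0_of_le_scaled (x C : R) : (forall e, 0 < e -> x <= e * C) -> x <= 0.
Proof.
move=> h; apply/ler_addgt0Pr => e e0; rewrite add0r.
have C1 : 0 < `|C| + 1 by rewrite ltr_wpDl.
apply: le_trans (h (e / (`|C| + 1)) (divr_gt0 e0 C1)) _.
rewrite mulrAC ler_pdivrMr// ler_wpM2l ?(ltW e0)//.
by apply: le_trans (ler_norm _) _; rewrite lerDl.
Qed.

Lemma combine_bounds (e x y d g h : R) :
  0 <= x + y -> x <= e * g - d -> y <= e * h -> d <= e * (g + h).
Proof. by move=> *; rewrite mulrDr; lra. Qed.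

(** For each cutoff the weighted integral of the distance is at most e times a constant that depends
    on the cutoff but not on e, hence it is 0. Countably many cutoffs exhaust the times before T',
    so one null set suffices. *)
Lemma distance_eq0_before (T' : R) : 0 < T' < T ->
  {ae st, forall z, strip T z -> z.1 < T' -> distance z = 0}.
Proof.
move=> T'T; have [K K0 app] := approximation sF entropy Wr WL T'T W_solution.
have [CY [CF [CY0 CF0 bounds]]] := relative_entropy_bounds.
have c0' : 0 < c0 / 2 by case: entropy => _ _ h _ _; rewrite divr_gt0.
(* The zeroth order coefficient: [K] bounds the space derivatives of [p], and one flux remainder, at
   most [CF] times the distance, occurs for each pair of indices. *)
pose CZ := K * (CF *+ #|{: 'I_k * 'I_n}|).
have CZ0 : 0 <= CZ by rewrite mulr_ge0// mulrn_wge0.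
have /andP[T'0 T'T'] := T'T.
pose psi j : V -> R := cutoff (c0 / 2) CY CZ T' j.+1%:R.
have main j : {ae st, forall z, strip T z -> psi j z * distance z = 0}.
  have s1 : 1 <= j.+1%:R :> R by rewrite ler1n.
  have tpsi : test_function T (psi j) by exact: cutoff_test.
  have psi0 z : 0 <= psi j z by exact: cutoff_ge0.
  have [rad supp] : exists rad, supported rad (psi j).
    by eexists; exact: (cutoff_supported c0' CY0 CZ0 T'0 s1).
  have cpsi : continuous (psi j) by case: tpsi => /(_ 0%N).
  have cDpsi v : continuous (fun z => 'D_v (psi j) z).
    by case: tpsi => /(_ 1%N) [_ /(_ v)].
  have sDpsi v : supported rad (fun z => 'D_v (psi j) z) by exact: derive_support.
  have r0 : 0 <= r by exact: le_trans (normr_ge0 _) (Wr 0).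
  have [BF BF0 hBF] := rV_ball_boundI r
    (fun a : 'I_k * 'I_n => of_class_continuous (sFij a.1 a.2)).
  pose B := r + BF.
  have B0 : 0 <= B by rewrite addr_ge0.
  (* Everything that multiplies [e] in [tested_balance_le]; it depends on the cutoff only. *)
  pose G z := (B *+ k + 1) * (`|'D_(dir_t R n) (psi j) z|
      + \sum_(i < n) `|'D_(dir_x R i) (psi j) z|)
    + psi j z * (1 + 1 *+ n + (B + B) *+ k).
  have G0 z : 0 <= G z.
    by rewrite addr_ge0// mulr_ge0// ?addr_ge0// ?mulrn_wge0 ?addr_ge0// sumr_ge0.
  have cnorm (f : V -> R) : continuous f -> continuous (fun z => `|f z|).
    by move=> cf z; apply: (@continuous_comp _ _ _ f (fun x : R => `|x|));
      [exact: cf|exact: norm_continuous].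
  have iG : strip_integrable T G.
    apply: (@continuous_strip_integrable _ _ _ _ rad).
      apply: (@of_class_add _ _ 0); apply: (@of_class_mul _ _ 0) => //.
      - exact: (@of_class_cst _ _ 0).
      - apply: (@of_class_add _ _ 0); first by apply: cnorm; exact: cDpsi.
        by apply: (@of_class_sum _ _ 0) => i; apply: cnorm; exact: cDpsi.
      - exact: (@of_class_cst _ _ 0).
    move=> z nz; rewrite /G (sDpsi _ _ nz) supp// normr0 big1 => [|i _].
      by rewrite mul0r !addr0 mulr0.
    by rewrite (sDpsi _ _ nz) normr0.
  have iD := distance_integrable cpsi supp.
  have pointwise e p s t z : 0 < e ->
      (forall z : V, 0 <= z.1 <= T' -> mollified F eta q W e K p s t z) ->
      strip T z -> balance_at F eta q nu (psi j) p s t z <= - (psi j z * distance z) + e * G z.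
    move=> e0 moll sz.
    (* Beyond time T' the mollified fields are not controlled, but there the cutoff vanishes
       together with its derivatives. *)
    have [pz|pz] := eqVneq (psi j z) 0.
      have Dz v : 'D_v (psi j) z = 0 by exact: derive_bump_eq0.
      have Dx : (fun i : 'I_n => 'D_(dir_x R i) (psi j) z) = fun=> 0.
        by apply/funext => i; exact: Dz.
      rewrite /balance_at pz Dz Dx.
      by rewrite tested_balance0 mul0r oppr0 add0r mulr_ge0// ltW.
    have z0 : 0 <= z.1 by case: sz => /=; rewrite in_itv /= => /andP[].
    have zT : 0 <= z.1 <= T'.
      rewrite z0 /= ltW//; apply: le_lt_trans (ler_norm _) _.
      exact: (cutoff_time c0' CY0 CZ0 T'0 s1 pz).
    have [[m1 m2 m3] m4 m5 m6 m7] := moll z zT.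
    have [bH bY bF] := bounds z sz.
    have mr := nu_ball sz.
    have coordB (x : 'rV[R]_k) i : rV_ball r x -> `|x 0 i| <= B.
      move=> xr; apply: le_trans ((@rV_basis R k).2 x i) _.
      by apply: le_trans xr _; rewrite lerDl.
    have XB i : `|avg (nu z) (fun xi => xi 0 i)| <= B.
      by apply: (avg_norm_le mr (@cX i)) => x; exact: coordB.
    have uB i : `|W z 0 i| <= B by exact: coordB.
    have PhiB i l : `|avg (nu z) (fun xi => F xi i l)| <= B.
      apply: (avg_norm_le mr (of_class_continuous (sFij i l))) => x xr.
      by apply: le_trans (hBF (i, l) x xr) _; rewrite lerDr.
    have := tested_balance_le ('D_(dir_t R n) (psi j) z)
      (fun i => 'D_(dir_x R i) (psi j) z) (avg (nu z) eta)
      (fun i => avg (nu z) (fun xi => q xi 0 i))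
      (psi0 z) m1 m2 m3 m4 m5 m6 m7 XB uB PhiB.
    move=> /le_trans; apply; rewrite lerD2r.
    set H := avg (nu z) eta - _ - _ in bH.
    apply: le_trans (cutoff_decay c0' CY0 CZ0 T'0 s1 z0 (distance_ge0 sz) bH bY).
    rewrite lerD2l ler_wpM2l// -mulrA ler_wpM2l//.
    have -> : CF *+ #|{: 'I_k * 'I_n}| * distance z =
        \sum_(a : 'I_k * 'I_n) CF * distance z by rewrite sumr_const mulrnAl.
    by apply: ler_sum => a _; exact: bF.
  apply: strip_ae_eq0 => //; first by move=> z sz; rewrite mulr_ge0// distance_ge0.
  apply: (@le0_of_le_scaled _ (\int[st]_(z in strip T) G z +
      (B *+ k + 1) * \int[sp]_x psi j (0, x))) => e e0.
  have [p [s [t [sp_ ss stj moll]]]] := app e e0.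
  have cW := lipschitz_continuous WL.
  have cq : continuous q by case: entropy => _ /of_class_continuous.
  have [ib ge0] := weak_inequality T0 cW (of_class_continuous sF)
    (of_class_continuous seta) cq mvs nu_ball tpsi psi0 supp sp_ ss stj.
  have mS := @strip_measurable R n T.
  have le1 : \int[st]_(z in strip T) balance_at F eta q nu (psi j) p s t z <=
      e * \int[st]_(z in strip T) G z - \int[st]_(z in strip T) (psi j z * distance z).
    have ieG := strip_integrableZ e iG.
    rewrite -RintegralZl; [|exact: mS|exact: iG].
    rewrite -RintegralB; [|exact: mS|exact: ieG|exact: iD].
    apply: le_Rintegral; [exact: mS|exact: ib| |].
      exact: (strip_integrableD ieG (strip_integrableN iD)).
    by move=> z sz; rewrite [leRHS]addrC; exact: pointwise.
  have le2 : \int[sp]_x (psi j (0, x) * initial_defect eta W p s x) <=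
      e * ((B *+ k + 1) * \int[sp]_x psi j (0, x)).
    have i1 : space_integrable (fun x => psi j (0, x) * initial_defect eta W p s x).
      have cWi i : continuous (fun z => W z 0 i).
        by move=> z; apply: (@continuous_comp _ _ _ W (fun u : 'rV[R]_k => u 0 i));
          [exact: cW|exact: cX].
      apply: (@continuous_space_integrable _ _ (fun z => psi j z *
        (eta (W z) - \sum_i p i z * W z 0 i - s z)) rad); last exact: supported_mul.
      apply: (@of_class_mul _ _ 0) => //; apply: (@of_class_add _ _ 0); last first.
        by apply: (@of_class_opp _ _ 0); exact: (ss 0%N).
      apply: (@of_class_add _ _ 0).
        move=> z; apply: (@continuous_comp _ _ _ W eta); first exact: cW.
        exact: (of_class_continuous seta).
      apply: (@of_class_opp _ _ 0); apply: (@of_class_sum _ _ 0) => i.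
      by apply: (@of_class_mul _ _ 0); [exact: (sp_ 0%N)|exact: cWi].
    have i2 : space_integrable (fun x => psi j (0, x)).
      exact: (continuous_space_integrable cpsi supp).
    have i3 : space_integrable (fun x => e * (B *+ k + 1) * psi j (0, x)).
      exact: (integrableZl measurableT _ i2).
    rewrite mulrA -RintegralZl//; apply: le_Rintegral => // x _.
    rewrite [leRHS]mulrC ler_wpM2l//.
    have zT : 0 <= ((0 : R), x).1 <= T' by rewrite /= lexx ltW.
    have [[m1 m2 _] _ _ _ _] := moll (0, x) zT.
    (* Regrouped as a combination of differences between exact and mollified fields at time 0. *)
    have -> : initial_defect eta W p s x = (entropy_dual eta (W (0, x)) - s (0, x)) +
        \sum_i (D_ i eta (W (0, x)) - p i (0, x)) * W (0, x) 0 i.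
      rewrite /initial_defect /entropy_dual.
      under [X in _ = _ + X]eq_bigr => i _ do rewrite mulrBl.
      by rewrite sumrB; ring.
    apply: le_trans (ler_norm _) _; apply: le_trans (ler_normD _ _) _.
    rewrite addrC mulrDr mulr1 lerD//; last by rewrite distrC.
    apply: le_trans (ler_norm_sum _ _ _) _.
    have -> : B *+ k = \sum_(i < k) B by rewrite sumr_const card_ord.
    rewrite mulr_sumr; apply: ler_sum => i _; rewrite normrM ler_pM//.
      by rewrite distrC.
    apply: le_trans ((@rV_basis R k).2 _ i) _.
    by apply: le_trans (Wr _) _; rewrite lerDl.
  exact: combine_bounds ge0 le1 le2.
apply: (ae_sub _ (ae_foralln main)) => z hz sz zT'.
have z0 : 0 <= z.1 by case: sz => /=; rewrite in_itv /= => /andP[].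
have [|j pj] := cutoff_eventually c0' CY0 CZ0 (T' := T') (z := z); first by rewrite z0.
have := hz j sz; move/eqP; rewrite mulf_eq0 => /orP[|/eqP//].
by rewrite gt_eqF.
Qed.

End relative_entropy.

(** * From all earlier times to the whole strip *)

Lemma time_slice_null (R : realType) (n : nat) (T : R) :
  {ae spacetime_lebesgue R n, forall z : R * 'rV[R]_n, z.1 != T}.
Proof.
pose S : set (R * 'rV[R]_n) := [set T] `*` [set: 'rV[R]_n].
have mS : measurable (S : set (measurableTypeR R * 'rV[R]_n)).
  by apply: measurableX => //; exact: measurable_set1.
exists S; split.
- exact: st_measurable.
- have E : spacetime_lebesgue R n S = (lebesgue_measure \x lebesgue_rV R n)%E S.
    exact: ((@st_preserving R n).2 _ mS).
  rewrite E /S product_measure1E; [|exact: measurable_set1|exact: measurableT].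
  apply: etrans (congr1 (fun x => (x * _)%E) (lebesgue_measure_set1 T)) _.
  exact: mul0e.
- by move=> z /= /negP; rewrite negbK => /eqP zT; split.
Qed.

Lemma bounded_rV_ball (R : realType) (k : nat) (K : set 'rV[R]_k) : bounded_set K ->
  exists r, K `<=` @rV_ball R k r.
Proof.
move=> [M [_ hM]]; exists (M + 1) => x Kx.
by apply: (hM (M + 1)) => //; rewrite ltrDl.
Qed.

Theorem theorem3 (R : realType) (n k : nat) (T : R)
    (F : 'rV[R]_k -> 'M[R]_(k, n))
    (eta : 'rV[R]_k -> R) (q : 'rV[R]_k -> 'rV[R]_n) (c0 : R)
    (U : R * 'rV[R]_n -> 'rV[R]_k)
    (nu : R * 'rV[R]_n -> probability 'rV[R]_k R) :
  (1 <= n)%N -> (1 <= k)%N -> 0 < T ->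
  of_class 2 F ->
  strictly_convex_entropy F eta q c0 ->
  bounded_lipschitz_solution T F U ->
  bounded_admissible_mvs T F eta q (fun x => U (0, x)) nu ->
  {ae spacetime_lebesgue R n, forall z, strip T z ->
    forall B, measurable B -> nu z B = \d_(U z) B}.
Proof.
move=> _ _ T0 sF entropy solution mvs.
have [W [r [L [WU Wr WL Wae]]]] := solution_extension T0 solution.
have [K bK subK] := mvs_bounded mvs.
have [r' Kr'] := bounded_rV_ball bK.
(* One ball for the values of the extension and for the supports of all [nu z]. *)
pose rr := Num.max r r'.
have Wrr z : rV_ball rr (W z) by apply: le_trans (Wr z) _; rewrite le_max lexx.
have nu_ball z : strip T z -> concentrated rr (nu z).
  move=> sz; apply: msupport_concentrated => x /(subK z sz) /Kr' xr.
  by apply: le_trans xr _; rewrite le_max lexx orbT.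
have U0 : (fun x => U (0, x)) = (fun x => W (0, x)).
  by apply/funext => x; rewrite WU//; split => //=; rewrite in_itv /= lexx ltW.
rewrite U0 in mvs.
have before i : {ae spacetime_lebesgue R n, forall z, strip T z ->
    z.1 < T * (i.+1%:R / i.+2%:R) -> distance W nu z = 0}.
  apply: (distance_eq0_before sF entropy T0 Wrr WL Wae mvs nu_ball).
  apply/andP; split; first by rewrite mulr_gt0// divr_gt0.
  by rewrite gtr_pMr// ltr_pdivrMr// mul1r ltr_nat.
apply: (ae_sub _ (ae_and (ae_foralln before) (time_slice_null n T))) => z [hz zT] sz B mB.
have zT' : z.1 < T.
  by case: sz => /=; rewrite in_itv /= lt_neqAle zT => /andP[].
have [i ti] := time_exhaustion T0 zT'.
rewrite -(WU z sz).
exact: (avg_eq0_dirac (nu_ball z sz) (hz i sz ti)).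
Qed.
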